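(* Let $(M,\varphi_i,\xi_i,\eta_i,g)$ be a $3$-$(\alpha,\delta)$-Sasaki manifold of dimension $4n+3$ with Riemannian curvature operator $\mathcal{R}^g$. Then the following conditions are equivalent, where $(ijk)$ denotes an even permutation of $(123)$: (a) each $2$-form $\Phi_i-\xi_{jk}$ ($i=1,2,3$) is an eigenform of $\mathcal{R}^g$; (b) each $2$-form $\Phi_i+(n+1)\xi_{jk}$ ($i=1,2,3$) is an eigenform of $\mathcal{R}^g$; (c) either $\delta=\alpha$ or $\delta=(2n+3)\alpha$; (d) $(M,g)$ is Einstein. If $\delta=\alpha$, the six orthogonal eigenforms $\Phi_i-\xi_{jk}$, $\Phi_i+(n+1)\xi_{jk}$ all have the same eigenvalue $\lambda=\alpha^2$. If $\delta=\alpha(2n+3)$, then each $\Phi_i-\xi_{jk}$ has eigenvalue $\lambda_1=\alpha^2(8n^2+16n+9)$, while each $\Phi_i+(n+1)\xi_{jk}$ has eigenvalue $\lambda_2=\alpha^2(2n+1)^2$.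
   Context: An almost contact metric structure $(\varphi,\xi,\eta,g)$ consists of a $(1,1)$-tensor $\varphi$, a vector field $\xi$, a $1$-form $\eta$ and a Riemannian metric $g$ with $\varphi^2=-I+\eta\otimes\xi$, $\eta(\xi)=1$, $\varphi\xi=0$, $\eta\circ\varphi=0$, $g(\varphi X,\varphi Y)=g(X,Y)-\eta(X)\eta(Y)$; its fundamental $2$-form is $\Phi(X,Y)=g(X,\varphi Y)$. An almost $3$-contact metric manifold $(M,\varphi_i,\xi_i,\eta_i,g)$, $i=1,2,3$, is a manifold of dimension $4n+3$ ($n\ge1$) with three almost contact metric structures sharing $g$ such that $\varphi_k=\varphi_i\varphi_j-\eta_j\otimes\xi_i=-\varphi_j\varphi_i+\eta_i\otimes\xi_j$, $\xi_k=\varphi_i\xi_j=-\varphi_j\xi_i$, $\eta_k=\eta_i\circ\varphi_j=-\eta_j\circ\varphi_i$ for every even permutation $(ijk)$ of $(123)$. It is $3$-$(\alpha,\delta)$-Sasaki, for real constants $\alpha\ne0$ and $\delta$, if $d\eta_i=2\alpha\Phi_i+2(\alpha-\delta)\eta_j\wedge\eta_k$ for every even permutation $(ijk)$, with $d\eta(X,Y)=X\eta(Y)-Y\eta(X)-\eta([X,Y])$ and $(\eta\wedge\zeta)(X,Y)=\eta(X)\zeta(Y)-\eta(Y)\zeta(X)$. Curvature: $R^g(X,Y,Z,V)=g([\nabla^g_X,\nabla^g_Y]Z-\nabla^g_{[X,Y]}Z,V)$ with $\nabla^g$ the Levi-Civita connection, and $\mathcal{R}^g\colon\Lambda^2TM\to\Lambda^2TM$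 is the symmetric operator $\langle\mathcal{R}^g(X\wedge Y),Z\wedge V\rangle=-R^g(X,Y,Z,V)$, where $\langle u_1\wedge u_2,v_1\wedge v_2\rangle=\det[g(u_i,v_j)]$. $2$-forms and $2$-vectors are identified via this inner product, so $\langle\omega,X\wedge Y\rangle=\omega(X,Y)$. Notation: $\xi_{jk}=\xi_j\wedge\xi_k=\eta_j\wedge\eta_k$. *)

(* Defs.v *)
From HB Require Import structures.
From mathcomp Require Import all_boot all_order all_algebra perm.
From mathcomp Require Import all_classical all_reals all_analysis ring.
Set Implicit Arguments.
Unset Strict Implicit.
Unset Printing Implicit Defensive.
Import Order.TTheory GRing.Theory Num.Theory.
Import numFieldNormedType.Exports.
Local Open Scope classical_set_scope.
Local Open Scope ring_scope.

(* [U] is meant to be open. *)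
Fixpoint Ck_on (R : realType) (V W : normedModType R) (k : nat) (U : set V)
    (f : V -> W) : Prop :=
  match k with
  | 0%N => forall x, U x -> {for x, continuous f}
  | k'.+1 => (forall x, U x -> differentiable f x) /\
             (forall v : V, Ck_on k' U ('D_v f))
  end.

Definition smooth_on (R : realType) (V W : normedModType R) (U : set V)
    (f : V -> W) : Prop :=
  forall k, Ck_on k U f.

(* [chart_param] inverts [chart_coord] on [chart_dom], and is only relevant on
   the image of [chart_dom] under [chart_coord]. *)
Record chart (R : realType) (m : nat) (T : Type) := Chart {
  chart_dom : set T;
  chart_coord : T -> 'rV[R]_m;
  chart_param : 'rV[R]_m -> T }.

Definition is_chart (R : realType) (m : nat) (T : topologicalType)
    (c : chart R m T) : Prop :=
  [/\ open (chart_dom c), open (chart_coord c @` chart_dom c),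
      forall p, chart_dom c p -> chart_param c (chart_coord c p) = p,
      {within chart_dom c, continuous (chart_coord c)} &
      {within chart_coord c @` chart_dom c, continuous (chart_param c)}].

(* A smooth atlas is presented as a family of charts indexed by the points, the
   chart of index [p] being defined at [p]; every smooth structure has such an
   atlas. As usual, manifolds are nonempty. *)
Record manifold (R : realType) (m : nat) := Manifold {
  points :> topologicalType;
  chart_at : points -> chart R m points;
  manifold_hausdorff : hausdorff_space points;
  manifold_countable : @second_countable points;
  manifold_nonempty : [set: points] !=set0;
  chart_atP : forall p, is_chart (chart_at p);
  chart_at_dom : forall p, chart_dom (chart_at p) p;
  chart_at_smooth : forall p q,
    smooth_on (chart_coord (chart_at p) @`
                 (chart_dom (chart_at p) `&` chart_dom (chart_at q)))
              (chart_coord (chart_at q) \o chart_param (chart_at p)) }.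

Section Fields.
Variables (R : realType) (m : nat) (M : manifold R m).

(* The tangent space at [p] is 'rV_m: a row vector is read as the components of
   a tangent vector with respect to the coordinates of [chart_at p]. Fields are
   arbitrary sections, whose smoothness near a point is a separate predicate. *)
Definition vfield := M -> 'rV[R]_m.
Definition form1 := M -> {scalar 'rV[R]_m}.
Definition form2 := M -> 'rV[R]_m -> 'rV[R]_m -> R.
Definition endo := M -> {linear 'rV[R]_m -> 'rV[R]_m}.

(* The coordinates of [p] in the chart at [p]. *)
Definition base (p : M) : 'rV[R]_m := chart_coord (chart_at p) p.

(* Change of coordinates from [chart_at q] to [chart_at p] in the tangent space
   at [q]. *)
Definition tangent_coord (q p : M) (v : 'rV[R]_m) : 'rV[R]_m :=
  'd (chart_coord (chart_at p) \o chart_param (chart_at q)) (base q) v.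

Definition local_vf (p : M) (X : vfield) (u : 'rV[R]_m) : 'rV[R]_m :=
  tangent_coord (chart_param (chart_at p) u) p (X (chart_param (chart_at p) u)).

Definition local_fun (p : M) (f : M -> R) : 'rV[R]_m -> R :=
  f \o chart_param (chart_at p).

(* Smooth on a neighbourhood of [p]. *)
Definition smooth_fun (p : M) (f : M -> R) : Prop :=
  exists2 U, open_nbhs (base p) U & smooth_on U (local_fun p f).

Definition smooth_vf (p : M) (X : vfield) : Prop :=
  exists2 U, open_nbhs (base p) U & smooth_on U (local_vf p X).

Definition smooth_form1 (a : form1) : Prop :=
  forall p X, smooth_vf p X -> smooth_fun p (fun q => a q (X q)).

Definition smooth_endo (F : endo) : Prop :=
  forall p X, smooth_vf p X -> smooth_vf p (fun q => F q (X q)).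

Definition smooth_form2 (w : form2) : Prop :=
  forall p X Y, smooth_vf p X -> smooth_vf p Y ->
    smooth_fun p (fun q => w q (X q) (Y q)).

(* X f *)
Definition vf_act (X : vfield) (f : M -> R) : M -> R := fun p =>
  'd (local_fun p f) (base p) (X p).

(* [X, Y], with components X^i d_i Y^j - Y^i d_i X^j in the chart at p. *)
Definition bracket (X Y : vfield) : vfield := fun p =>
  'd (local_vf p Y) (base p) (X p)
  - 'd (local_vf p X) (base p) (Y p).

Definition ext_d (a : form1) (X Y : vfield) : M -> R := fun p =>
  vf_act X (fun q => a q (Y q)) p - vf_act Y (fun q => a q (X q)) p
  - a p (bracket X Y p).

Definition wedge11 (a b : form1) : form2 := fun p x y =>
  a p x * b p y - a p y * b p x.

(* The i-th coordinate vector field of the chart at [p]. *)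
Definition coord_vf (p : M) (i : 'I_m) : vfield := fun q =>
  'd (chart_coord (chart_at q) \o chart_param (chart_at p))
     (chart_coord (chart_at p) q) (delta_mx 0 i).

Record metric := Metric {
  metric_val :> M -> 'rV[R]_m -> 'rV[R]_m -> R;
  metric_linear : forall p y, scalar (metric_val p ^~ y);
  metric_sym : forall p x y, metric_val p x y = metric_val p y x;
  metric_pos : forall p x, x != 0 -> 0 < metric_val p x x;
  metric_smooth : smooth_form2 metric_val }.

Variable g : metric.

(* Connections act on vector fields defined near a point; the axioms only
   constrain [nabla X Y] near the points where [X] and [Y] are smooth. *)
Record levi_civita (nabla : vfield -> vfield -> vfield) : Prop := LeviCivita {
  nabla_smooth : forall p X Y, smooth_vf p X -> smooth_vf p Y ->
    smooth_vf p (nabla X Y);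
  nabla_addl : forall p X X' Y,
    smooth_vf p X -> smooth_vf p X' -> smooth_vf p Y ->
    nabla (fun q => X q + X' q) Y p = nabla X Y p + nabla X' Y p;
  nabla_scalel : forall p f X Y,
    smooth_fun p f -> smooth_vf p X -> smooth_vf p Y ->
    nabla (fun q => f q *: X q) Y p = f p *: nabla X Y p;
  nabla_addr : forall p X Y Y',
    smooth_vf p X -> smooth_vf p Y -> smooth_vf p Y' ->
    nabla X (fun q => Y q + Y' q) p = nabla X Y p + nabla X Y' p;
  nabla_leibniz : forall p f X Y,
    smooth_fun p f -> smooth_vf p X -> smooth_vf p Y ->
    nabla X (fun q => f q *: Y q) p = vf_act X f p *: Y p + f p *: nabla X Y p;
  nabla_metric : forall p X Y Z,
    smooth_vf p X -> smooth_vf p Y -> smooth_vf p Z ->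
    vf_act X (fun q => g q (Y q) (Z q)) p
    = g p (nabla X Y p) (Z p) + g p (Y p) (nabla X Z p);
  nabla_torsion : forall p X Y, smooth_vf p X -> smooth_vf p Y ->
    nabla X Y p - nabla Y X p = bracket X Y p }.

Variable nabla : vfield -> vfield -> vfield.

Definition curvature (X Y Z : vfield) : vfield := fun p =>
  nabla X (nabla Y Z) p - nabla Y (nabla X Z) p - nabla (bracket X Y) Z p.

Definition riemann (X Y Z V : vfield) : M -> R := fun p =>
  g p (curvature X Y Z p) (V p).

(* The trace of X |-> R(X, Y)Z. *)
Definition ricci (Y Z : vfield) : M -> R := fun p =>
  \sum_(i < m) curvature (coord_vf p i) Y Z p 0 i.

Definition einstein : Prop := exists c : R, forall p Y Z,
  smooth_vf p Y -> smooth_vf p Z -> ricci Y Z p = c * g p (Y p) (Z p).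

(* The exterior square of 'rV_m is modelled by the antisymmetric matrices, the
   matrix B standing for the sum of the B i j e_i /\ e_j over i < j. *)
Definition bivector (B : 'M[R]_m) : Prop := B^T = - B.

Definition wedge (x y : 'rV[R]_m) : 'M[R]_m := x^T *m y - y^T *m x.

Definition bdot (p : M) (A B : 'M[R]_m) : R :=
  2^-1 * \sum_a \sum_b \sum_c \sum_d A a b * B c d
    * g p (delta_mx 0 a) (delta_mx 0 c) * g p (delta_mx 0 b) (delta_mx 0 d).

(* Only the values of [Rop p] on bivectors are relevant. *)
Definition curvature_operator
    (Rop : M -> {linear 'M[R]_m -> 'M[R]_m}) : Prop :=
  (forall p B, bivector B -> bivector (Rop p B)) /\
  (forall p X Y Z V,
     smooth_vf p X -> smooth_vf p Y -> smooth_vf p Z -> smooth_vf p V ->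
     bdot p (Rop p (wedge (X p) (Y p))) (wedge (Z p) (V p))
     = - riemann X Y Z V p).

(* The bivector field [B] is identified with the 2-form [w]. *)
Definition dual_form2 (w : form2) (B : M -> 'M[R]_m) : Prop := forall p,
  bivector (B p) /\ forall x y, bdot p (B p) (wedge x y) = w p x y.

Definition eigenform_at (Rop : M -> {linear 'M[R]_m -> 'M[R]_m})
    (lambda : R) (w : form2) : Prop :=
  exists B, [/\ dual_form2 w B, exists p, B p != 0 &
                forall p, Rop p (B p) = lambda *: B p].

Definition eigenform (Rop : M -> {linear 'M[R]_m -> 'M[R]_m})
    (w : form2) : Prop :=
  exists lambda, eigenform_at Rop lambda w.

Definition orthogonal_form2 (w w' : form2) : Prop :=
  exists B B', [/\ dual_form2 w B, dual_form2 w' B' &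
                   forall p, bdot p (B p) (B' p) = 0].

Definition fundamental_form (phi : endo) : form2 := fun p x y =>
  g p x (phi p y).

Record almost_contact_metric (phi : endo) (xi : vfield) (eta : form1) : Prop :=
  AlmostContactMetric {
  acm_phi_smooth : smooth_endo phi;
  acm_xi_smooth : forall p, smooth_vf p xi;
  acm_eta_smooth : smooth_form1 eta;
  acm_phi2 : forall p x, phi p (phi p x) = - x + eta p x *: xi p;
  acm_eta_xi : forall p, eta p (xi p) = 1;
  acm_phi_xi : forall p, phi p (xi p) = 0;
  acm_eta_phi : forall p x, eta p (phi p x) = 0;
  acm_metric : forall p x y,
    g p (phi p x) (phi p y) = g p x y - eta p x * eta p y }.

End Fields.

Definition even_ijk (i j k : 'I_3) : Prop :=
  exists2 s : 'S_3, ~~ odd_perm s & [/\ i = s 0, j = s 1 & k = s 2%:R].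

Section ThreeStructures.
Variables (R : realType) (m : nat) (M : manifold R m) (g : metric M).
Variables (phi : 'I_3 -> endo M) (xi : 'I_3 -> vfield M)
          (eta : 'I_3 -> form1 M).

Record almost_3contact_metric : Prop := Almost3ContactMetric {
  a3c_acm : forall i, almost_contact_metric g (phi i) (xi i) (eta i);
  a3c_phi : forall i j k, even_ijk i j k -> forall p x,
    phi k p x = phi i p (phi j p x) - eta j p x *: xi i p /\
    phi k p x = - phi j p (phi i p x) + eta i p x *: xi j p;
  a3c_xi : forall i j k, even_ijk i j k -> forall p,
    xi k p = phi i p (xi j p) /\ xi k p = - phi j p (xi i p);
  a3c_eta : forall i j k, even_ijk i j k -> forall p x,
    eta k p x = eta i p (phi j p x) /\ eta k p x = - eta j p (phi i p x) }.

Definition sasaki3_alpha_delta (alpha delta : R) : Prop :=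
  forall i j k, even_ijk i j k -> forall p X Y,
    smooth_vf p X -> smooth_vf p Y ->
    ext_d (eta i) X Y p
    = 2 * alpha * fundamental_form g (phi i) p (X p) (Y p)
      + 2 * (alpha - delta) * wedge11 (eta j) (eta k) p (X p) (Y p).

End ThreeStructures.

(* [bdot] is the inner product of the determinant formula. *)
Lemma bdot_wedge (R : realType) (m : nat) (M : manifold R m) (g : metric M)
    (p : M) (u1 u2 v1 v2 : 'rV[R]_m) :
  bdot g p (wedge u1 u2) (wedge v1 v2)
  = g p u1 v1 * g p u2 v2 - g p u1 v2 * g p u2 v1.
Proof.
have gE (x y : 'rV[R]_m) : g p x y =
    \sum_a \sum_c x 0 a * y 0 c * g p (delta_mx 0 a) (delta_mx 0 c).
  have gl (z : 'rV[R]_m) (w : 'rV[R]_m) :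
      g p z w = \sum_a z 0 a * g p (delta_mx 0 a) w.
    pose f : {scalar 'rV[R]_m} :=
      HB.pack (g p ^~ w) (GRing.isLinear.Build _ _ _ _ _ (metric_linear g p w)).
    rewrite -[LHS]/(f z) [in LHS](row_sum_delta z) linear_sum.
    by apply: eq_bigr => a _; rewrite linearZ.
  rewrite gl; apply: eq_bigr => a _.
  rewrite metric_sym gl mulr_sumr; apply: eq_bigr => c _.
  by rewrite mulrA (metric_sym g p (delta_mx 0 c)).
pose G a c := g p (delta_mx 0 a) (delta_mx 0 c).
have prodE (x y z t : 'rV[R]_m) : \sum_a \sum_b \sum_c \sum_d
    x 0 a * y 0 b * (z 0 c * t 0 d) * G a c * G b d = g p x z * g p y t.
  rewrite (gE x z) (gE y t) mulr_suml; apply: eq_bigr => a _.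
  rewrite mulr_sumr; apply: eq_bigr => b _.
  rewrite mulr_suml; apply: eq_bigr => c _.
  rewrite mulr_sumr; apply: eq_bigr => d _.
  by rewrite /G; ring.
have -> : g p u1 v1 * g p u2 v2 - g p u1 v2 * g p u2 v1 =
    2^-1 * (g p u1 v1 * g p u2 v2 - g p u2 v1 * g p u1 v2
            - (g p u1 v2 * g p u2 v1 - g p u2 v2 * g p u1 v1)).
  by field.
rewrite /bdot; congr (_ * _); rewrite -!prodE -!sumrB.
apply: eq_bigr => a _; rewrite -!sumrB; apply: eq_bigr => b _.
rewrite -!sumrB; apply: eq_bigr => c _; rewrite -!sumrB; apply: eq_bigr => d _.
by rewrite !mxE !big_ord1 !mxE /G; ring.
Qed.

(* Main.v *)
From HB Require Import structures.
Require Import Defs.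
From mathcomp Require Import all_boot all_order all_algebra perm.
From mathcomp Require Import all_classical all_reals all_analysis.
From mathcomp Require Import ring lra.
Set Implicit Arguments.
Unset Strict Implicit.
Unset Printing Implicit Defensive.
Import Order.TTheory GRing.Theory Num.Theory.
Import numFieldNormedType.Exports.
Local Open Scope classical_set_scope.
Local Open Scope ring_scope.

(** The curvature splits into a part that the contraction with the structure does
    not see and a part that is an explicit expression in the structure.

    Write the Levi-Civita connection as [D + B], where [B] is the tensor [frameB]
    built from the [phi_i], the [xi_i], [alpha] and [delta].  The structure is
    parallel for [D] ([adapted_parallel]).  Indeed, on the sum of the tangent bundle
    with a trivial line the [phi_i] and [xi_i] combine to an almost hyperhermitian
    structure; [d (d eta_i) = 0] says that the fundamental forms of this structure
    are closed, as the contributions of [B] cancel ([frame_closed]), and an almost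
    hyperhermitian structure with three closed fundamental forms is parallel, by
    Hitchin's argument ([hitchin]).  Hence [B] is parallel for [D] too, and the
    Riemann tensor is the curvature of [D], which commutes with the [phi_i] and
    kills the [xi_i], plus an expression [frameQ] in [B] ([curvature_adapted]).

    The curvature operator maps [Phi_i] to the form with value
    [- tr (phi_i R(z, v)) / 2] at [(z, v)].  An endomorphism that commutes with the
    [phi_i] and kills the [xi_i] has no trace against [phi_i], which on horizontal
    vectors is both [phi_j phi_k] and [- phi_k phi_j] ([tr_f1_commuting]); so only
    [frameQ] contributes.  The same is true of [xi_jk], because the curvature of [D]
    kills [xi_j].  It follows that [Phi_i] and [xi_jk] span an invariant plane
    ([Rop_Phi], [Rop_xi]), on which the operator is
[[
    Phi_i |-> (alpha^2 + (4n+2) alpha (delta-alpha)) Phi_i - (alpha-delta)^2 xi_jk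
    xi_jk |-> 2 alpha (alpha-delta) Phi_i
                + (2 alpha (alpha-delta) + delta^2) xi_jk
]]
    For [c = -1] and for [c = n + 1] the condition on [Phi_i + c xi_jk] to be an
    eigenvector is, up to a nonzero factor,
    [(delta - alpha) (delta - (2n+3) alpha) = 0].

    For the Ricci tensor, the Bianchi identity and the pair symmetry turn the
    contraction of [phi_i R] into half of the trace of [phi_i R(z, v)]
    ([tr_f1Rm_bianchi]), so that it is again determined by [frameQ].  It is a
    multiple of the metric on the horizontal vectors and another one on the span of
    the [xi_i] ([ricci_formula]); the two factors differ by
    [2 (delta - alpha) (delta - (2n+3) alpha)]. *)

(** * Functions of class C^k and the symmetry of second derivatives *)

Section Ck.
Variables (R : realType) (V : normedModType R).
Implicit Types (U : set V) (k : nat).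

Lemma Ck_on_sub (W : normedModType R) k U U' (f : V -> W) :
  U' `<=` U -> Ck_on k U f -> Ck_on k U' f.
Proof.
move=> sU; elim: k f => [|k IH] f /=; first by move=> h x /sU/h.
by move=> [h1 h2]; split=> [x /sU/h1//|v]; apply: IH.
Qed.

(** The differential of a function is characterised by an expansion at the point,
    which only depends on the germ of the function. *)
Lemma near_eq_differentiable (W : normedModType R) (f g : V -> W) x :
  (\near x, f x = g x) -> differentiable f x ->
  differentiable g x /\ 'd g x = 'd f x :> (V -> W).
Proof.
move=> fg df.
have gx : g x = f x by rewrite (nbhs_singleton fg).
have dfc := diff_continuous df.
have E : g \o shift x = cst (g x) + 'd f x +o_ (0 : V) id.
  apply/eqaddoP => _/posnumP[e].
  have /eqaddoP/(_ _ (gt0 e)) h := diff_locally df.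
  have fg0 : \forall y \near (0 : V), f (y + x) = g (y + x).
    by move: fg; rewrite (near_shift 0) /= subr0.
  rewrite gx; near=> y.
  have -> : (g \o shift x - (cst (f x) + 'd f x)) y =
            (f \o shift x - (cst (f x) + 'd f x)) y.
    by rewrite /= !fctE /=; congr (_ - _); apply/esym; near: y.
  by near: y; exact: h.
have dE := diff_unique dfc E.
split=> //; apply/diff_locallyP; split; first by rewrite dE.
by rewrite dE.
Unshelve. all: by end_near. Qed.

(** Openness of [U] is what makes the germs of [f] and [g] agree, and with them
    the derivatives that the recursion in [Ck_on] looks at. *)
Lemma Ck_on_ext (W : normedModType R) k U (f g : V -> W) : open U ->
  (forall x, U x -> f x = g x) -> Ck_on k U f -> Ck_on k U g.
Proof.
move=> oU; elim: k f g => [|k IH] f g fg /= => [h x Ux|[h1 h2]].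
  have fgx : \near x, f x = g x.
    by apply: filterS (open_nbhs_nbhs (conj oU Ux)) => y; exact: fg.
  suff : g @ x --> g x by []; rewrite -(fg _ Ux).
  by apply: cvg_trans (h _ Ux); apply: near_eq_cvg.
have near_fg x : U x -> \near x, f x = g x.
  by move=> Ux; apply: filterS (open_nbhs_nbhs (conj oU Ux)) => y; exact: fg.
split=> [x Ux|v].
  by have [] := near_eq_differentiable (near_fg x Ux) (h1 x Ux).
apply: IH (h2 v) => x Ux; exact: near_eq_derive (near_fg x Ux).
Qed.

Lemma Ck_on_pred (W : normedModType R) k U (f : V -> W) :
  Ck_on k.+1 U f -> Ck_on k U f.
Proof.
elim: k f => [|k IH] f [h1 h2] /=.
  by move=> x /h1; exact: differentiable_continuous.
by split=> // v; apply: IH.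
Qed.

Lemma Ck_on_cst (W : normedModType R) k U (c : W) : open U ->
  Ck_on k U (cst c : V -> W).
Proof.
move=> oU; elim: k c => [|k IH] c /=; first by move=> x _; exact: cst_continuous.
split=> [x _|v]; first exact: differentiable_cst.
by apply: Ck_on_ext (IH 0) => // x _; rewrite derive_cst.
Qed.

Lemma Ck_onD (W : normedModType R) k U (f g : V -> W) : open U ->
  Ck_on k U f -> Ck_on k U g -> Ck_on k U (fun x => f x + g x).
Proof.
move=> oU; elim: k f g => [|k IH] f g /=.
  by move=> hf hg x Ux; apply: cvgD; [exact: hf|exact: hg].
move=> [f1 f2] [g1 g2]; split=> [x Ux|v].
  by apply: differentiableD; [exact: f1|exact: g1].
apply: Ck_on_ext (IH _ _ (f2 v) (g2 v)) => // x Ux.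
by rewrite deriveD//; apply: diff_derivable; [exact: f1|exact: g1].
Qed.

Lemma Ck_on_sum (W : normedModType R) k U n (f : 'I_n -> V -> W) : open U ->
  (forall i, Ck_on k U (f i)) -> Ck_on k U (fun x => \sum_i f i x).
Proof.
move=> oU; elim: n f => [|n IH] f hf.
  by apply: Ck_on_ext (Ck_on_cst k 0 oU) => // x _; rewrite big_ord0.
have := Ck_onD oU (hf ord0) (IH _ (fun i => hf (lift ord0 i))).
by apply: Ck_on_ext => // x _; rewrite big_ord_recl.
Qed.

Lemma Ck_onM k U (f g : V -> R) : open U ->
  Ck_on k U f -> Ck_on k U g -> Ck_on k U (fun x => f x * g x).
Proof.
move=> oU; elim: k f g => [|k IH] f g.
  by move=> hf hg x Ux; apply: cvgM; [exact: hf|exact: hg].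
move=> fk gk; have [f1 f2] := fk; have [g1 g2] := gk.
split=> [x Ux|v].
  by apply: differentiableM; [exact: f1|exact: g1].
have := Ck_onD oU (IH _ _ (f2 v) (Ck_on_pred gk)) (IH _ _ (Ck_on_pred fk) (g2 v)).
apply: Ck_on_ext => // x Ux; rewrite deriveM; last 2 first.
- by apply: diff_derivable; exact: f1.
- by apply: diff_derivable; exact: g1.
by rewrite addrC /= [g x *: _]mulrC.
Qed.

Lemma Ck_onZl (W : normedModType R) k U (f : V -> R) (w : W) : open U ->
  Ck_on k U f -> Ck_on k U (fun x => f x *: w).
Proof.
move=> oU; elim: k f => [|k IH] f.
  by move=> hf x Ux; apply: cvgZl; exact: hf.
move=> [f1 f2]; split=> [x Ux|v]; first by apply: differentiableZl; exact: f1.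
apply: Ck_on_ext (IH _ (f2 v)) => // x Ux.
rewrite !deriveE; [|by apply: differentiableZl; exact: f1|exact: f1].
by rewrite diffZl//; exact: f1.
Qed.

Lemma Ck_on_coord k U m n (f : V -> 'M[R]_(m, n)) i j : open U ->
  Ck_on k U f -> Ck_on k U (fun x => f x i j).
Proof.
move=> oU; elim: k f => [|k IH] f.
  move=> hf x Ux; apply: (@continuous_comp _ _ _ f (fun A => A i j) x).
    exact: hf.
  exact: coord_continuous.
move=> [f1 f2]; have df x : U x -> differentiable (fun x => f x i j) x.
  move=> Ux.
  apply: (@differentiable_comp _ _ _ _ f (fun A => A i j : R)); first exact: f1.
  exact: differentiable_coord.
split=> // v; apply: Ck_on_ext (IH _ (f2 v)) => // x Ux.
by rewrite derive_mx ?mxE//; apply: diff_derivable; exact: f1.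
Qed.

Lemma Ck_on_rV k U n (f : V -> 'rV[R]_n) : open U ->
  (forall j, Ck_on k U (fun x => f x 0 j)) -> Ck_on k U f.
Proof.
move=> oU hf.
have := Ck_on_sum oU (fun j => Ck_onZl (delta_mx 0 j : 'rV[R]_n) oU (hf j)).
by apply: Ck_on_ext => // x _; rewrite -row_sum_delta.
Qed.

Lemma Ck_onZ k U n (f : V -> R) (g : V -> 'rV[R]_n) : open U ->
  Ck_on k U f -> Ck_on k U g -> Ck_on k U (fun x => f x *: g x).
Proof.
move=> oU hf hg; apply: Ck_on_rV => // j.
apply: Ck_on_ext (Ck_onM oU hf (Ck_on_coord 0 j oU hg)) => // x _.
by rewrite mxE.
Qed.

End Ck.

Lemma derive_rV_sum (R : realType) n (W : normedModType R) (f : 'rV[R]_n -> W)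
    x v : differentiable f x -> 'd f x v = \sum_j v 0 j *: 'D_(delta_mx 0 j) f x.
Proof.
move=> df; rewrite [in LHS](row_sum_delta v) linear_sum.
by apply: eq_bigr => j _; rewrite linearZ deriveE.
Qed.

(** By induction on [k]: the chain rule writes a derivative of [g \o f] as a sum of
    products of derivatives of the components of [f] with partial derivatives of
    [g] composed with [f]. *)
Lemma Ck_on_compR (R : realType) (V : normedModType R) n k (U : set V)
    (U' : set 'rV[R]_n) (f : V -> 'rV[R]_n) (g : 'rV[R]_n -> R) :
  open U -> open U' -> (forall x, U x -> U' (f x)) ->
  Ck_on k U f -> Ck_on k U' g -> Ck_on k U (g \o f).
Proof.
move=> oU oU' fU; elim: k g => [|k IH] g.
  move=> hf hg x Ux; apply: continuous_comp; first exact: hf.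
  exact/hg/fU.
move=> fk [g1 g2]; have [f1 f2] := fk.
split=> [x Ux|v].
  by apply: differentiable_comp; [exact: f1|exact/g1/fU].
have := Ck_on_sum oU (fun j => Ck_onM oU (Ck_on_coord 0 j oU (f2 v))
  (IH _ (Ck_on_pred fk) (g2 (delta_mx 0 j)))).
apply: Ck_on_ext => // x Ux.
have dfx := f1 _ Ux; have dgx := g1 _ (fU _ Ux).
rewrite [RHS]deriveE; last exact: differentiable_comp.
rewrite diff_comp// /= derive_rV_sum//; apply: eq_bigr => j _.
by rewrite -deriveE.
Qed.

Lemma Ck_on_comp (R : realType) (V : normedModType R) n l k (U : set V)
    (U' : set 'rV[R]_n) (f : V -> 'rV[R]_n) (g : 'rV[R]_n -> 'rV[R]_l) :
  open U -> open U' -> (forall x, U x -> U' (f x)) ->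
  Ck_on k U f -> Ck_on k U' g -> Ck_on k U (g \o f).
Proof.
move=> oU oU' fU fk gk; apply: Ck_on_rV => // j.
by apply: Ck_on_compR fU fk (Ck_on_coord 0 j oU' gk).
Qed.

Lemma is_derive_line (R : realType) (V W : normedModType R) (h : V -> W)
    (y u : V) (s : R) : differentiable h (y + s *: u) ->
  is_derive s 1 (fun s => h (y + s *: u)) ('D_u h (y + s *: u)).
Proof.
move=> dh.
have E : (fun t : R => t^-1 *: (((fun s => h (y + s *: u)) \o shift s) (t *: 1)
            - h (y + s *: u)))
       = (fun t => t^-1 *: ((h \o shift (y + s *: u)) (t *: u) - h (y + s *: u))).
  apply/funext => t /=; congr (_ *: (h _ - _)).
  by rewrite scalerDl [t *: 1]mulr1 addrCA.
have : derivable h (y + s *: u) u by exact: diff_derivable.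
rewrite /derivable -E => dl.
by apply: DeriveDef => //; rewrite /derive E.
Qed.

(** The mean value theorem is used once in each direction. *)
Lemma second_difference_MVT (R : realType) n (U : set 'rV[R]_n)
    (f : 'rV[R]_n -> R) (x v w : 'rV[R]_n) (e : R) :
  0 < e -> Ck_on 2 U f ->
  (forall s t, 0 <= s <= e -> 0 <= t <= e -> U (x + s *: v + t *: w)) ->
  exists s t, [/\ 0 <= s <= e, 0 <= t <= e &
    f (x + e *: v + e *: w) - f (x + e *: v) - (f (x + e *: w) - f x)
    = 'D_w ('D_v f) (x + s *: v + t *: w) * (e * e)].
Proof.
move=> e0 [f1 f2] xU; have [f3 _] := f2 v.
have e01 (s : R) : s \in `]0, e[ -> 0 <= s <= e.
  by rewrite in_itv/= => /andP[/ltW-> /ltW->].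
have xU0 s : 0 <= s <= e -> U (x + s *: v).
  by move=> hs; rewrite -[x + _]addr0 -(scale0r w); apply: xU; rewrite // lexx ltW.
pose h s := f (x + e *: w + s *: v) - f (x + s *: v).
have dh s : 0 <= s <= e -> is_derive s 1 h
    ('D_v f (x + e *: w + s *: v) - 'D_v f (x + s *: v)).
  move=> hs; apply: is_deriveB; apply: is_derive_line; apply: f1; last exact: xU0.
  by rewrite addrAC; apply: xU; rewrite // lexx ltW.
have [s hs Eh] : exists2 s, s \in `]0, e[ & h e - h 0 =
    ('D_v f (x + e *: w + s *: v) - 'D_v f (x + s *: v)) * (e - 0).
  apply: MVT => // [s hs|]; first exact/dh/e01.
  apply: derivable_within_continuous => s; rewrite in_itv/= => hs.
  by have [] := dh s hs.
pose k t := 'D_v f (x + s *: v + t *: w).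
have dk t : 0 <= t <= e -> is_derive t 1 k ('D_w ('D_v f) (x + s *: v + t *: w)).
  by move=> ht; apply: is_derive_line; apply: f3; apply: xU => //; exact: e01.
have [t ht Ek] : exists2 t, t \in `]0, e[ & k e - k 0 =
    'D_w ('D_v f) (x + s *: v + t *: w) * (e - 0).
  apply: (@MVT R k (fun t => 'D_w ('D_v f) (x + s *: v + t *: w)) 0 e e0).
    by move=> t ht; apply/dk/e01.
  apply: derivable_within_continuous => t; rewrite in_itv/= => ht.
  by have [] := dk t ht.
exists s, t; split; [exact: e01|exact: e01|].
move: Eh Ek; rewrite /h /k !scale0r !addr0 !subr0 [x + e *: w + s *: v]addrAC.
move=> Eh Ek; rewrite mulrA -Ek -Eh [x + e *: w + e *: v]addrAC.
by ring.
Qed.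

Lemma ler_dist_half (R : realType) (a b c e : R) :
  `|a - c| < e / 2 -> `|b - c| < e / 2 -> `|a - b| <= e.
Proof.
move=> h1 h2; have -> : a - b = (a - c) - (b - c) by ring.
by rewrite (le_trans (ler_normB _ _))// [leRHS]splitr lerD// ltW.
Qed.

(** Schwarz: the second difference quotient is symmetric in the two directions, and
    it is a value of either mixed derivative at some point of a small ball, so
    that continuity makes the two derivatives at [x] equal. *)
Lemma derive_comm (R : realType) n (U : set 'rV[R]_n) (f : 'rV[R]_n -> R)
    (x v w : 'rV[R]_n) : open U -> U x -> Ck_on 2 U f ->
  'D_w ('D_v f) x = 'D_v ('D_w f) x.
Proof.
move=> oU Ux f2; apply/eqP; rewrite -subr_eq0 -normr_le0; apply/ler_addgt0Pl.
move=> eps eps0; rewrite addr0.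
have cf a b : {for x, continuous ('D_a ('D_b f))}.
  by case: f2 => _ /(_ b)[_ /(_ a)]; exact.
have eps2 : 0 < eps / 2 by rewrite divr_gt0.
have nw : \forall y \near x, `|'D_w ('D_v f) x - 'D_w ('D_v f) y| < eps / 2.
  exact: (cvgrPdist_lt _ _).1 (cf w v) _ eps2.
have nv : \forall y \near x, `|'D_v ('D_w f) x - 'D_v ('D_w f) y| < eps / 2.
  exact: (cvgrPdist_lt _ _).1 (cf v w) _ eps2.
have : \forall y \near x, [/\ U y,
    `|'D_w ('D_v f) x - 'D_w ('D_v f) y| < eps / 2 &
    `|'D_v ('D_w f) x - 'D_v ('D_w f) y| < eps / 2].
  by apply: filterS3 (open_nbhs_nbhs (conj oU Ux)) nw nv => y; split.
case/nbhs_ballP => r /= r0 xr.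
(* The parallelogram spanned by [e *: v] and [e *: w] at [x] stays in the ball; the
   summand 1 covers the case [v = w = 0]. *)
pose e := r / (`|v| + `|w| + 1).
have d0 : 0 < `|v| + `|w| + 1 by rewrite ltr_wpDl// addr_ge0.
have e0 : 0 < e by rewrite divr_gt0.
have inball s t : 0 <= s <= e -> 0 <= t <= e -> ball x r (x + s *: v + t *: w).
  move=> /andP[s0 se] /andP[t0 te].
  rewrite -ball_normE /= -addrA opprD addNKr normrN.
  rewrite (le_lt_trans (ler_normD _ _))// !normrZ !ger0_norm//.
  have : s * `|v| + t * `|w| <= e * (`|v| + `|w|).
    by rewrite mulrDr lerD// ler_wpM2r.
  move=> /le_lt_trans; apply; rewrite /e mulrAC ltr_pdivrMr//.
  by rewrite ltr_pM2l// ltrDl.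
have inU s t hs ht := xr _ (inball s t hs ht).
have [s [t [hs ht E1]]] := second_difference_MVT (w := w) e0 f2
  (fun s t hs ht => let: And3 h _ _ := inU s t hs ht in h).
have [s' [t' [hs' ht' E2]]] := second_difference_MVT (v := w) (w := v) e0 f2
  (fun s t hs ht => let: And3 h _ _ := inU t s ht hs in
     eq_ind _ U h _ (addrAC _ _ _)).
have [_ h1 _] := inU _ _ hs ht.
have [_ _ h2] := inU _ _ ht' hs'.
have ee : e * e != 0 by rewrite mulf_neq0// gt_eqF.
have E : 'D_w ('D_v f) (x + s *: v + t *: w)
       = 'D_v ('D_w f) (x + t' *: v + s' *: w).
  rewrite (addrAC x (t' *: v)); apply: (mulIf ee).
  apply: (etrans (esym E1)); apply: etrans E2.
  by rewrite (addrAC x (e *: w)); ring.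
rewrite E in h1.
exact: ler_dist_half h1 h2.
Qed.


(** * Charts, vector fields and brackets *)

Lemma diff_near_eq (R : realType) (V W : normedModType R) (f g : V -> W) x v :
  (\forall u \near x, f u = g u) -> differentiable f x -> 'd f x v = 'd g x v.
Proof. by move=> fg df; have [_ ->] := near_eq_differentiable fg df. Qed.

Lemma diff_comp_near (R : realType) (U V W : normedModType R) (f : U -> V)
    (g : V -> W) (h : U -> W) x v :
  (\forall u \near x, g (f u) = h u) ->
  differentiable f x -> differentiable g (f x) ->
  'd g (f x) ('d f x v) = 'd h x v.
Proof.
move=> gfh df dg; rewrite -(diff_near_eq v gfh (differentiable_comp df dg)).
by rewrite (diff_comp df dg).
Qed.

Section Charts.
Variables (R : realType) (m : nat) (M : manifold R m).
Implicit Types (p q x : M) (u v : 'rV[R]_m) (N : set M).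

Definition dom p : set M := chart_dom (chart_at p).
Definition coord p : M -> 'rV[R]_m := chart_coord (chart_at p).
Definition param p : 'rV[R]_m -> M := chart_param (chart_at p).
Definition trans p q : 'rV[R]_m -> 'rV[R]_m := coord q \o param p.

(** The part of [N] seen in the chart at [p], as a set of coordinates. *)
Definition chart_set p N : set 'rV[R]_m :=
  [set u | (coord p @` dom p) u /\ N (param p u)].

Lemma coordK p x : dom p x -> param p (coord p x) = x.
Proof. by move=> px; have [_ _ h _ _] := chart_atP p; exact: h. Qed.

Lemma chart_setP p N u : chart_set p N u -> 
  [/\ dom p (param p u), coord p (param p u) = u & N (param p u)].
Proof. by move=> [[x px <-]]; rewrite coordK. Qed.

Lemma chart_set_coord p N x : dom p x -> N x -> chart_set p N (coord p x).
Proof. by move=> px Nx; split; [exists x|rewrite coordK]. Qed.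

Lemma open_chart_set p N : open N -> open (chart_set p N).
Proof.
move=> oN; have [_ oI _ _] := chart_atP p.
rewrite continuous_open_subspace// => cI.
rewrite openE => u [Iu Nu]; apply: filterI; first exact: open_nbhs_nbhs.
have := cI u; rewrite inE => /(_ Iu); apply.
exact: open_nbhs_nbhs.
Qed.

Lemma near_chart p N x : open N -> dom p x -> N x ->
  nbhs (coord p x) (chart_set p N).
Proof.
move=> oN px Nx; apply: open_nbhs_nbhs; split; first exact: open_chart_set.
exact: chart_set_coord.
Qed.

Lemma near_base p N : open N -> N p -> nbhs (base p) (chart_set p N).
Proof. by move=> oN Np; apply: near_chart => //; exact: chart_at_dom. Qed.

Lemma open_dom p : open (dom p).
Proof. by have [] := chart_atP p. Qed.

Lemma trans_smooth p q : smooth_on (chart_set p (dom q)) (trans p q).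
Proof.
move=> k; apply: Ck_on_sub (chart_at_smooth p q k) => u /chart_setP[h1 h2 h3].
by exists (param p u).
Qed.

Lemma trans_differentiable p q x : dom p x -> dom q x ->
  differentiable (trans p q) (coord p x).
Proof.
by move=> px qx; have [h _] := trans_smooth p q 1; apply/h/chart_set_coord.
Qed.

Lemma near_trans_comp p q x : dom p x -> dom q x ->
  \forall u \near coord p x, param q (trans p q u) = param p u.
Proof.
move=> px qx; apply: filterS (near_chart (open_dom q) px qx) => u.
by move=> /chart_setP[h1 h2 h3]; rewrite /trans/= coordK.
Qed.

Lemma diff_trans_comp p q r x v : dom p x -> dom q x -> dom r x ->
  'd (trans q r) (coord q x) ('d (trans p q) (coord p x) v)
  = 'd (trans p r) (coord p x) v.
Proof.
move=> px qx rx.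
have qE : coord q x = trans p q (coord p x) by rewrite /trans/= coordK.
rewrite qE; have dq := trans_differentiable px qx.
have dr := trans_differentiable qx rx; rewrite qE in dr.
apply: (diff_comp_near (h := trans p r)) => //.
apply: filterS (near_trans_comp px qx) => u /= E.
by rewrite {1}/trans/= E.
Qed.

Lemma diff_trans_id p x v : dom p x -> 'd (trans p p) (coord p x) v = v.
Proof.
move=> px.
have E : {near coord p x, id =1 trans p p}.
  apply: filterS (near_chart (open_dom p) px px) => u.
  by move=> /chart_setP[h1 h2 h3]; rewrite /trans/= h2.
rewrite -(diff_near_eq v E) ?diff_val//.
Qed.

End Charts.

Section Fields.
Variables (R : realType) (m : nat) (M : manifold R m).
Implicit Types (p q x : M) (u v : 'rV[R]_m) (N : set M) (X Y Z : vfield M).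
Implicit Types (f h : M -> R).

Lemma base_dom p : dom p p. Proof. exact: chart_at_dom. Qed.

Lemma local_vf_base p X : local_vf p X (base p) = X p.
Proof.
rewrite /local_vf -[base p]/(coord p p) -[chart_param _ _]/(param p _).
rewrite coordK; last exact: base_dom.
by rewrite /tangent_coord; exact: diff_trans_id (base_dom p).
Qed.

Lemma local_fun_base p f : local_fun p f (base p) = f p.
Proof.
rewrite /local_fun /= -[chart_param _ _]/(param p (coord p p)).
by rewrite coordK//; exact: base_dom.
Qed.

(** Smoothness, derivation and covariant derivative at [p] depend only on germs
    at [p]; agreement of germs is phrased with an open set so that it can be read
    in any chart. *)
Definition agree_near p (T : Type) (F G : M -> T) :=
  exists2 N : set M, open N /\ N p & forall q, N q -> F q = G q.

Lemma local_vf_eq p X Y : agree_near p X Y ->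
  \forall u \near base p, local_vf p X u = local_vf p Y u.
Proof.
move=> [N [oN Np] XY]; apply: filterS (near_base oN Np) => u.
by move=> /chart_setP[_ _ Nu]; rewrite /local_vf XY.
Qed.

Lemma local_fun_eq p f h : agree_near p f h ->
  \forall u \near base p, local_fun p f u = local_fun p h u.
Proof.
move=> [N [oN Np] XY]; apply: filterS (near_base oN Np) => u.
by move=> /chart_setP[_ _ Nu]; rewrite /local_fun /= XY.
Qed.

Lemma smooth_on_ext (V W : normedModType R) (U U' : set V) (F G : V -> W) :
  open U -> open U' -> (forall y, U y -> U' y -> F y = G y) ->
  smooth_on U F -> smooth_on (U `&` U') G.
Proof.
move=> oU oU' FG sF k; apply: Ck_on_ext (Ck_on_sub (@subIsetl _ U U') (sF k)).
  exact: openI.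
by move=> u [Uu U'u]; exact: FG.
Qed.

Lemma smooth_near (W : normedModType R) u (F G : 'rV[R]_m -> W) :
  (\forall u' \near u, F u' = G u') ->
  (exists2 U, open_nbhs u U & smooth_on U F) ->
  exists2 U, open_nbhs u U & smooth_on U G.
Proof.
rewrite /prop_near1 nbhsE => -[U' [oU' U'u] FG] [U [oU Uu] sF].
exists (U `&` U'); first by split; [exact: openI|].
by apply: smooth_on_ext sF => // u' _ /FG.
Qed.

Lemma smooth_vf_eq p X Y : agree_near p X Y -> smooth_vf p X -> smooth_vf p Y.
Proof. by move=> /local_vf_eq/smooth_near; exact. Qed.

Lemma smooth_fun_eq p f h :
  agree_near p f h -> smooth_fun p f -> smooth_fun p h.
Proof. by move=> /local_fun_eq/smooth_near; exact. Qed.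

(** Pointwise operations on sections are smooth because they are given by class
    C^k operations in the chart, on the intersection of two neighbourhoods. *)
Lemma smooth2 (W1 W2 W : normedModType R) u (F1 : 'rV[R]_m -> W1)
    (F2 : 'rV[R]_m -> W2) (F : 'rV[R]_m -> W) :
  (forall k U, open U -> Ck_on k U F1 -> Ck_on k U F2 -> Ck_on k U F) ->
  (exists2 U, open_nbhs u U & smooth_on U F1) ->
  (exists2 U, open_nbhs u U & smooth_on U F2) ->
  exists2 U, open_nbhs u U & smooth_on U F.
Proof.
move=> HF [U [oU Uu] s1] [U' [oU' U'u] s2].
exists (U `&` U'); first by split; [exact: openI|].
move=> k; apply: HF; first exact: openI.
- by apply: Ck_on_sub (s1 k); exact: subIsetl.
- by apply: Ck_on_sub (s2 k); exact: subIsetr.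
Qed.

Lemma smooth_vfD p X Y : smooth_vf p X -> smooth_vf p Y ->
  smooth_vf p (fun q => X q + Y q).
Proof.
apply: smooth2 => k U oU sX sY; apply: Ck_on_ext (Ck_onD oU sX sY) => // u _.
by rewrite /local_vf /tangent_coord linearD.
Qed.

Lemma smooth_vfZ p f X : smooth_fun p f -> smooth_vf p X ->
  smooth_vf p (fun q => f q *: X q).
Proof.
apply: smooth2 => k U oU sf sX; apply: Ck_on_ext (Ck_onZ oU sf sX) => // u _.
by rewrite /local_vf /tangent_coord linearZ.
Qed.

Lemma smooth_funD p f h : smooth_fun p f -> smooth_fun p h ->
  smooth_fun p (fun q => f q + h q).
Proof. by apply: smooth2 => k U oU sf sh; exact: Ck_onD. Qed.

Lemma smooth_funM p f h : smooth_fun p f -> smooth_fun p h ->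
  smooth_fun p (fun q => f q * h q).
Proof. by apply: smooth2 => k U oU sf sh; exact: Ck_onM. Qed.

Lemma smooth_cst p (c : R) : smooth_fun p (fun=> c).
Proof.
exists setT; first by split; [exact: openT|].
by move=> k; apply: Ck_on_cst; exact: openT.
Qed.

(** The definition of [vf_act] uses at each point the chart of that point.  By the
    chain rule it can be read near [p] in the single chart at [p], where it is then
    possible to differentiate it again. *)
Lemma local_fun_act p X f : smooth_fun p f ->
  \forall u \near base p,
    local_fun p (vf_act X f) u = 'd (local_fun p f) u (local_vf p X u).
Proof.
move=> [U Unear sf]; have [dU _] := sf 1.
have nU : nbhs (base p) U by exact: open_nbhs_nbhs.
apply: filterS2 nU (near_base (open_dom p) (base_dom p)) => u Uu.
move=> /chart_setP[pq qE _]; set q := param p u in pq qE.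
rewrite /local_vf /tangent_coord -[chart_param _ _]/q.
rewrite -[LHS]/('d (local_fun q f) (base q) (X q)).
have E : base q = coord q q by [].
have uE : u = trans q p (base q) by rewrite /trans/= coordK//; exact: base_dom.
rewrite [in RHS]uE; apply/esym; apply: (diff_comp_near (h := local_fun q f)).
- apply: filterS (near_base (open_dom p) pq) => w /chart_setP[_ _ pw].
  by rewrite /local_fun/= -/(param p _) /trans/= coordK.
- by apply: trans_differentiable => //; exact: base_dom.
- by rewrite -uE; exact: dU.
Qed.

Lemma smooth_act p X f : smooth_vf p X -> smooth_fun p f ->
  smooth_fun p (vf_act X f).
Proof.
move=> sX sf; move: (sf) => [U Unear sU].
apply: (@smooth_near _ _
  (fun u => \sum_j local_vf p X u 0 j * 'D_(delta_mx 0 j) (local_fun p f) u)).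
  have [dU _] := sU 1.
  apply: filterS2 (open_nbhs_nbhs Unear) (local_fun_act X sf) => u Uu ->.
  by rewrite derive_rV_sum//; exact: dU.
have sf' : exists2 U, open_nbhs (base p) U &
    smooth_on U (fun u => \row_j 'D_(delta_mx 0 j) (local_fun p f) u).
  exists U => // k; have [oU _] := Unear; apply: Ck_on_rV => // j.
  have [_ /(_ (delta_mx 0 j))] := sU k.+1.
  by apply: Ck_on_ext => // u _; rewrite mxE.
apply: smooth2 sX sf' => k U' oU' s1 s2.
have := Ck_on_sum oU' (fun j => Ck_onM oU' (Ck_on_coord 0 j oU' s1)
  (Ck_on_coord 0 j oU' s2)).
by apply: Ck_on_ext => // u _; apply: eq_bigr => j _; rewrite mxE.
Qed.

Lemma act_eq p X f h : agree_near p f h -> smooth_fun p f ->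
  vf_act X f p = vf_act X h p.
Proof.
move=> /local_fun_eq fh [U [oU Uu] sf].
by apply: diff_near_eq => //; have [d _] := sf 1; exact: d.
Qed.

Lemma smooth_fun_diff p f : smooth_fun p f ->
  differentiable (local_fun p f) (base p).
Proof. by move=> [U [oU Uu] sf]; have [d _] := sf 1; exact: d. Qed.

Lemma smooth_vf_diff p X : smooth_vf p X ->
  differentiable (local_vf p X) (base p).
Proof. by move=> [U [oU Uu] sf]; have [d _] := sf 1; exact: d. Qed.

Lemma act_cst p X (c : R) : vf_act X (fun=> c) p = 0.
Proof. by rewrite /vf_act -[local_fun p _]/(cst c) diff_cst. Qed.

Lemma actD p X f h : smooth_fun p f -> smooth_fun p h ->
  vf_act X (fun q => f q + h q) p = vf_act X f p + vf_act X h p.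
Proof.
move=> /smooth_fun_diff df /smooth_fun_diff dh.
rewrite /vf_act -[local_fun p (fun q => f q + h q)]/(local_fun p f + local_fun p h).
by rewrite diffD.
Qed.

Lemma actM p X f h : smooth_fun p f -> smooth_fun p h ->
  vf_act X (fun q => f q * h q) p = f p * vf_act X h p + h p * vf_act X f p.
Proof.
move=> /smooth_fun_diff df /smooth_fun_diff dh.
rewrite /vf_act -[local_fun p (fun q => f q * h q)]/(local_fun p f * local_fun p h).
by rewrite diffM// !local_fun_base.
Qed.

(** In the chart at [p], the second-order part of [X Y f] is symmetric in [X] and
    [Y] by [derive_comm]; the first-order parts make up the components of the
    bracket. *)
Lemma act_bracket p X Y f : smooth_vf p X -> smooth_vf p Y ->
  smooth_fun p f ->
  vf_act X (vf_act Y f) p - vf_act Y (vf_act X f) p = vf_act (bracket X Y) f p.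
Proof.
move=> sX sY sf; set F := local_fun p f.
have [U [oU Up] sU] := sf.
have key Z W : smooth_vf p Z -> smooth_vf p W ->
    vf_act Z (vf_act W f) p = 'd F (base p) ('d (local_vf p W) (base p) (Z p))
     + \sum_j \sum_i W p 0 j * Z p 0 i *
        'D_(delta_mx 0 i) ('D_(delta_mx 0 j) F) (base p).
  move=> sZ sW.
  pose G j := (fun u => local_vf p W u 0 j) * 'D_(delta_mx 0 j) F.
  have dW := smooth_vf_diff sW.
  have d1 j : differentiable (fun u => local_vf p W u 0 j) (base p).
    apply: (@differentiable_comp _ _ _ _ (local_vf p W) (fun A => A 0 j : R)) => //.
    exact: differentiable_coord.
  have d2 j : differentiable ('D_(delta_mx 0 j) F) (base p).
    by have [_ /(_ (delta_mx 0 j))[d _]] := sU 2; exact: d.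
  have E : \forall u \near base p, (\sum_j G j) u = local_fun p (vf_act W f) u.
    have [dU _] := sU 1.
    apply: filterS2 (open_nbhs_nbhs (conj oU Up)) (local_fun_act W sf) => u Uu ->.
    rewrite derive_rV_sum; last exact: dU.
    by rewrite fct_sumE.
  have dG j : differentiable (G j) (base p) by exact: differentiableM.
  rewrite /vf_act -(diff_near_eq _ E); last exact: differentiable_sum.
  rewrite -deriveE; last exact: differentiable_sum.
  rewrite derive_sum; last by move=> j; exact: diff_derivable.
  rewrite [X in _ = X + _]derive_rV_sum; last exact: smooth_fun_diff.
  rewrite -big_split /=; apply: eq_bigr => j _.
  rewrite deriveM; [|exact: diff_derivable|exact: diff_derivable].
  rewrite addrC; congr (_ + _); last first.
    rewrite -deriveE// derive_mx ?mxE; last exact: diff_derivable.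
    exact: mulrC.
  rewrite local_vf_base deriveE// derive_rV_sum// scaler_sumr.
  by apply: eq_bigr => i _; exact: mulrA.
rewrite !key// opprD addrACA exchange_big /= [X in _ + X](_ : _ = 0) ?addr0.
  by rewrite /vf_act /bracket linearB.
apply/eqP; rewrite subr_eq0; apply/eqP; apply: eq_bigr => i _.
apply: eq_bigr => j _; rewrite (derive_comm _ _ oU Up (sU 2)).
by rewrite (mulrC (Y p 0 j)).
Qed.

End Fields.

Section ConstantFields.
Variables (R : realType) (m : nat) (M : manifold R m).
Implicit Types (p q x : M) (u v : 'rV[R]_m) (N : set M) (X Y Z : vfield M).
Implicit Types (f h : M -> R).

(** The coordinate fields and their combinations with constant coefficients.  They
    extend a tangent vector at [p] to a field that is smooth on the whole domain of
    the chart, so that it can be differentiated repeatedly. *)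
Definition const_vf p v : vfield M := fun q => 'd (trans p q) (coord p q) v.

Lemma const_vf_at p v : const_vf p v p = v.
Proof. by rewrite /const_vf diff_trans_id//; exact: base_dom. Qed.

Lemma const_vf_smooth p v q : dom p q -> smooth_vf q (const_vf p v).
Proof.
move=> pq.
apply: (@smooth_near _ _ _ _ ('D_v (trans p q) \o trans q p)).
  apply: filterS (near_base (open_dom p) pq) => u /chart_setP[qx xE px].
  set x := param q u in qx xE px.
  have dpq := trans_differentiable px qx.
  rewrite /local_vf /tangent_coord -[chart_param _ _]/x /const_vf.
  rewrite -[LHS]/('D_v (trans p q) (coord p x)) deriveE//.
  by apply/esym; exact: diff_trans_comp px (base_dom x) qx.
exists (chart_set q (dom p)).
  split; first exact/open_chart_set/open_dom.
  exact: chart_set_coord (base_dom q) pq.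
move=> k; apply: (@Ck_on_comp _ _ _ _ _ _ (chart_set p (dom q))).
- exact/open_chart_set/open_dom.
- exact/open_chart_set/open_dom.
- move=> u /chart_setP[h1 h2 h3]; rewrite /trans/=.
  exact: chart_set_coord.
- exact: trans_smooth.
- by have [_] := @trans_smooth _ _ _ p q k.+1; exact.
Qed.

Lemma coord_smooth p q a : dom p q -> smooth_fun q (fun x => coord p x 0 a).
Proof.
move=> pq; exists (chart_set q (dom p)).
  split; first exact/open_chart_set/open_dom.
  exact: chart_set_coord (base_dom q) pq.
move=> k; apply: (@Ck_on_coord _ _ k _ _ _ (trans q p) 0 a).
  exact/open_chart_set/open_dom.
exact: trans_smooth.
Qed.

(** A field is determined at [p] by its action on the coordinate functions; this
    turns identities between operators on functions into identities between
    fields. *)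
Lemma act_coord p X a : vf_act X (fun x => coord p x 0 a) p = X p 0 a.
Proof.
have dT := trans_differentiable (base_dom p) (base_dom p).
rewrite /vf_act -[local_fun p _]/(fun u => trans p p u 0 a).
rewrite -deriveE; last first.
  apply: (@differentiable_comp _ _ _ _ (trans p p) (fun A => A 0 a : R)) => //.
  exact: differentiable_coord.
have dX : derivable (trans p p) (coord p p) (X p) by exact: diff_derivable.
have := derive_mx dX; rewrite (deriveE _ dT) diff_trans_id; last exact: base_dom.
by move=> /rowP/(_ a) ->; rewrite mxE.
Qed.

End ConstantFields.

Section Connection.
Variables (R : realType) (m : nat) (M : manifold R m) (g : metric M).
Variables (nabla : vfield M -> vfield M -> vfield M) (LC : levi_civita g nabla).
Implicit Types (p q x : M) (u v : 'rV[R]_m) (N : set M) (X Y Z : vfield M).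
Implicit Types (f h : M -> R).

Lemma smooth_vfN p X : smooth_vf p X -> smooth_vf p (fun q => - X q).
Proof.
move=> sX; have -> : (fun q => - X q) = (fun q => -1 *: X q).
  by apply/funext => q; rewrite scaleN1r.
by apply: smooth_vfZ => //; exact: smooth_cst.
Qed.

Lemma smooth_vfB p X Y : smooth_vf p X -> smooth_vf p Y ->
  smooth_vf p (fun q => X q - Y q).
Proof. by move=> sX sY; apply: smooth_vfD => //; exact: smooth_vfN. Qed.

Lemma smooth_funN p f : smooth_fun p f -> smooth_fun p (fun q => - f q).
Proof.
move=> sf; have -> : (fun q => - f q) = (fun q => -1 * f q).
  by apply/funext => q; rewrite mulN1r.
by apply: smooth_funM => //; exact: smooth_cst.
Qed.

Lemma smooth_funB p f h : smooth_fun p f -> smooth_fun p h ->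
  smooth_fun p (fun q => f q - h q).
Proof. by move=> sX sY; apply: smooth_funD => //; exact: smooth_funN. Qed.

Lemma actN p X f : smooth_fun p f -> vf_act X (fun q => - f q) p = - vf_act X f p.
Proof.
move=> sf; have -> : (fun q => - f q) = (fun q => -1 * f q).
  by apply/funext => q; rewrite mulN1r.
rewrite actM//; last exact: smooth_cst.
by rewrite act_cst mulr0 addr0 mulN1r.
Qed.

Lemma actB p X f h : smooth_fun p f -> smooth_fun p h ->
  vf_act X (fun q => f q - h q) p = vf_act X f p - vf_act X h p.
Proof. by move=> sf sh; rewrite actD ?actN//; exact: smooth_funN. Qed.

Lemma act_scale p (c : R) X f : smooth_fun p f ->
  vf_act X (fun q => c * f q) p = c * vf_act X f p.
Proof.
move=> sf; rewrite actM//; last exact: smooth_cst.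
by rewrite act_cst mulr0 addr0.
Qed.

Lemma nabla_oppr p X Y : smooth_vf p X -> smooth_vf p Y ->
  nabla X (fun q => - Y q) p = - nabla X Y p.
Proof.
move=> sX sY; have -> : (fun q => - Y q) = (fun q => -1 *: Y q).
  by apply/funext => q; rewrite scaleN1r.
rewrite (nabla_leibniz LC)//; last exact: smooth_cst.
by rewrite act_cst scale0r add0r scaleN1r.
Qed.

Lemma nabla_subr p X Y Z : smooth_vf p X -> smooth_vf p Y -> smooth_vf p Z ->
  nabla X (fun q => Y q - Z q) p = nabla X Y p - nabla X Z p.
Proof.
move=> sX sY sZ; rewrite (nabla_addr LC)//; last exact: smooth_vfN.
by rewrite nabla_oppr.
Qed.

Lemma nabla_oppl p X Y : smooth_vf p X -> smooth_vf p Y ->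
  nabla (fun q => - X q) Y p = - nabla X Y p.
Proof.
move=> sX sY; have -> : (fun q => - X q) = (fun q => -1 *: X q).
  by apply/funext => q; rewrite scaleN1r.
by rewrite (nabla_scalel LC) ?scaleN1r//; exact: smooth_cst.
Qed.

Lemma nabla_subl p X Y Z : smooth_vf p X -> smooth_vf p Y -> smooth_vf p Z ->
  nabla (fun q => X q - Y q) Z p = nabla X Z p - nabla Y Z p.
Proof.
move=> sX sY sZ; rewrite (nabla_addl LC)//; last exact: smooth_vfN.
by rewrite nabla_oppl.
Qed.

(** A field vanishing on a neighbourhood [N] of [p] is its own product with the
    indicator function of the complement of [N], which is locally constant at
    [p] and vanishes there.  A connection applied to it therefore vanishes at [p],
    by linearity over functions or by the Leibniz rule. *)
Lemma near0_indicator p X : agree_near p (fun=> 0) X ->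
  exists f, [/\ smooth_fun p f, f p = 0 & X = (fun q => f q *: X q)].
Proof.
move=> [N [oN Np] X0]; exists (fun q => if `[< N q >] then 0 else 1); split.
- apply: smooth_fun_eq (smooth_cst p 0); exists N => // q Nq.
  by rewrite asboolT.
- by rewrite asboolT.
- apply/funext => q; case: ifP => [/asboolP Nq|_]; last by rewrite scale1r.
  by rewrite scale0r -X0.
Qed.

Lemma agree_sub0 p X Y : agree_near p X Y -> agree_near p (fun=> 0) (fun q => Y q - X q).
Proof. by move=> [N oN XY]; exists N => // q /XY ->; rewrite subrr. Qed.

Lemma nabla_eqr p X Y Y' : agree_near p Y Y' -> smooth_vf p X ->
  smooth_vf p Y -> nabla X Y p = nabla X Y' p.
Proof.
move=> YY' sX sY; have sY' := smooth_vf_eq YY' sY.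
apply/eqP; rewrite eq_sym -subr_eq0 -nabla_subr//.
have sD := smooth_vfB sY' sY.
have [f [sf fp E]] := near0_indicator (agree_sub0 YY').
have [N [_ Np] EN] := YY'.
by rewrite E (nabla_leibniz LC)// fp (EN _ Np) subrr scaler0 scale0r addr0.
Qed.

Lemma nabla_eql p X X' Y : agree_near p X X' -> smooth_vf p X ->
  smooth_vf p Y -> nabla X Y p = nabla X' Y p.
Proof.
move=> XX' sX sY; have sX' := smooth_vf_eq XX' sX.
apply/eqP; rewrite eq_sym -subr_eq0 -nabla_subl//.
have sD := smooth_vfB sX' sX.
have [f [sf fp E]] := near0_indicator (agree_sub0 XX').
by rewrite E (nabla_scalel LC)// fp scale0r.
Qed.

(** Second covariant derivatives at a point require smoothness of the fields at
    the nearby points as well, hence this predicate, used for open [N]. *)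
Definition smooth_vf_on N X := forall q, N q -> smooth_vf q X.

(** The bracket is the alternation of the covariant derivative, whose smoothness
    is part of the definition of a connection. *)
Lemma bracket_smooth N p X Y : open N -> N p -> smooth_vf_on N X ->
  smooth_vf_on N Y -> smooth_vf p (bracket X Y).
Proof.
move=> oN Np sX sY.
apply: (@smooth_vf_eq _ _ _ _ (fun q => nabla X Y q - nabla Y X q)).
  by exists N => // q Nq; apply: (nabla_torsion LC); [exact: sX|exact: sY].
by apply: smooth_vfB; apply: (nabla_smooth LC); auto.
Qed.

(** The commutators of derivations satisfy the Jacobi identity, and a field is
    determined by its action on coordinate functions. *)
Lemma jacobi N p X Y Z : open N -> N p -> smooth_vf_on N X ->
  smooth_vf_on N Y -> smooth_vf_on N Z ->
  bracket X (bracket Y Z) p + bracket Y (bracket Z X) p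
    + bracket Z (bracket X Y) p = 0.
Proof.
move=> oN Np sX sY sZ; apply/rowP => a.
have sumE (A B C : 'rV[R]_m) : (A + B + C) 0 a = A 0 a + B 0 a + C 0 a.
  by rewrite !mxE.
rewrite sumE [RHS]mxE.
pose f := fun x => coord p x 0 a.
pose N' := N `&` dom p.
have oN' : open N' by apply: openI => //; exact: open_dom.
have N'p : N' p by split=> //; exact: base_dom.
have sf q : N' q -> smooth_fun q f by move=> [_ pq]; exact: coord_smooth.
have key X1 X2 X3 : smooth_vf_on N X1 -> smooth_vf_on N X2 -> smooth_vf_on N X3 ->
  bracket X1 (bracket X2 X3) p 0 a =
   vf_act X1 (vf_act X2 (vf_act X3 f)) p - vf_act X1 (vf_act X3 (vf_act X2 f)) p
   - (vf_act X2 (vf_act X3 (vf_act X1 f)) p - vf_act X3 (vf_act X2 (vf_act X1 f)) p).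
  move=> s1 s2 s3; have s23 := bracket_smooth oN Np s2 s3.
  have sf1 := smooth_act (s1 _ Np) (sf _ N'p).
  have sf2 := smooth_act (s2 _ Np) (sf _ N'p).
  have sf3 := smooth_act (s3 _ Np) (sf _ N'p).
  rewrite -act_coord -/f -act_bracket//; [|exact: s1|exact: sf].
  rewrite -(act_bracket (s2 _ Np) (s3 _ Np) sf1); congr (_ - _).
  rewrite -actB; [|apply: smooth_act => //; exact: s2
    |apply: smooth_act => //; exact: s3].
  apply/esym/act_eq.
    exists N' => // q N'q; have [Nq _] := N'q.
    by rewrite act_bracket//; [exact: s2|exact: s3|exact: sf].
  apply: smooth_funB; apply: smooth_act => //; [exact: s2|exact: s3].
rewrite (key X Y Z)// (key Y Z X)// (key Z X Y)//.
have cancel6 (a1 a2 a3 a4 a5 a6 : R) : a1 - a2 - (a3 - a4) +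
  (a3 - a5 - (a6 - a2)) + (a6 - a4 - (a1 - a5)) = 0 by ring.
exact: cancel6.
Qed.

End Connection.


(** * Symmetries of the Riemann tensor *)

Section Metric.
Variables (R : realType) (m : nat) (M : manifold R m) (g : metric M).
Implicit Types (p : M) (x y z : 'rV[R]_m) (a : R).

Lemma metricC p x y : g p x y = g p y x.
Proof. exact: Defs.metric_sym. Qed.

Lemma metricDl p x y z : g p (x + y) z = g p x z + g p y z.
Proof. by rewrite -[x]scale1r metric_linear mul1r scale1r. Qed.

Lemma metric0l p z : g p 0 z = 0.
Proof. by apply: (addrI (g p 0 z)); rewrite -metricDl !addr0. Qed.

Lemma metricZl p a x z : g p (a *: x) z = a * g p x z.
Proof. by rewrite -[a *: x]addr0 metric_linear metric0l addr0. Qed.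

Lemma metricNl p x z : g p (- x) z = - g p x z.
Proof. by rewrite -scaleN1r metricZl mulN1r. Qed.

Lemma metricBl p x y z : g p (x - y) z = g p x z - g p y z.
Proof. by rewrite metricDl metricNl. Qed.

Lemma metricDr p x y z : g p z (x + y) = g p z x + g p z y.
Proof. by rewrite metricC metricDl !(metricC p z). Qed.

Lemma metric0r p z : g p z 0 = 0.
Proof. by rewrite metricC metric0l. Qed.

Lemma metricZr p a x z : g p z (a *: x) = a * g p z x.
Proof. by rewrite metricC metricZl (metricC p z). Qed.

Lemma metricNr p x z : g p z (- x) = - g p z x.
Proof. by rewrite metricC metricNl (metricC p z). Qed.

Lemma metricBr p x y z : g p z (x - y) = g p z x - g p z y.
Proof. by rewrite metricDr metricNr. Qed.

Lemma metric_eq0 p x : g p x x = 0 -> x = 0.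
Proof.
move=> x0; apply/eqP/negPn/negP => /(Defs.metric_pos g p).
by rewrite x0 ltxx.
Qed.

Lemma metric_inj p x y : (forall z, g p x z = g p y z) -> x = y.
Proof.
by move=> E; apply/eqP; rewrite -subr_eq0; apply/eqP/(@metric_eq0 p);
   rewrite metricBl E subrr.
Qed.

End Metric.

(** The octahedron argument: the four Bianchi identities add up to the claim. *)
Lemma pair_symmetry (R : realDomainType) (T : Type) (P : T -> Prop)
    (r : T -> T -> T -> T -> R) :
  (forall A B C D, P A -> P B -> P C -> P D -> r A B C D = - r B A C D) ->
  (forall A B C D, P A -> P B -> P C -> P D -> r A B C D = - r A B D C) ->
  (forall A B C D, P A -> P B -> P C -> P D ->
     r A B C D + r B C A D + r C A B D = 0) ->
  forall X Y Z V, P X -> P Y -> P Z -> P V -> r X Y Z V = r Z V X Y.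
Proof.
move=> s12 s34 b X Y Z V sX sY sZ sV.
have := b X Y Z V sX sY sZ sV; have := b Y Z V X sY sZ sV sX.
have := b Z V X Y sZ sV sX sY; have := b V X Y Z sV sX sY sZ.
rewrite (s34 Y Z V X)// (s34 Z V Y X)// (s12 V Y Z X)// (s34 Y V Z X)//.
rewrite (s12 V X Z Y)// (s12 V X Y Z)// (s34 X V Y Z)// (s34 X Y V Z)//.
rewrite (s12 Y V X Z)// (s12 X Z V Y)// (s34 Z X V Y)//.
move: (r X Y Z V) (r Z V X Y) (r Y Z X V) (r Y V Z X) (r X V Z Y) (r Z X Y V).
move: (r Y V X Z) (r Z V Y X) => a b' c d e f h i.
rewrite ?opprK; lra.
Qed.

Section Curvature.
Variables (R : realType) (m : nat) (M : manifold R m) (g : metric M).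
Variables (nabla : vfield M -> vfield M -> vfield M) (LC : levi_civita g nabla).
Variables (N : set M) (oN : open N).
Implicit Types (p q : M) (X Y Z V : vfield M).
Local Notation smooth := (smooth_vf_on N).
Local Notation curv := (curvature nabla).

Lemma nabla_smooth_on X Y : smooth X -> smooth Y -> smooth (nabla X Y).
Proof.
by move=> sX sY q Nq; apply: (nabla_smooth LC); [exact: sX|exact: sY].
Qed.

Lemma bracket_smooth_on X Y : smooth X -> smooth Y -> smooth (bracket X Y).
Proof. by move=> sX sY q Nq; exact: (bracket_smooth LC oN Nq). Qed.

Lemma metric_smooth_on X Y : smooth X -> smooth Y ->
  forall q, N q -> smooth_fun q (fun q => g q (X q) (Y q)).
Proof.
by move=> sX sY q Nq; apply: (metric_smooth g); [exact: sX|exact: sY].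
Qed.

Lemma bracketC X Y q : bracket Y X q = - bracket X Y q.
Proof. by rewrite /bracket opprB. Qed.

Lemma curvature_skew X Y Z p : N p -> smooth X -> smooth Y -> smooth Z ->
  curv Y X Z p = - curv X Y Z p.
Proof.
move=> Np sX sY sZ; rewrite /curvature.
have -> : bracket Y X = (fun q => - bracket X Y q).
  by apply/funext => q; exact: bracketC.
rewrite (nabla_oppl LC); [|exact: bracket_smooth_on|exact: sZ].
by rewrite opprK [RHS]opprB opprB addrC.
Qed.

Lemma act_act_metric X Y Z V p : N p -> smooth X -> smooth Y -> smooth Z ->
  smooth V ->
  vf_act X (vf_act Y (fun q => g q (Z q) (V q))) p
  = g p (nabla X (nabla Y Z) p) (V p) + g p (nabla Y Z p) (nabla X V p)
    + (g p (nabla X Z p) (nabla Y V p) + g p (Z p) (nabla X (nabla Y V) p)).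
Proof.
move=> Np sX sY sZ sV.
have sYZ := nabla_smooth_on sY sZ; have sYV := nabla_smooth_on sY sV.
transitivity (vf_act X (fun q => g q (nabla Y Z q) (V q)
                               + g q (Z q) (nabla Y V q)) p).
  apply: act_eq.
    exists N => // q Nq; apply: (nabla_metric LC); [exact: sY|exact: sZ|exact: sV].
  by apply: smooth_act; [exact: sY|exact: metric_smooth_on].
rewrite actD; [|exact: metric_smooth_on|exact: metric_smooth_on].
by congr (_ + _); apply: (nabla_metric LC); auto.
Qed.

(** [X Y - Y X - [X, Y]] kills the function [g(Z, V)], and expanding it with the
    compatibility of the metric leaves the two curvature terms. *)
Lemma curvature_metric X Y Z V p : N p -> smooth X -> smooth Y -> smooth Z ->
  smooth V -> g p (curv X Y Z p) (V p) = - g p (Z p) (curv X Y V p).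
Proof.
move=> Np sX sY sZ sV.
have sf := metric_smooth_on sZ sV Np.
have := act_bracket (sX _ Np) (sY _ Np) sf.
rewrite !act_act_metric// (nabla_metric LC); [|exact: bracket_smooth_on
  |exact: sZ|exact: sV].
rewrite /curvature !metricBl !metricBr.
move: (g p (nabla X (nabla Y Z) p) _) (g p _ (nabla X (nabla Y V) p)).
move: (g p (nabla Y (nabla X Z) p) _) (g p _ (nabla Y (nabla X V) p)).
move: (g p (nabla Y Z p) _) (g p (nabla X Z p) _).
move: (g p (nabla (bracket X Y) Z p) _) (g p _ (nabla (bracket X Y) V p)).
move=> a b c d e f h i E.
have -> : h - e - a = (h + c + (d + i) - (e + d + (c + f))) - a - i + f by ring.
by rewrite E; ring.
Qed.

(** With vanishing torsion the cyclic sum of [R(X,Y)Z] is that of the iterated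
    brackets. *)
Lemma bianchi X Y Z p : N p -> smooth X -> smooth Y -> smooth Z ->
  curv X Y Z p + curv Y Z X p + curv Z X Y p = 0.
Proof.
move=> Np sX sY sZ.
have key U V W : smooth U -> smooth V -> smooth W ->
    nabla U (nabla V W) p - nabla U (nabla W V) p - nabla (bracket V W) U p
    = bracket U (bracket V W) p.
  move=> sU sV sW; have sVW := bracket_smooth_on sV sW.
  rewrite -(nabla_subr LC); [|exact: sU|exact: nabla_smooth_on
    |exact: nabla_smooth_on].
  rewrite -(nabla_torsion LC); [|exact: sU|exact: sVW].
  congr (_ - _); apply: (nabla_eqr LC).
  - exists N => // q Nq; apply: (nabla_torsion LC); [exact: sV|exact: sW].
  - exact: sU.
  - by apply: smooth_vfB; apply: nabla_smooth_on.
rewrite -(jacobi LC oN Np sX sY sZ) -!key// /curvature.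
move: (nabla X (nabla Y Z) p) (nabla Y (nabla X Z) p) => a1 a2.
move: (nabla (bracket X Y) Z p) (nabla Y (nabla Z X) p) => a3 a4.
move: (nabla Z (nabla Y X) p) (nabla (bracket Y Z) X p) => a5 a6.
move: (nabla Z (nabla X Y) p) (nabla X (nabla Z Y) p) => a7 a8.
move: (nabla (bracket Z X) Y p) => a9.
by apply/rowP => i; rewrite !mxE; ring.
Qed.

Lemma curvature_pair X Y Z V p : N p -> smooth X -> smooth Y -> smooth Z ->
  smooth V -> g p (curv X Y Z p) (V p) = g p (curv Z V X p) (Y p).
Proof.
move=> Np sX sY sZ sV.
apply: (pair_symmetry (P := smooth)
  (r := fun A B C D => g p (curv A B C p) (D p))) => //.
- by move=> A B C D *; rewrite curvature_skew// metricNl.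
- by move=> A B C D *; rewrite curvature_metric// metricC.
- by move=> A B C D *; rewrite -!metricDl bianchi// metric0l.
Qed.

End Curvature.


(** * The linear algebra of a tangent space *)

(** The structure of a tangent space for an even triple [(i, j, k)]: the metric,
    the three endomorphisms and the three characteristic vectors.  The three
    1-forms are the inner products with the characteristic vectors. *)
Record frame (R : realType) (V : lmodType R) := Frame {
  fg : V -> V -> R;
  f1 : {linear V -> V}; f2 : {linear V -> V}; f3 : {linear V -> V};
  x1 : V; x2 : V; x3 : V }.

(** Cyclic permutations carry statements about the first structure to the other
    two. *)
Definition frame_rot (R : realType) (V : lmodType R) (F : frame V) : frame V :=
  Frame (fg F) (f2 F) (f3 F) (f1 F) (x2 F) (x3 F) (x1 F).

Record is_frame (R : realType) (V : lmodType R) (F : frame V) : Prop := IsFrame {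
  fgC : forall x y, fg F x y = fg F y x;
  fgDl : forall x y z, fg F (x + y) z = fg F x z + fg F y z;
  fgZl : forall a x z, fg F (a *: x) z = a * fg F x z;
  fg_eq0 : forall x, fg F x x = 0 -> x = 0;
  f1_skew : forall x y, fg F x (f1 F y) = - fg F (f1 F x) y;
  f2_skew : forall x y, fg F x (f2 F y) = - fg F (f2 F x) y;
  f3_skew : forall x y, fg F x (f3 F y) = - fg F (f3 F x) y;
  f11 : forall x, f1 F (f1 F x) = - x + fg F (x1 F) x *: x1 F;
  f22 : forall x, f2 F (f2 F x) = - x + fg F (x2 F) x *: x2 F;
  f33 : forall x, f3 F (f3 F x) = - x + fg F (x3 F) x *: x3 F;
  f12 : forall x, f1 F (f2 F x) = f3 F x + fg F (x2 F) x *: x1 F;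
  f23 : forall x, f2 F (f3 F x) = f1 F x + fg F (x3 F) x *: x2 F;
  f31 : forall x, f3 F (f1 F x) = f2 F x + fg F (x1 F) x *: x3 F;
  f21 : forall x, f2 F (f1 F x) = - f3 F x + fg F (x1 F) x *: x2 F;
  f32 : forall x, f3 F (f2 F x) = - f1 F x + fg F (x2 F) x *: x3 F;
  f13 : forall x, f1 F (f3 F x) = - f2 F x + fg F (x3 F) x *: x1 F;
  f1x1 : f1 F (x1 F) = 0; f2x2 : f2 F (x2 F) = 0; f3x3 : f3 F (x3 F) = 0;
  f1x2 : f1 F (x2 F) = x3 F; f2x3 : f2 F (x3 F) = x1 F;
  f3x1 : f3 F (x1 F) = x2 F;
  f2x1 : f2 F (x1 F) = - x3 F; f3x2 : f3 F (x2 F) = - x1 F;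
  f1x3 : f1 F (x3 F) = - x2 F;
  g11 : fg F (x1 F) (x1 F) = 1; g22 : fg F (x2 F) (x2 F) = 1;
  g33 : fg F (x3 F) (x3 F) = 1;
  g12 : fg F (x1 F) (x2 F) = 0; g23 : fg F (x2 F) (x3 F) = 0;
  g31 : fg F (x3 F) (x1 F) = 0 }.

Lemma frame_rot_frame (R : realType) (V : lmodType R) (F : frame V) :
  is_frame F -> is_frame (frame_rot F).
Proof. by case=> *; split. Qed.

Section FrameForms.
Variables (R : realType) (V : lmodType R) (al de : R).
Implicit Types (F : frame V) (w z u : V).

Definition frameT F z w : V :=
  fg F (x1 F) z *: ((de - al) *: f1 F w
    - al *: (fg F (x2 F) w *: x3 F - fg F (x3 F) w *: x2 F))
  + al *: (fg F w (f1 F z) *: x1 F - fg F (x1 F) w *: f1 F z).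

(** The connection form of the canonical connection.  It is the sum over the three
    structures of terms that act on the span of the characteristic vectors and on
    the horizontal space through the structures, plus terms exchanging the two; its
    coefficients are chosen for [frameB_torsion1], which reproduces [d eta_1], and
    for the skewness [frameB_skew]. *)
Definition frameB F z w : V :=
  frameT F z w + frameT (frame_rot F) z w + frameT (frame_rot (frame_rot F)) z w.

(** [frameD F z] is the commutator of [frameB F z] with the first structure. *)
Definition frameD F z w : V :=
  let be := de - al in
  al *: (fg F z w *: x1 F - fg F (x1 F) w *: z)
  + (2 * be) *: (fg F (x3 F) z *: f2 F w - fg F (x2 F) z *: f3 F w)
  - be *: ((fg F (x2 F) z * fg F (x2 F) w + fg F (x3 F) z * fg F (x3 F) w) *: x1 F
           - fg F (x1 F) w *: (fg F (x2 F) z *: x2 F + fg F (x3 F) z *: x3 F)).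

(** If a torsion-free connection is the sum of a connection [D] and of [frameB],
    and [frameB] is [D]-parallel, then [frameQ] is the difference of the two
    curvatures. *)
Definition frameQ F x y z : V :=
  frameB F x (frameB F y z) - frameB F y (frameB F x z)
  - frameB F (frameB F x y - frameB F y x) z.

End FrameForms.

Section FrameAlgebra.
Variables (R : realType) (V : lmodType R) (F : frame V) (HF : is_frame F).
Variables (al de : R).
Implicit Types (u v w z : V) (a : R).
Local Notation g := (fg F).
Local Notation f1 := (f1 F). Local Notation f2 := (f2 F).
Local Notation f3 := (f3 F). Local Notation x1 := (x1 F).
Local Notation x2 := (x2 F). Local Notation x3 := (x3 F).

Lemma fgDr u v w : g u (v + w) = g u v + g u w.
Proof. by rewrite fgC// fgDl// !(fgC HF u). Qed.
Lemma fgZr a u w : g u (a *: w) = a * g u w.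
Proof. by rewrite fgC// fgZl// (fgC HF u). Qed.
Lemma fgNl u w : g (- u) w = - g u w.
Proof. by rewrite -scaleN1r fgZl// mulN1r. Qed.
Lemma fgNr u w : g u (- w) = - g u w.
Proof. by rewrite -scaleN1r fgZr mulN1r. Qed.
Lemma fg0l w : g 0 w = 0.
Proof. by rewrite -(scale0r 0) fgZl// mul0r. Qed.
Lemma fg0r w : g w 0 = 0.
Proof. by rewrite -(scale0r 0) fgZr mul0r. Qed.
Lemma fg_inj u v : (forall w, g u w = g v w) -> u = v.
Proof.
move=> E; apply/eqP; rewrite -subr_eq0; apply/eqP/(fg_eq0 HF).
by rewrite fgDl// fgNl E subrr.
Qed.

Let gx1 u : g u x1 = g x1 u. Proof. exact: fgC. Qed.
Let gx2 u : g u x2 = g x2 u. Proof. exact: fgC. Qed.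
Let gx3 u : g u x3 = g x3 u. Proof. exact: fgC. Qed.
Let g21 : g x2 x1 = 0. Proof. by rewrite fgC// g12. Qed.
Let g32 : g x3 x2 = 0. Proof. by rewrite fgC// g23. Qed.
Let g13 : g x1 x3 = 0. Proof. by rewrite fgC// g31. Qed.

Definition frame_linE := (fgDl HF, fgDr, fgNl, fgNr, fgZl HF, fgZr, fg0l, fg0r).

Definition frame_tableE :=
  (f1x1 HF, f1x2 HF, f1x3 HF, f2x1 HF, f2x2 HF, f2x3 HF, f3x1 HF, f3x2 HF,
   f3x3 HF, f11 HF, f12 HF, f13 HF, f21 HF, f22 HF, f23 HF, f31 HF, f32 HF,
   f33 HF).

Definition frame_gE := (g11 HF, g22 HF, g33 HF, g12 HF, g23 HF, g31 HF, g21,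
  g32, g13, f1_skew HF, f2_skew HF, f3_skew HF, gx1, gx2, gx3).

Let f1Z a u : f1 (a *: u) = a *: f1 u. Proof. exact: linearZ. Qed.
Let f2Z a u : f2 (a *: u) = a *: f2 u. Proof. exact: linearZ. Qed.
Let f3Z a u : f3 (a *: u) = a *: f3 u. Proof. exact: linearZ. Qed.
Let f1D u w : f1 (u + w) = f1 u + f1 w. Proof. exact: linearD. Qed.
Let f1N u : f1 (- u) = - f1 u. Proof. exact: linearN. Qed.
Let f10 : f1 0 = 0. Proof. exact: linear0. Qed.
Let f2D u w : f2 (u + w) = f2 u + f2 w. Proof. exact: linearD. Qed.
Let f2N u : f2 (- u) = - f2 u. Proof. exact: linearN. Qed.
Let f20 : f2 0 = 0. Proof. exact: linear0. Qed.
Let f3D u w : f3 (u + w) = f3 u + f3 w. Proof. exact: linearD. Qed.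
Let f3N u : f3 (- u) = - f3 u. Proof. exact: linearN. Qed.
Let f30 : f3 0 = 0. Proof. exact: linear0. Qed.
Let flin := (f1D, f2D, f3D, f1N, f2N, f3N, f1Z, f2Z, f3Z, f10, f20, f30).

Definition frame_fE := flin.

Lemma f1_swap u w : g (f1 u) w = - g (f1 w) u.
Proof. by rewrite fgC// f1_skew. Qed.
Lemma f2_swap u w : g (f2 u) w = - g (f2 w) u.
Proof. by rewrite fgC// f2_skew. Qed.
Lemma f3_swap u w : g (f3 u) w = - g (f3 w) u.
Proof. by rewrite fgC// f3_skew. Qed.

Local Notation B := (frameB al de F).
Local Notation D := (frameD al de F).

Lemma frameB_rot z w : frameB al de (frame_rot F) z w = B z w.
Proof. by rewrite /frameB addrC addrA. Qed.

Lemma frameB_x1 z :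
  B z x1 = - al *: f1 z + (al - de) *: (g x2 z *: x3 - g x3 z *: x2).
Proof.
apply: fg_inj => u; rewrite /frameB /frameT /=.
rewrite ?(frame_tableE, flin, frame_linE, frame_gE).
by ring.
Qed.

Lemma frameB_at_x1 w :
  B x1 w = (de - al) *: f1 w + al *: (g x2 w *: x3 - g x3 w *: x2).
Proof.
apply: fg_inj => u; rewrite /frameB /frameT /=.
rewrite ?(frame_tableE, flin, frame_linE, frame_gE).
by ring.
Qed.

Lemma frameB_skew z w u : g (B z w) u = - g w (B z u).
Proof.
rewrite /frameB /frameT /=.
rewrite ?(frame_tableE, flin, frame_linE, frame_gE).
by rewrite (f1_swap u z) (f2_swap u z) (f3_swap u z); ring.
Qed.

Lemma frameB_comm z w : B z (f1 w) - f1 (B z w) = D z w.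
Proof.
apply: fg_inj => u; rewrite /frameB /frameT /frameD /=.
rewrite ?(frame_tableE, flin, frame_linE, frame_gE).
by rewrite (fgC HF w z); ring.
Qed.

Lemma frameBDr z u w : B z (u + w) = B z u + B z w.
Proof.
by apply: fg_inj => v; rewrite (fgDl HF) !frameB_skew (fgDl HF) opprD.
Qed.

Lemma frameBZr z a u : B z (a *: u) = a *: B z u.
Proof.
by apply: fg_inj => v; rewrite (fgZl HF) !frameB_skew (fgZl HF) mulrN.
Qed.

Lemma frameBDl y z w : B (y + z) w = B y w + B z w.
Proof.
apply: fg_inj => u; rewrite /frameB /frameT /=.
rewrite ?(flin, frame_linE, f1_skew HF, f2_skew HF, f3_skew HF).
by ring.
Qed.

Lemma frameBZl a z w : B (a *: z) w = a *: B z w.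
Proof.
apply: fg_inj => u; rewrite /frameB /frameT /=.
rewrite ?(flin, frame_linE, f1_skew HF, f2_skew HF, f3_skew HF).
by ring.
Qed.

(** The vectors [(u, a)] of the sum of the tangent space with a line carry the three
    endomorphisms [(u, a) |-> (f_i u - a x_i, g x_i u)].  By this lemma and the two
    following ones they multiply like the quaternion units. *)
Lemma frame_hat_sq u a :
  f1 (f1 u - a *: x1) - g x1 u *: x1 = - u /\ g x1 (f1 u - a *: x1) = - a.
Proof.
split; last by rewrite ?(frame_tableE, flin, frame_linE, frame_gE); ring.
apply: fg_inj => w; rewrite ?(frame_tableE, flin, frame_linE, frame_gE).
by ring.
Qed.

Lemma frame_hat_mul u a :
  f3 u - a *: x3 = f1 (f2 u - a *: x2) - g x2 u *: x1 /\
  g x3 u = g x1 (f2 u - a *: x2).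
Proof.
split; last by rewrite ?(frame_tableE, flin, frame_linE, frame_gE); ring.
apply: fg_inj => w; rewrite ?(frame_tableE, flin, frame_linE, frame_gE).
by ring.
Qed.

Lemma frame_hat_mulC u a :
  f3 u - a *: x3 = - (f2 (f1 u - a *: x1) - g x1 u *: x2) /\
  g x3 u = - g x2 (f1 u - a *: x1).
Proof.
split; last by rewrite ?(frame_tableE, flin, frame_linE, frame_gE); ring.
apply: fg_inj => w; rewrite ?(frame_tableE, flin, frame_linE, frame_gE).
by ring.
Qed.

(** For a 3-(alpha, delta)-Sasaki structure the right-hand side is [- d eta_1]. *)
Lemma frameB_torsion1 z w : g x1 (B z w) - g x1 (B w z) =
  - (2 * al * g z (f1 w) + 2 * (al - de) * (g x2 z * g x3 w - g x2 w * g x3 z)).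
Proof.
rewrite !(fgC HF x1 (B _ _)) !frameB_skew 2!(fgC HF _ (B _ x1)) !frameB_x1.
rewrite ?(frame_tableE, flin, frame_linE, frame_gE).
by rewrite (f1_swap w z); ring.
Qed.

End FrameAlgebra.

Section FrameClosed.
Variables (R : realType) (V : lmodType R) (F : frame V) (HF : is_frame F).
Variables (al de : R).
Local Notation g := (fg F). Local Notation B := (frameB al de F).
Let HF' := frame_rot_frame HF.
Let HF'' := frame_rot_frame HF'.

Lemma frameB_x2 z : B z (x2 F) =
  - al *: f2 F z + (al - de) *: (g (x3 F) z *: x1 F - g (x1 F) z *: x3 F).
Proof. by rewrite -frameB_rot (frameB_x1 HF'). Qed.

Lemma frameB_x3 z : B z (x3 F) =
  - al *: f3 F z + (al - de) *: (g (x1 F) z *: x2 F - g (x2 F) z *: x1 F).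
Proof. by rewrite -2!frameB_rot (frameB_x1 HF''). Qed.

Lemma frameB_at_x2 w : B (x2 F) w = (de - al) *: f2 F w
  + al *: (g (x3 F) w *: x1 F - g (x1 F) w *: x3 F).
Proof. by rewrite -frameB_rot (frameB_at_x1 HF'). Qed.

Lemma frameB_at_x3 w : B (x3 F) w = (de - al) *: f3 F w
  + al *: (g (x1 F) w *: x2 F - g (x2 F) w *: x1 F).
Proof. by rewrite -2!frameB_rot (frameB_at_x1 HF''). Qed.

(** The part of the covariant derivative of
    [2 al g(y, f1 z) + 2 (al - de) (x2 /\ x3)(y, z)] that comes from [frameB]. *)
Definition frame_dform x y z : R :=
  2 * al * g y (frameD al de F x z)
  + 2 * (al - de) * (g (B x (x2 F)) y * g (x3 F) z + g (x2 F) y * g (B x (x3 F)) z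
      - (g (B x (x2 F)) z * g (x3 F) y + g (x2 F) z * g (B x (x3 F)) y)).

(** The terms with the connection form in the expansion of [d (d eta_1)] cancel among
    themselves. *)
Lemma frame_closed x y z :
  frame_dform x y z + frame_dform y z x + frame_dform z x y = 0.
Proof.
rewrite /frame_dform !frameB_x2 !frameB_x3 /frameD.
rewrite ?(frame_linE HF).
rewrite ?(fgC HF _ (x1 F)) ?(fgC HF _ (x2 F)) ?(fgC HF _ (x3 F)).
rewrite ?(f1_skew HF) ?(f2_skew HF) ?(f3_skew HF).
rewrite (f2_swap HF y x) (f2_swap HF z x) (f2_swap HF z y).
rewrite (f3_swap HF y x) (f3_swap HF z x) (f3_swap HF z y).
rewrite (fgC HF y x) (fgC HF z y); ring.
Qed.

End FrameClosed.

(** Hitchin's lemma at the level of linear algebra.  [C1], [C2], [C3] stand for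
    the covariant derivatives of the three fundamental forms of an almost
    hyperhermitian structure [I], [J], [I J].  If the three forms are closed,
    the Nijenhuis tensor of [I], written with the exterior derivatives of the
    other two forms, vanishes; closedness of the first form then gives [C1 = 0].
    The vectors range over a type [T] with a negation only, because the lemma is
    applied to vector fields and not to tangent vectors. *)
Lemma hitchin (R : realFieldType) (T : Type) (P : T -> Prop) (I J neg : T -> T)
    (C1 C2 C3 : T -> T -> T -> R) :
  (forall X, P X -> [/\ P (I X), P (J X) & P (neg X)]) ->
  (forall X, [/\ I (I X) = neg X, J (J X) = neg X & I (J X) = neg (J (I X))]) ->
  (forall C, [\/ C = C1, C = C2 | C = C3] -> forall X Y Z, P X -> P Y -> P Z ->
     [/\ C X Y (neg Z) = - C X Y Z, C X Y Z = - C X Z Y &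
         C X Y Z + C Y Z X + C Z X Y = 0]) ->
  (forall X Y Z, P X -> P Y -> P Z -> C1 X Y (I Z) = C1 X (I Y) Z) ->
  (forall X Y Z, P X -> P Y -> P Z ->
     C3 X Y Z = - C2 X Y (I Z) + C1 X (J Y) Z) ->
  forall X Y Z, P X -> P Y -> P Z -> C1 X Y Z = 0.
Proof.
move=> PIJ sq skcy slide prod.
have c1 := skcy C1 (Or31 _ _ erefl); have c2 := skcy C2 (Or32 _ _ erefl).
have c3 := skcy C3 (Or33 _ _ erefl).
have nijenhuis X Y Z : P X -> P Y -> P Z ->
    C1 X (J Z) (I Y) - C1 Y (J Z) (I X) + C1 (I X) (J Z) Y - C1 (I Y) (J Z) X = 0.
  move=> pX pY pZ.
  have [pIX pJX _] := PIJ _ pX; have [pIY _ _] := PIJ _ pY.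
  have [pJIX _ _] := PIJ _ pJX; have [_ pJ'X _] := PIJ _ pIX.
  have [IIX _ IJX] := sq X; have [IIY _ _] := sq Y.
  (* Closedness of the second form at [(X, Y, Z)] and [(I X, I Y, Z)], and of the
     third form at [(I X, Y, Z)] and [(X, I Y, Z)].  The equations [p1] to [p6]
     replace the third form by the other two, and the second one cancels. *)
  have [_ _ e1] := c2 X Y Z pX pY pZ; have [_ _ e2] := c2 _ _ _ pIX pIY pZ.
  have [_ _ e3] := c3 _ _ _ pIX pY pZ; have [_ _ e4] := c3 _ _ _ pX pIY pZ.
  have [_ s1 _] := c3 _ _ _ pX pIY pZ; have [_ s2 _] := c3 _ _ _ pIX pY pZ.
  have p1 := prod _ _ _ pX pZ pIY; have p2 := prod _ _ _ pY pZ pIX.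
  have p3 := prod _ _ _ pIX pZ pY; have p4 := prod _ _ _ pIY pZ pX.
  have p5 := prod _ _ _ pZ pIX pY; have p6 := prod _ _ _ pZ pX pIY.
  rewrite IIY in p1 p6; rewrite IIX in p2.
  have [n1 _ _] := c2 _ _ _ pX pZ pY; have [n2 _ _] := c2 _ _ _ pY pZ pX.
  have [n3 _ _] := c2 _ _ _ pZ pX pY.
  have [_ s3 _] := c2 _ _ _ pX pY pZ; have [_ s4 _] := c2 _ _ _ pIX pIY pZ.
  have l1 := slide _ _ _ pZ pJX pY; rewrite IJX in l1.
  have [_ _ pn] := PIJ _ pJ'X.
  have [_ l2 _] := c1 _ _ _ pZ pn pY; have [l3 _ _] := c1 _ _ _ pZ pY pJ'X.
  have [_ l4 _] := c1 _ _ _ pZ pY pJ'X.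
  lra.
have half X Y W : P X -> P Y -> P W -> C1 W (I X) Y = 0.
  move=> pX pY pW.
  have [pIX _ _] := PIJ _ pX; have [pIY _ _] := PIJ _ pY.
  have [_ pJW pnW] := PIJ _ pW.
  have [_ JJW _] := sq W.
  have := nijenhuis _ _ _ pX pY pJW; rewrite JJW.
  have neg2 A B : P A -> P B -> C1 A (neg W) B = - C1 A W B.
    move=> pA pB; have [n1 s1 _] := c1 _ _ _ pA pB pW.
    have [_ s2 _] := c1 _ _ _ pA pnW pB.
    lra.
  rewrite !neg2// => e1.
  have [_ _ e2] := c1 _ _ _ pY pW pIX; have [_ _ e3] := c1 _ _ _ pIY pW pX.
  have [_ s1 _] := c1 _ _ _ pIX pY pW; have [_ s2 _] := c1 _ _ _ pX pIY pW.
  have l := slide _ _ _ pW pX pY.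
  lra.
move=> X Y Z pX pY pZ; have [pIY _ pnY] := PIJ _ pY; have [IIY _ _] := sq Y.
have := half (I Y) Z X pIY pZ pX; rewrite IIY.
have [_ s1 _] := c1 _ _ _ pX pnY pZ; have [n1 s2 _] := c1 _ _ _ pX pZ pY.
lra.
Qed.


(** * Even permutations of three indices *)

Lemma even_ijk_rot i j k : even_ijk i j k -> even_ijk j k i.
Proof.
case=> s es [-> -> ->].
exists (tperm 0%R 1%R * tperm 0%R 2%:R%R * s)%g.
  by rewrite !odd_permM !odd_tperm /=.
by split; rewrite !permM !permE /=.
Qed.

Lemma even_ijk_exists : exists i j k, even_ijk i j k.
Proof.
exists 0, 1, 2%:R, 1%g; first by rewrite odd_perm1.
by rewrite !perm1.
Qed.

Lemma ord3P (i : 'I_3) : [\/ i = 0, i = 1 | i = 2%:R].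
Proof.
by case: i => [[|[|[|i]]] Hi]; [apply: Or31|apply: Or32|apply: Or33|];
  first [exact/val_inj|done].
Qed.

Lemma even_ijk_uniq i j k j' k' : even_ijk i j k -> even_ijk i j' k' ->
  j = j' /\ k = k'.
Proof.
move=> [s es [-> -> ->]] [t et [ti -> ->]].
have tE x : x != 0 -> t x != s 0 by rewrite ti (inj_eq perm_inj).
pose r := (t * s^-1)%g.
have r0 : r 0 = 0 by rewrite permM -ti permK.
have er : ~~ odd_perm r by rewrite odd_permM odd_permV (negPf es) (negPf et).
have rE x : t x = s (r x) by rewrite permM permKV.
have rN x : x != 0 -> r x != 0 by rewrite -{2}r0 (inj_eq perm_inj).
have neq : (1 : 'I_3) != 0 /\ (2%:R : 'I_3) != 0 /\ (1 : 'I_3) != 2%:R by [].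
have [n1 [n2 n12]] := neq.
have [r1|r1|r1] := ord3P (r 1); first by have := rN 1 n1; rewrite r1 eqxx.
  have [r2|r2|r2] := ord3P (r 2%:R); first by have := rN _ n2; rewrite r2 eqxx.
    by move: n12; rewrite -(inj_eq (@perm_inj _ r)) r1 r2 eqxx.
  by rewrite !rE r1 r2.
have [r2|r2|r2] := ord3P (r 2%:R); first by have := rN _ n2; rewrite r2 eqxx.
  have rtp : r = tperm 1 2%:R.
    apply/permP => x; have [->|->|->] := ord3P x.
    - by rewrite r0 tpermD.
    - by rewrite r1 tpermL.
    - by rewrite r2 tpermR.
  by move: er; rewrite rtp odd_tperm.
by move: n12; rewrite -(inj_eq (@perm_inj _ r)) r1 r2 eqxx.
Qed.

Lemma even_ijk_cases i j k i' j' k' : even_ijk i j k -> even_ijk i' j' k' ->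
  [\/ [/\ i' = i, j' = j & k' = k], [/\ i' = j, j' = k & k' = i] |
      [/\ i' = k, j' = i & k' = j]].
Proof.
move=> e e'; have [s _ [iE jE kE]] := e.
have e1 := even_ijk_rot e; have e2 := even_ijk_rot e1.
have [i'E|i'E|i'E] : [\/ i' = i, i' = j | i' = k].
  rewrite -[i'](permKV s) iE jE kE.
  by have [->|->|->] := ord3P ((s^-1)%g i'); [apply: Or31|apply: Or32|apply: Or33].
- by apply: Or31; rewrite i'E in e'; have [-> ->] := even_ijk_uniq e e'.
- by apply: Or32; rewrite i'E in e'; have [-> ->] := even_ijk_uniq e1 e'.
- by apply: Or33; rewrite i'E in e'; have [-> ->] := even_ijk_uniq e2 e'.
Qed.

(** * The canonical connection *)

Section FrameAt.
Variables (R : realType) (m : nat) (M : manifold R m) (g : metric M).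
Variables (phi : 'I_3 -> endo M) (xi : 'I_3 -> vfield M) (eta : 'I_3 -> form1 M).
Hypothesis h3c : almost_3contact_metric g phi xi eta.

Definition frame_at i j k p : frame 'rV[R]_m :=
  Frame (g p) (phi i p) (phi j p) (phi k p) (xi i p) (xi j p) (xi k p).

(** Compatibility of the metric with [phi_i], at the vector [xi_i] that [phi_i]
    kills. *)
Lemma eta_metric i p x : eta i p x = g p (xi i p) x.
Proof.
have A := a3c_acm h3c i.
have := acm_metric A p x (xi i p).
rewrite (acm_phi_xi A) metric0r (acm_eta_xi A) mulr1 => /esym/eqP.
by rewrite subr_eq0 metricC => /eqP.
Qed.

Lemma phi_skew i p x y : g p x (phi i p y) = - g p (phi i p x) y.
Proof.
have A := a3c_acm h3c i.
have := acm_metric A p x (phi i p y).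
rewrite (acm_phi2 A) (acm_eta_phi A) mulr0 subr0 metricDr metricNr metricZr.
by rewrite [g p _ (xi i p)]metricC -eta_metric (acm_eta_phi A) mulr0 addr0.
Qed.

Lemma frame_at_frame i j k p : even_ijk i j k -> is_frame (frame_at i j k p).
Proof.
move=> e1; have e2 := even_ijk_rot e1; have e3 := even_ijk_rot e2.
have A l := a3c_acm h3c l.
have sq l x : phi l p (phi l p x) = - x + g p (xi l p) x *: xi l p.
  by rewrite (acm_phi2 (A l)) eta_metric.
have pos a b c x : even_ijk a b c ->
    phi a p (phi b p x) = phi c p x + g p (xi b p) x *: xi a p.
  by move=> /(a3c_phi h3c)/(_ p x)[-> _]; rewrite eta_metric subrK.
have neg a b c x : even_ijk a b c ->
    phi b p (phi a p x) = - phi c p x + g p (xi a p) x *: xi b p.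
  move=> /(a3c_phi h3c)/(_ p x)[_ ->].
  by rewrite eta_metric opprD opprK subrK.
have xipos a b c : even_ijk a b c -> phi a p (xi b p) = xi c p.
  by move=> /(a3c_xi h3c)/(_ p)[-> _].
have xineg a b c : even_ijk a b c -> phi b p (xi a p) = - xi c p.
  by move=> /(a3c_xi h3c)/(_ p)[_ ->]; rewrite opprK.
have nrm l : g p (xi l p) (xi l p) = 1 by rewrite -eta_metric (acm_eta_xi (A l)).
have orth a b c : even_ijk a b c -> g p (xi b p) (xi c p) = 0.
  move=> /(a3c_xi h3c)/(_ p)[_ ->].
  by rewrite metricNr -eta_metric (acm_eta_phi (A b)) oppr0.
split=> /= *; rewrite ?(acm_phi_xi (A _))//; auto.
- exact: metricC.
- exact: metricDl.
- exact: metricZl.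
- by apply: (@metric_eq0 _ _ _ g p).
- exact: phi_skew.
- exact: phi_skew.
- exact: phi_skew.
- exact: orth e3.
- exact: orth e1.
- exact: orth e2.
Qed.

End FrameAt.

Section ClosedForm.
Variables (R : realType) (m : nat) (M : manifold R m) (g : metric M).
Variables (nabla : vfield M -> vfield M -> vfield M) (LC : levi_civita g nabla).
Variables (N : set M) (oN : open N).
Local Notation smooth := (smooth_vf_on N).
Implicit Types (p q : M) (X Y Z U : vfield M).

Definition nabla_form2 (w : form2 M) X Y Z p : R :=
  vf_act X (fun q => w q (Y q) (Z q)) p - w p (nabla X Y p) (Z p)
  - w p (Y p) (nabla X Z p).

(** The form [w] is the exterior derivative of the 1-form dual to [U], and the
    cyclic sum is its exterior derivative.  The second derivatives of [U] in the
    sum combine to curvature terms, and these cancel by the Bianchi identity. *)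
Lemma exact_closed (w : form2 M) U : smooth U ->
  (forall Y Z q, smooth Y -> smooth Z -> N q ->
     w q (Y q) (Z q) = g q (nabla Y U q) (Z q) - g q (nabla Z U q) (Y q)) ->
  forall X Y Z p, smooth X -> smooth Y -> smooth Z -> N p ->
  nabla_form2 w X Y Z p + nabla_form2 w Y Z X p + nabla_form2 w Z X Y p = 0.
Proof.
move=> sU wE X Y Z p sX sY sZ Np.
have E A B C : smooth A -> smooth B -> smooth C -> nabla_form2 w A B C p =
    g p (nabla A (nabla B U) p) (C p) - g p (nabla (nabla A B) U p) (C p)
    - (g p (nabla A (nabla C U) p) (B p) - g p (nabla (nabla A C) U p) (B p)).
  move=> sA sB sC; have sAB := nabla_smooth_on LC sA sB.
  have sAC := nabla_smooth_on LC sA sC.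
  have sBU := nabla_smooth_on LC sB sU; have sCU := nabla_smooth_on LC sC sU.
  rewrite /nabla_form2 (wE _ C)// (wE B _)//.
  have -> : vf_act A (fun q => w q (B q) (C q)) p = vf_act A (fun q =>
      g q (nabla B U q) (C q) - g q (nabla C U q) (B q)) p.
    apply/esym/act_eq; first by exists N => // q Nq; rewrite wE.
    by apply: smooth_funB; apply: metric_smooth_on Np.
  rewrite actB; [|exact: metric_smooth_on Np|exact: metric_smooth_on Np].
  rewrite (nabla_metric LC); [|exact: sA|exact: sBU|exact: sC].
  rewrite (nabla_metric LC); [|exact: sA|exact: sCU|exact: sB].
  by ring.
rewrite !E//.
have K A B C : smooth A -> smooth B -> smooth C ->
    g p (nabla A (nabla B U) p) (C p) - g p (nabla (nabla A B) U p) (C p)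
    - (g p (nabla B (nabla A U) p) (C p) - g p (nabla (nabla B A) U p) (C p))
    = - g p (U p) (curvature nabla A B C p).
  move=> sA sB sC; rewrite -(curvature_metric LC oN Np sA sB sU sC) /curvature.
  rewrite !metricBl.
  have -> : nabla (bracket A B) U p = nabla (nabla A B) U p - nabla (nabla B A) U p.
    have sAB := nabla_smooth_on LC sA sB; have sBA := nabla_smooth_on LC sB sA.
    rewrite -(nabla_subl LC); [|exact: sAB|exact: sBA|exact: sU].
    apply/esym/(nabla_eql LC); [|apply: smooth_vfB; auto|exact: sU].
    by exists N => // q Nq; apply: (nabla_torsion LC); [exact: sA|exact: sB].
  by rewrite metricBl; ring.
have b : g p (U p) (curvature nabla X Y Z p) + g p (U p) (curvature nabla Y Z X p)
    + g p (U p) (curvature nabla Z X Y p) = 0.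
  by rewrite -!metricDr (bianchi LC oN Np sX sY sZ) metric0r.
have k1 := K X Y Z sX sY sZ; have k2 := K Y Z X sY sZ sX.
have k3 := K Z X Y sZ sX sY.
move: b k1 k2 k3.
move: (g p (nabla X (nabla Y U) p) (Z p)) (g p (nabla (nabla X Y) U p) (Z p)).
move: (g p (nabla Y (nabla X U) p) (Z p)) (g p (nabla (nabla Y X) U p) (Z p)).
move: (g p (nabla Y (nabla Z U) p) (X p)) (g p (nabla (nabla Y Z) U p) (X p)).
move: (g p (nabla Z (nabla Y U) p) (X p)) (g p (nabla (nabla Z Y) U p) (X p)).
move: (g p (nabla Z (nabla X U) p) (Y p)) (g p (nabla (nabla Z X) U p) (Y p)).
move: (g p (nabla X (nabla Z U) p) (Y p)) (g p (nabla (nabla X Z) U p) (Y p)).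
move: (g p (U p) _) (g p (U p) _) (g p (U p) _) => *; lra.
Qed.

End ClosedForm.

Section AdaptedConnection.
Variables (R : realType) (m : nat) (M : manifold R m) (g : metric M).
Variables (phi : 'I_3 -> endo M) (xi : 'I_3 -> vfield M) (eta : 'I_3 -> form1 M).
Variables (alpha delta : R) (alpha0 : alpha != 0).
Variables (h3c : almost_3contact_metric g phi xi eta)
  (hsasaki : sasaki3_alpha_delta g phi eta alpha delta).
Variables (nabla : vfield M -> vfield M -> vfield M) (LC : levi_civita g nabla).
Variables (N : set M) (oN : open N).
Local Notation smooth := (smooth_vf_on N).
Implicit Types (p q : M) (X Y Z W : vfield M) (f h : M -> R).
Implicit Types (i j k l : 'I_3).

Definition smooth_fun_on f := forall q, N q -> smooth_fun q f.

Lemma smoothD X Y : smooth X -> smooth Y -> smooth (fun q => X q + Y q).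
Proof. by move=> sX sY q Nq; apply: smooth_vfD; auto. Qed.
Lemma smoothB X Y : smooth X -> smooth Y -> smooth (fun q => X q - Y q).
Proof. by move=> sX sY q Nq; apply: smooth_vfB; auto. Qed.
Lemma smoothN X : smooth X -> smooth (fun q => - X q).
Proof. by move=> sX q Nq; apply: smooth_vfN; auto. Qed.
Lemma smoothZ f X : smooth_fun_on f -> smooth X -> smooth (fun q => f q *: X q).
Proof. by move=> sf sX q Nq; apply: smooth_vfZ; auto. Qed.
Lemma smooth_onM f h : smooth_fun_on f -> smooth_fun_on h ->
  smooth_fun_on (fun q => f q * h q).
Proof. by move=> sf sh q Nq; apply: smooth_funM; auto. Qed.
Lemma smooth_onN f : smooth_fun_on f -> smooth_fun_on (fun q => - f q).
Proof. by move=> sf q Nq; apply: smooth_funN; auto. Qed.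
Lemma smooth_on_cst (c : R) : smooth_fun_on (fun=> c).
Proof. by move=> q Nq; exact: smooth_cst. Qed.
Lemma smooth0 : smooth (fun=> 0).
Proof.
move=> q Nq; exists setT; first by split; [exact: openT|].
move=> n; apply: Ck_on_ext (Ck_on_cst n 0 openT); first exact: openT.
by move=> u _; rewrite /local_vf /tangent_coord linear0.
Qed.
Lemma smooth_g X Y : smooth X -> smooth Y ->
  smooth_fun_on (fun q => g q (X q) (Y q)).
Proof. by move=> sX sY q Nq; exact: metric_smooth_on Nq. Qed.
Lemma smooth_phi l X : smooth X -> smooth (fun q => phi l q (X q)).
Proof. by move=> sX q Nq; apply: (acm_phi_smooth (a3c_acm h3c l)); auto. Qed.
Lemma smooth_xi l : smooth (xi l).
Proof. by move=> q Nq; exact: (acm_xi_smooth (a3c_acm h3c l)). Qed.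

(** The canonical connection of a 3-(alpha, delta)-Sasaki manifold. *)
Definition adapted i j k X Y : vfield M := fun q =>
  nabla X Y q - frameB alpha delta (frame_at g phi xi i j k q) (X q) (Y q).

Lemma adaptedE i j k X Y q : nabla X Y q = adapted i j k X Y q
  + frameB alpha delta (frame_at g phi xi i j k q) (X q) (Y q).
Proof. by rewrite /adapted subrK. Qed.

Lemma adapted_rot i j k : adapted j k i = adapted i j k.
Proof.
apply/funext => X; apply/funext => Y; apply/funext => q.
by rewrite /adapted -(frameB_rot (frame_at g phi xi i j k q) alpha delta).
Qed.

Lemma smooth_frameB i j k X Y : smooth X -> smooth Y -> smooth (fun q =>
  frameB alpha delta (frame_at g phi xi i j k q) (X q) (Y q)).
Proof.
move=> sX sY; rewrite /frameB /frameT /=.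
by do ?[exact: sX | exact: sY | exact: smooth_xi | exact: smooth_on_cst
  | apply: smoothD | apply: smoothN | apply: smoothZ
  | apply: smooth_g | apply: smooth_phi].
Qed.

Section Triple.
Variables (i j k : 'I_3) (e : even_ijk i j k).
Local Notation F := (frame_at g phi xi i j k).
Local Notation B q := (frameB alpha delta (F q)).
Local Notation D := (adapted i j k).
Let HF q : is_frame (F q) := frame_at_frame h3c q e.

Lemma smooth_adapted X Y : smooth X -> smooth Y -> smooth (D X Y).
Proof.
move=> sX sY; apply: smoothB; first exact: (nabla_smooth_on LC).
exact: smooth_frameB.
Qed.

Lemma adaptedDr X Y Z p : smooth X -> smooth Y -> smooth Z -> N p ->
  D X (fun q => Y q + Z q) p = D X Y p + D X Z p.
Proof.
move=> sX sY sZ Np.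
rewrite /adapted (nabla_addr LC); [|exact: sX|exact: sY|exact: sZ].
by rewrite (frameBDr (HF p)) opprD addrACA.
Qed.

Lemma adapted_leibniz f X Y p : smooth_fun_on f -> smooth X -> smooth Y -> N p ->
  D X (fun q => f q *: Y q) p = vf_act X f p *: Y p + f p *: D X Y p.
Proof.
move=> sf sX sY Np.
rewrite /adapted (nabla_leibniz LC); [|exact: sf|exact: sX|exact: sY].
by rewrite (frameBZr (HF p)) scalerBr addrA.
Qed.

Lemma adaptedNr X Y p : smooth X -> smooth Y -> N p ->
  D X (fun q => - Y q) p = - D X Y p.
Proof.
move=> sX sY Np; have -> : (fun q => - Y q) = (fun q => -1 *: Y q).
  by apply/funext => q; rewrite scaleN1r.
rewrite adapted_leibniz//; last exact: smooth_on_cst.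
by rewrite act_cst scale0r add0r scaleN1r.
Qed.

Lemma adapted_metric X Y Z p : smooth X -> smooth Y -> smooth Z -> N p ->
  vf_act X (fun q => g q (Y q) (Z q)) p
  = g p (D X Y p) (Z p) + g p (Y p) (D X Z p).
Proof.
move=> sX sY sZ Np.
rewrite (nabla_metric LC); [|exact: sX|exact: sY|exact: sZ].
rewrite /adapted metricBl metricBr.
have := frameB_skew (HF p) alpha delta (X p) (Y p) (Z p).
by rewrite /= => ->; ring.
Qed.

Lemma adapted_eqr X Y Y' p : (forall q, N q -> Y q = Y' q) -> smooth X ->
  smooth Y -> N p -> D X Y p = D X Y' p.
Proof.
move=> E sX sY Np; rewrite /adapted E//; congr (_ - _).
by apply: (nabla_eqr LC); [exists N|exact: sX|exact: sY].
Qed.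

(** For a torsion-free metric connection, [d eta_i] is the alternation of the
    covariant derivative of [xi_i]. *)
Lemma deta_nabla Y Z q : smooth Y -> smooth Z -> N q ->
  2 * alpha * g q (Y q) (phi i q (Z q)) + 2 * (alpha - delta) *
    (g q (xi j q) (Y q) * g q (xi k q) (Z q)
     - g q (xi j q) (Z q) * g q (xi k q) (Y q))
  = g q (nabla Y (xi i) q) (Z q) - g q (nabla Z (xi i) q) (Y q).
Proof.
move=> sY sZ Nq; have sX := smooth_xi i.
have := hsasaki e (sY q Nq) (sZ q Nq).
rewrite /fundamental_form /wedge11 !(eta_metric h3c) => <-.
rewrite /ext_d (eta_metric h3c) -(nabla_torsion LC); [|exact: sY|exact: sZ].
have act_eta V W : vf_act V (fun q => eta i q (W q)) q =
    vf_act V (fun q => g q (xi i q) (W q)) q.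
  congr (vf_act _ _ _); apply/funext => x; exact: (eta_metric h3c).
rewrite !act_eta (nabla_metric LC); [|exact: sY|exact: sX|exact: sZ].
rewrite (nabla_metric LC); [|exact: sZ|exact: sX|exact: sY].
by rewrite metricBr; ring.
Qed.

(** The exterior derivative of [eta i] only sees the alternation of the covariant
    derivative, and the connection form was chosen to account for it. *)
Lemma adapted_xi_sym Y Z q : smooth Y -> smooth Z -> N q ->
  g q (D Y (xi i) q) (Z q) = g q (D Z (xi i) q) (Y q).
Proof.
move=> sY sZ Nq; have := deta_nabla sY sZ Nq.
have := frameB_torsion1 (HF q) alpha delta (Y q) (Z q).
rewrite !(fgC (HF q) (x1 _)) !(frameB_skew (HF q)).
rewrite !(fgC (HF q) _ (frameB _ _ _ _ _)) /= /adapted !metricBl.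
lra.
Qed.

End Triple.

(** Closedness of [d eta_i], expanded with [nabla = adapted + frameB]: the terms
    with [frameB] cancel by [frame_closed], those with derivatives of [xi_j] and
    [xi_k] by [adapted_xi_sym]. *)
Lemma adapted_phi_closed i j k (e : even_ijk i j k) X Y Z p : smooth X ->
  smooth Y -> smooth Z -> N p ->
  let S U V := adapted i j k U (fun q => phi i q (V q)) p
               - phi i p (adapted i j k U V p) in
  g p (Y p) (S X Z) + g p (Z p) (S Y X) + g p (X p) (S Z Y) = 0.
Proof.
move=> sX sY sZ Np S; have e' := even_ijk_rot e; have e'' := even_ijk_rot e'.
have HF := frame_at_frame h3c p e.
pose w : form2 M := fun q y z => 2 * alpha * g q y (phi i q z) +
  2 * (alpha - delta) * (g q (xi j q) y * g q (xi k q) z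
                         - g q (xi j q) z * g q (xi k q) y).
have := exact_closed LC oN (w := w) (smooth_xi i)
  (fun Y Z q sY sZ Nq => deta_nabla e sY sZ Nq) sX sY sZ Np.
pose s U l := adapted i j k U (xi l) p.
have E A B C : smooth A -> smooth B -> smooth C -> nabla_form2 nabla w A B C p =
   2 * alpha * g p (B p) (S A C) + 2 * (alpha - delta) *
    (g p (s A j) (B p) * g p (xi k p) (C p) + g p (xi j p) (B p) * g p (s A k) (C p)
     - (g p (s A j) (C p) * g p (xi k p) (B p)
        + g p (xi j p) (C p) * g p (s A k) (B p)))
   + frame_dform (frame_at g phi xi i j k p) alpha delta (A p) (B p) (C p).
  move=> sA sB sC.
  have sfC := smooth_phi i sC; have sj := smooth_xi j; have sk := smooth_xi k.
  rewrite /nabla_form2 /w.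
  have g1 := smooth_g sB sfC Np.
  have g2 := smooth_g sj sB Np; have g3 := smooth_g sk sC Np.
  have g4 := smooth_g sj sC Np; have g5 := smooth_g sk sB Np.
  have g23 := smooth_funM g2 g3; have g45 := smooth_funM g4 g5.
  rewrite actD; [|by apply: smooth_funM => //; exact: smooth_cst
    |by apply: smooth_funM; [exact: smooth_cst|exact: smooth_funB]].
  rewrite act_scale// act_scale; last exact: smooth_funB.
  rewrite actB// !actM// !(nabla_metric LC); auto.
  have nE U V : nabla U V p = adapted i j k U V p +
      frameB alpha delta (frame_at g phi xi i j k p) (U p) (V p).
    by rewrite /adapted subrK.
  rewrite /frame_dform -(frameB_comm HF) /S /s /= !nE.
  move: (frameB _ _ _ (A p)) (adapted i j k A (fun q => phi i q (C q)) p) => b u1.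
  move: (adapted i j k A B p) (adapted i j k A C p) => u2 u3.
  move: (adapted i j k A (xi j) p) (adapted i j k A (xi k) p) => u4 u5.
  rewrite (linearD (phi i p)) !metricDl !metricDr !metricNr.
  by ring.
rewrite !E//.
have := frame_closed HF alpha delta (X p) (Y p) (Z p).
have symj A B : smooth A -> smooth B -> g p (s A j) (B p) = g p (s B j) (A p).
  by move=> sA sB; rewrite /s -(adapted_rot i j k); exact: adapted_xi_sym.
have symk A B : smooth A -> smooth B -> g p (s A k) (B p) = g p (s B k) (A p).
  move=> sA sB; rewrite /s -(adapted_rot i j k) -(adapted_rot j k i).
  exact: adapted_xi_sym.
clear E; clearbody S s.
move: (symj Y X sY sX) (symj Z X sZ sX) (symj Z Y sZ sY).
move: (symk Y X sY sX) (symk Z X sZ sX) (symk Z Y sZ sY).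
move: (frame_dform _ _ _ _ _ _) (frame_dform _ _ _ _ _ _) (frame_dform _ _ _ _ _ _).
move: (g p (Y p) (S X Z)) (g p (Z p) (S Y X)) (g p (X p) (S Z Y)).
move: (g p (s X j) (Y p)) (g p (s Y j) (X p)) (g p (s X j) (Z p)).
move: (g p (s Z j) (X p)) (g p (s Y j) (Z p)) (g p (s Z j) (Y p)).
move: (g p (s X k) (Y p)) (g p (s Y k) (X p)) (g p (s X k) (Z p)).
move: (g p (s Z k) (X p)) (g p (s Y k) (Z p)) (g p (s Z k) (Y p)).
move: (g p (xi j p) (X p)) (g p (xi j p) (Y p)) (g p (xi j p) (Z p)).
move: (g p (xi k p) (X p)) (g p (xi k p) (Y p)) (g p (xi k p) (Z p)).
move=> kX kY kZ jX jY jZ a1 a2 a3 a4 a5 a6 b1 b2 b3 b4 b5 b6 s1 s2 s3 d1 d2 d3.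
move=> -> -> -> -> -> -> h0 h1.
have a0 : 2 * alpha != 0 by rewrite mulf_neq0// pnatr_eq0.
apply: (mulfI a0); rewrite mulr0 -[RHS]h1 -[LHS](addr0) -[in LHS]h0.
by ring.
Qed.

(** The algebra of a 3-contact structure is that of an almost hyperhermitian
    structure on the sum of the tangent bundle with a trivial line, as on the cone
    over a 3-Sasaki manifold.  Sections of this sum are pairs of a vector field and
    a function. *)
Definition hat : Type := vfield M * (M -> R).
Implicit Types (Xh Yh Zh : hat) (u v w : 'rV[R]_m * R).

Definition hat_smooth Xh := smooth Xh.1 /\ smooth_fun_on Xh.2.
Definition hat_neg Xh : hat := (fun q => - Xh.1 q, fun q => - Xh.2 q).
Definition hat_phi l Xh : hat :=
  (fun q => phi l q (Xh.1 q) - Xh.2 q *: xi l q, fun q => g q (xi l q) (Xh.1 q)).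
Definition hat_at p Xh : 'rV[R]_m * R := (Xh.1 p, Xh.2 p).
Definition hat_phi_at p l u : 'rV[R]_m * R :=
  (phi l p u.1 - u.2 *: xi l p, g p (xi l p) u.1).
Definition hat_g p u v : R := g p u.1 v.1 + u.2 * v.2.
Definition hat_D i j k p Xh Yh : 'rV[R]_m * R :=
  (adapted i j k Xh.1 Yh.1 p, vf_act Xh.1 Yh.2 p).

(** Up to the choice of slots, the covariant derivative in the direction of the
    field part of [Xh] of the fundamental form of [hat_phi l]. *)
Definition hat_C i j k p l Xh Yh Zh : R :=
  hat_g p (hat_at p Yh)
    (hat_D i j k p Xh (hat_phi l Zh) - hat_phi_at p l (hat_D i j k p Xh Zh)).

Lemma hat_gBr p u v w : hat_g p u (v - w) = hat_g p u v - hat_g p u w.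
Proof. by rewrite /hat_g /= metricBr mulrBr; ring. Qed.

Lemma hat_gNr p u v : hat_g p u (- v) = - hat_g p u v.
Proof. by rewrite /hat_g /= metricNr mulrN opprD. Qed.

Lemma hat_gC p u v : hat_g p u v = hat_g p v u.
Proof. by rewrite /hat_g metricC mulrC. Qed.

Lemma hat_gNl p u v : hat_g p (- u) v = - hat_g p u v.
Proof. by rewrite hat_gC hat_gNr hat_gC. Qed.

Lemma hat_phi_skew p l u v :
  hat_g p u (hat_phi_at p l v) = - hat_g p (hat_phi_at p l u) v.
Proof.
rewrite /hat_g /= metricBr metricBl (phi_skew h3c) metricZl metricZr.
by rewrite (metricC g p u.1); ring.
Qed.

Lemma hat_skew_alg p l y z DY DZ DJY DJZ :
  - (hat_g p DZ (hat_phi_at p l y) + hat_g p z DJY)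
    = hat_g p DY (hat_phi_at p l z) + hat_g p y DJZ ->
  hat_g p y (DJZ - hat_phi_at p l DZ) = - hat_g p z (DJY - hat_phi_at p l DY).
Proof.
rewrite !hat_gBr (hat_phi_skew p l DZ) (hat_phi_skew p l DY).
rewrite (hat_gC p y (hat_phi_at p l DZ)) (hat_gC p z (hat_phi_at p l DY)).
move=> h; lra.
Qed.

Lemma hat_phiE p l Xh : hat_at p (hat_phi l Xh) = hat_phi_at p l (hat_at p Xh).
Proof. by []. Qed.

Lemma hat_phi_smooth l Xh : hat_smooth Xh -> hat_smooth (hat_phi l Xh).
Proof.
move=> [sX sf]; split; last by apply: smooth_g => //; exact: smooth_xi.
apply: smoothB; first exact: smooth_phi.
by apply: smoothZ => //; exact: smooth_xi.
Qed.

Lemma hat_neg_smooth Xh : hat_smooth Xh -> hat_smooth (hat_neg Xh).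
Proof. by move=> [sX sf]; split; [exact: smoothN|exact: smooth_onN]. Qed.

Lemma hat_ext Xh Yh : (forall p, hat_at p Xh = hat_at p Yh) -> Xh = Yh.
Proof.
case: Xh Yh => [X f] [Y h] E; congr pair; apply/funext => p.
  by have := congr1 fst (E p).
by have := congr1 snd (E p).
Qed.

Lemma hat_phi_neg l Xh : hat_phi l (hat_neg Xh) = hat_neg (hat_phi l Xh).
Proof.
apply: hat_ext => p; congr pair => /=.
  by rewrite linearN scaleNr opprB opprK addrC.
by rewrite metricNr.
Qed.

Lemma hat_phi_sq i j k (e : even_ijk i j k) p u :
  hat_phi_at p i (hat_phi_at p i u) = - u.
Proof.
case: u => x t.
by have [h1 h2] := frame_hat_sq (frame_at_frame h3c p e) x t; congr pair.
Qed.

Section HatTriple.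
Variables (i j k : 'I_3) (e : even_ijk i j k).
Let HF p := frame_at_frame h3c p e.

Lemma hat_phi_atN p l u : hat_phi_at p l (- u) = - hat_phi_at p l u.
Proof.
congr pair; rewrite /= ?metricNr// linearN scaleNr.
by rewrite -opprD.
Qed.

Lemma hat_phi_mul p u : hat_phi_at p k u = hat_phi_at p i (hat_phi_at p j u).
Proof.
by case: u => x t; have [h1 h2] := frame_hat_mul (HF p) x t; congr pair.
Qed.

Lemma hat_phi_mulC p u : hat_phi_at p k u = - hat_phi_at p j (hat_phi_at p i u).
Proof.
by case: u => x t; have [h1 h2] := frame_hat_mulC (HF p) x t; congr pair.
Qed.

Lemma hat_phi_sqE Xh : hat_phi i (hat_phi i Xh) = hat_neg Xh.
Proof. by apply: hat_ext => p; rewrite !hat_phiE (hat_phi_sq e). Qed.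

Section AtPoint.
Variables (p : M) (Np : N p).
Local Notation D := (hat_D i j k p).

Lemma hat_D_neg Xh Yh : hat_smooth Xh -> hat_smooth Yh ->
  D Xh (hat_neg Yh) = - D Xh Yh.
Proof.
move=> [sX _] [sY sf]; congr pair; first exact: (adaptedNr e).
by apply: actN; exact: sf.
Qed.

Lemma hat_metric Xh Yh Zh : hat_smooth Xh -> hat_smooth Yh -> hat_smooth Zh ->
  vf_act Xh.1 (fun q => hat_g q (hat_at q Yh) (hat_at q Zh)) p
  = hat_g p (D Xh Yh) (hat_at p Zh) + hat_g p (hat_at p Yh) (D Xh Zh).
Proof.
move=> [sX _] [sY sf] [sZ sh]; rewrite /hat_g /hat_at /hat_D /=.
rewrite actD; [|exact: smooth_g|exact: smooth_onM].
rewrite (adapted_metric e)// actM; [|exact: sf|exact: sh].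
by rewrite [RHS]addrACA (mulrC (vf_act Xh.1 Yh.2 p)) (addrC (Zh.2 p * _)).
Qed.

Lemma hat_C_neg l Xh Yh Zh : hat_smooth Xh -> hat_smooth Yh -> hat_smooth Zh ->
  hat_C i j k p l Xh Yh (hat_neg Zh) = - hat_C i j k p l Xh Yh Zh.
Proof.
move=> sX sY sZ; have sJZ := hat_phi_smooth l sZ.
rewrite /hat_C hat_phi_neg (hat_D_neg sX sZ) (hat_D_neg sX sJZ) hat_phi_atN.
move: (hat_at p Yh) (D Xh _) (hat_phi_at p l _) => y u v.
by rewrite -hat_gNr opprB opprK addrC.
Qed.

Lemma hat_C_skew l Xh Yh Zh : hat_smooth Xh -> hat_smooth Yh -> hat_smooth Zh ->
  hat_C i j k p l Xh Yh Zh = - hat_C i j k p l Xh Zh Yh.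
Proof.
move=> sX sY sZ; have sJZ := hat_phi_smooth l sZ; have sJY := hat_phi_smooth l sY.
have h1 := hat_metric sX sY sJZ; have h2 := hat_metric sX sZ sJY.
have E : (fun q => hat_g q (hat_at q Yh) (hat_at q (hat_phi l Zh))) =
         (fun q => - hat_g q (hat_at q Zh) (hat_at q (hat_phi l Yh))).
  by apply/funext => q; rewrite !hat_phiE hat_phi_skew hat_gC.
move: h1; rewrite E actN; last first.
  have [sZ1 sZ2] := sZ; have [sJ1 sJ2] := sJY.
  by apply: smooth_funD; [exact: smooth_g|apply: smooth_funM; auto].
rewrite h2 => h.
exact: (hat_skew_alg (l := l) (y := hat_at p Yh) (z := hat_at p Zh)) h.
Qed.

Lemma hat_C_slide Xh Yh Zh : hat_smooth Xh -> hat_smooth Yh -> hat_smooth Zh ->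
  hat_C i j k p i Xh Yh (hat_phi i Zh) = hat_C i j k p i Xh (hat_phi i Yh) Zh.
Proof.
move=> sX sY sZ; rewrite /hat_C hat_phi_sqE (hat_phiE p i Yh) (hat_D_neg sX sZ).
move: (hat_at p Yh) (D Xh (hat_phi i Zh)) (D Xh Zh) => y u v.
rewrite !hat_gBr hat_gNr !hat_phi_skew (hat_phi_sq e).
by rewrite hat_gNl; ring.
Qed.

Lemma hat_C_mul Xh Yh Zh : hat_smooth Xh -> hat_smooth Yh -> hat_smooth Zh ->
  hat_C i j k p k Xh Yh Zh
  = - hat_C i j k p j Xh Yh (hat_phi i Zh) + hat_C i j k p i Xh (hat_phi j Yh) Zh.
Proof.
move=> sX sY sZ; have sIZ := hat_phi_smooth i sZ; have sJIZ := hat_phi_smooth j sIZ.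
have E : hat_phi k Zh = hat_neg (hat_phi j (hat_phi i Zh)).
  by apply: hat_ext => q; rewrite !hat_phiE hat_phi_mulC.
rewrite /hat_C E (hat_D_neg sX sJIZ) hat_phi_mulC (hat_phiE p j Yh).
move: (hat_at p Yh) (D Xh (hat_phi j _)) (D Xh (hat_phi i Zh)) (D Xh Zh).
move=> y u v w.
rewrite !hat_gBr !hat_gNr (hat_phi_skew p j y v).
by rewrite (hat_phi_skew p j y (hat_phi_at p i w)); ring.
Qed.

(** The closedness of the fundamental form of [hat_phi l] splits into the symmetry
    of the derivative of [xi_l] and the closedness of the form of [phi_l]. *)
Lemma hat_CE l Xh Yh Zh : hat_smooth Xh -> hat_smooth Yh -> hat_smooth Zh ->
  let s U := adapted i j k U (xi l) p in
  let S U V := adapted i j k U (fun q => phi l q (V q)) p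
               - phi l p (adapted i j k U V p) in
  hat_C i j k p l Xh Yh Zh
  = g p (Yh.1 p) (S Xh.1 Zh.1) - Zh.2 p * g p (s Xh.1) (Yh.1 p)
    + Yh.2 p * g p (s Xh.1) (Zh.1 p).
Proof.
case: Xh Yh Zh => [X a] [Y t] [Z u] [sX sa] [sY st] [sZ su] s S.
rewrite /= in sX sa sY st sZ su.
have sx := smooth_xi l; have sf := smooth_phi l sZ.
rewrite /hat_C /hat_g /hat_at /hat_D /hat_phi_at /=.
have -> : adapted i j k X (fun q => phi l q (Z q) - u q *: xi l q) p =
    adapted i j k X (fun q => phi l q (Z q)) p
    - (vf_act X u p *: xi l p + u p *: s X).
  rewrite (adaptedDr e)//; last exact/smoothN/smoothZ.
  by rewrite (adaptedNr e)//; [rewrite (adapted_leibniz e)|exact: smoothZ].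
rewrite (adapted_metric e)// -/(s X) addrK (metricC g p (s X) (Y p)) /S.
move: (adapted i j k X _ p) (phi l p (adapted i j k X Z p)) (s X) => b c d.
by rewrite !metricBr metricDr !metricZr; ring.
Qed.

End AtPoint.

(** By [hitchin] the covariant derivative of the structure on the sum with a line
    vanishes; its two components are the derivatives of [phi_i] and of [xi_i]. *)
Lemma adapted_parallel X Z p : smooth X -> smooth Z -> N p ->
  adapted i j k X (fun q => phi i q (Z q)) p = phi i p (adapted i j k X Z p) /\
  adapted i j k X (xi i) p = 0.
Proof.
move=> sX sZ Np; have e' := even_ijk_rot e; have e'' := even_ijk_rot e'.
have closed l Xh Yh Zh : l = i \/ l = j \/ l = k ->
    hat_smooth Xh -> hat_smooth Yh -> hat_smooth Zh ->
    hat_C i j k p l Xh Yh Zh + hat_C i j k p l Yh Zh Xh + hat_C i j k p l Zh Xh Yh = 0.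
  move=> lE sXh sYh sZh; rewrite !hat_CE//.
  have [[sX1 _] [sY1 _] [sZ1 _]] := And3 sXh sYh sZh.
  have [sym cl] : (forall U V, smooth U -> smooth V ->
      g p (adapted i j k U (xi l) p) (V p) = g p (adapted i j k V (xi l) p) (U p)) /\
    let S U V := adapted i j k U (fun q => phi l q (V q)) p
               - phi l p (adapted i j k U V p) in
    g p (Yh.1 p) (S Xh.1 Zh.1) + g p (Zh.1 p) (S Yh.1 Xh.1)
     + g p (Xh.1 p) (S Zh.1 Yh.1) = 0.
    case: lE => [->|[]->].
    - by split=> [U V sU sV|]; [exact: adapted_xi_sym|exact: adapted_phi_closed].
    - rewrite -(adapted_rot i j k).
      by split=> [U V sU sV|]; [exact: adapted_xi_sym|exact: adapted_phi_closed].
    - rewrite -(adapted_rot i j k) -(adapted_rot j k i).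
      by split=> [U V sU sV|]; [exact: adapted_xi_sym|exact: adapted_phi_closed].
  move: cl (sym _ _ sX1 sY1) (sym _ _ sX1 sZ1) (sym _ _ sY1 sZ1) => /=.
  move: (g p (Yh.1 p) _) (g p (Zh.1 p) _) (g p (Xh.1 p) _) => a1 a2 a3.
  move: (adapted i j k Xh.1 (xi l) p) (adapted i j k Yh.1 (xi l) p) => x y.
  move: (adapted i j k Zh.1 (xi l) p) => z c E1 E2 E3.
  by rewrite E1 E2 E3 -[RHS]c; ring.
have sq : forall Xh, [/\ hat_phi i (hat_phi i Xh) = hat_neg Xh,
    hat_phi j (hat_phi j Xh) = hat_neg Xh &
    hat_phi i (hat_phi j Xh) = hat_neg (hat_phi j (hat_phi i Xh))].
  move=> Xh; split; first exact: hat_phi_sqE.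
    by apply: hat_ext => q; rewrite !hat_phiE (hat_phi_sq e').
  by apply: hat_ext => q; rewrite !hat_phiE -hat_phi_mul hat_phi_mulC.
have sP Xh : hat_smooth Xh ->
    [/\ hat_smooth (hat_phi i Xh), hat_smooth (hat_phi j Xh) & hat_smooth (hat_neg Xh)].
  move=> sXh; split; [exact: hat_phi_smooth|exact: hat_phi_smooth|].
  exact: hat_neg_smooth.
have C0 := hitchin (C1 := hat_C i j k p i) (C2 := hat_C i j k p j)
  (C3 := hat_C i j k p k) sP sq.
have {}C0 Xh Yh Zh : hat_smooth Xh -> hat_smooth Yh -> hat_smooth Zh ->
    hat_C i j k p i Xh Yh Zh = 0.
  apply: C0; [|exact: hat_C_slide|exact: hat_C_mul].
  move=> C CE A1 A2 A3 s1 s2 s3.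
  have [l lE ->] : exists2 l, l = i \/ l = j \/ l = k & C = hat_C i j k p l.
    by case: CE => ->; [exists i|exists j|exists k]; auto.
  by split; [exact: hat_C_neg|exact: hat_C_skew|exact: closed].
have s0 : smooth_fun_on (fun=> 0) by exact: smooth_on_cst.
have s1 : smooth_fun_on (fun=> 1) by exact: smooth_on_cst.
have sZ' := smooth_phi i sZ; have sxi := smooth_xi i.
have sD := smooth_adapted i j k sX sZ; have sD' := smooth_adapted i j k sX sZ'.
have sS := smoothB sD' (smooth_phi i sD); have sx := smooth_adapted i j k sX sxi.
split.
  have := C0 (X, fun=> 0) (_, fun=> 0) (Z, fun=> 0)
    (conj sX s0) (conj sS s0) (conj sZ s0).
  rewrite hat_CE// /= !mul0r subr0 addr0 => /metric_eq0/eqP.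
  by rewrite subr_eq0 => /eqP.
have := C0 (X, fun=> 0) ((fun=> 0) : vfield M, fun=> 1) (_, fun=> 0)
  (conj sX s0) (conj (smooth0) s1) (conj sx s0).
rewrite hat_CE//; last by split; [exact: smooth0|].
by move=> /=; rewrite metric0l metric0r mulr0 subr0 add0r mul1r => /metric_eq0.
Qed.

End HatTriple.

Local Opaque adapted.

Section ParallelMaps.
Variables (i j k : 'I_3) (e : even_ijk i j k).
Local Notation D := (adapted i j k).
Implicit Types (c d : M -> 'rV[R]_m -> 'rV[R]_m).
Implicit Types (b : M -> 'rV[R]_m -> 'rV[R]_m -> 'rV[R]_m).

(** Parallel bundle maps with one argument, and below with two.  The connection form
    [frameB] is built from [phi], [xi] and the metric, so that it is obtained from
    parallel maps by operations preserving parallelism. *)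
Definition parallel1 c := forall X Z p, smooth X -> smooth Z -> N p ->
  smooth (fun q => c q (Z q)) /\ D X (fun q => c q (Z q)) p = c p (D X Z p).

Definition parallel2 b := forall X Y Z p, smooth X -> smooth Y -> smooth Z ->
  N p -> smooth (fun q => b q (Y q) (Z q)) /\
  D X (fun q => b q (Y q) (Z q)) p = b p (D X Y p) (Z p) + b p (Y p) (D X Z p).

Lemma parallel1D c d : parallel1 c -> parallel1 d ->
  parallel1 (fun q z => c q z + d q z).
Proof.
move=> pc pd X Z p sX sZ Np; have [sc Dc] := pc X Z p sX sZ Np.
have [sd Dd] := pd X Z p sX sZ Np; split; first exact: smoothD.
by rewrite (adaptedDr e sX sc sd Np) Dc Dd.
Qed.

Lemma parallel1N c : parallel1 c -> parallel1 (fun q z => - c q z).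
Proof.
move=> pc X Z p sX sZ Np; have [sc Dc] := pc X Z p sX sZ Np.
by split; [exact: smoothN|rewrite (adaptedNr e sX sc Np) Dc].
Qed.

Lemma parallel1Z (a : R) c : parallel1 c -> parallel1 (fun q z => a *: c q z).
Proof.
move=> pc X Z p sX sZ Np; have [sc Dc] := pc X Z p sX sZ Np.
split; first by apply: smoothZ => //; exact: smooth_on_cst.
rewrite (adapted_leibniz e (smooth_on_cst a) sX sc Np).
by rewrite act_cst scale0r add0r Dc.
Qed.

Lemma parallel2D b b' : parallel2 b -> parallel2 b' ->
  parallel2 (fun q y z => b q y z + b' q y z).
Proof.
move=> pb pb' X Y Z p sX sY sZ Np; have [sb Db] := pb X Y Z p sX sY sZ Np.
have [sb' Db'] := pb' X Y Z p sX sY sZ Np; split; first exact: smoothD.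
by rewrite (adaptedDr e sX sb sb' Np) Db Db' addrACA.
Qed.

Lemma parallel2N b : parallel2 b -> parallel2 (fun q y z => - b q y z).
Proof.
move=> pb X Y Z p sX sY sZ Np; have [sb Db] := pb X Y Z p sX sY sZ Np.
by split; [exact: smoothN|rewrite (adaptedNr e sX sb Np) Db opprD].
Qed.

Lemma parallel2Z (a : R) b : parallel2 b -> parallel2 (fun q y z => a *: b q y z).
Proof.
move=> pb X Y Z p sX sY sZ Np; have [sb Db] := pb X Y Z p sX sY sZ Np.
split; first by apply: smoothZ => //; exact: smooth_on_cst.
rewrite (adapted_leibniz e (smooth_on_cst a) sX sb Np).
by rewrite act_cst scale0r add0r Db scalerDr.
Qed.

Lemma parallel2C b : parallel2 b -> parallel2 (fun q y z => b q z y).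
Proof.
move=> pb X Y Z p sX sY sZ Np; have [sb Db] := pb X Z Y p sX sZ sY Np.
by split=> //; rewrite Db addrC.
Qed.

Definition in_triple l := [\/ l = i, l = j | l = k].

Lemma adapted_phi l X Z p : in_triple l -> smooth X -> smooth Z -> N p ->
  D X (fun q => phi l q (Z q)) p = phi l p (D X Z p).
Proof.
have e' := even_ijk_rot e; have e'' := even_ijk_rot e'.
move=> lE sX sZ Np; case: lE => ->.
- by have [] := adapted_parallel e sX sZ Np.
- by rewrite -(adapted_rot i j k); have [] := adapted_parallel e' sX sZ Np.
- rewrite -(adapted_rot i j k) -(adapted_rot j k i).
  by have [] := adapted_parallel e'' sX sZ Np.
Qed.

Lemma adapted_xi l X p : in_triple l -> smooth X -> N p -> D X (xi l) p = 0.
Proof.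
have e' := even_ijk_rot e; have e'' := even_ijk_rot e'.
move=> lE sX Np; case: lE => ->.
- by have [] := adapted_parallel e sX sX Np.
- by rewrite -(adapted_rot i j k); have [] := adapted_parallel e' sX sX Np.
- rewrite -(adapted_rot i j k) -(adapted_rot j k i).
  by have [] := adapted_parallel e'' sX sX Np.
Qed.

Lemma parallel1_phi l : in_triple l -> parallel1 (phi l).
Proof.
by move=> lE X Z p sX sZ Np; split; [exact: smooth_phi|exact: adapted_phi].
Qed.

Lemma parallel1_xi l l' : in_triple l -> in_triple l' ->
  parallel1 (fun q z => g q (xi l q) z *: xi l' q).
Proof.
move=> lE lE' X Z p sX sZ Np; have sx := smooth_xi l; have sx' := smooth_xi l'.
split; first by apply: smoothZ => //; exact: smooth_g.
rewrite (adapted_leibniz e (smooth_g sx sZ) sX sx' Np).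
rewrite (adapted_metric e sX sx sZ Np) (adapted_xi lE)// (adapted_xi lE')//.
by rewrite metric0l add0r scaler0 addr0.
Qed.

Lemma parallel2_form l c : in_triple l -> parallel1 c ->
  parallel2 (fun q y z => g q (xi l q) y *: c q z).
Proof.
move=> lE pc X Y Z p sX sY sZ Np; have [sc Dc] := pc X Z p sX sZ Np.
have sx := smooth_xi l; split; first by apply: smoothZ => //; exact: smooth_g.
rewrite (adapted_leibniz e (smooth_g sx sY) sX sc Np).
rewrite (adapted_metric e sX sx sY Np) (adapted_xi lE)//.
by rewrite metric0l add0r Dc.
Qed.

Lemma parallel2_Phi l l' : in_triple l -> in_triple l' ->
  parallel2 (fun q y z => g q z (phi l q y) *: xi l' q).
Proof.
move=> lE lE' X Y Z p sX sY sZ Np; have sx' := smooth_xi l'.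
have sf := smooth_phi l sY.
split; first by apply: smoothZ => //; exact: smooth_g.
rewrite (adapted_leibniz e (smooth_g sZ sf) sX sx' Np).
rewrite (adapted_metric e sX sZ sf Np) (adapted_phi lE)// (adapted_xi lE')//.
by rewrite scaler0 addr0 scalerDl addrC.
Qed.

Lemma parallel2_frameB : parallel2 (fun q =>
  frameB alpha delta (frame_at g phi xi i j k q)).
Proof.
have ti : in_triple i by constructor.
have tj : in_triple j by constructor.
have tk : in_triple k by constructor.
have T l1 l2 l3 : in_triple l1 -> in_triple l2 -> in_triple l3 ->
    parallel2 (fun q => frameT alpha delta (frame_at g phi xi l1 l2 l3 q)).
  move=> t1 t2 t3; rewrite /frameT /=.
  apply: parallel2D; first apply: (parallel2_form t1).
    apply: parallel1D; first exact/parallel1Z/parallel1_phi.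
    apply/parallel1N/parallel1Z/parallel1D; first exact: parallel1_xi.
    exact/parallel1N/parallel1_xi.
  apply/parallel2Z/parallel2D; first exact: parallel2_Phi.
  apply/parallel2N/(parallel2C (b := fun q z y => g q (xi l1 q) z *: phi l1 q y)).
  by apply: parallel2_form => //; exact: parallel1_phi.
by rewrite /frameB; apply: parallel2D; [apply: parallel2D|]; exact: T.
Qed.

Definition adapted_curvature X Y Z p :=
  D X (D Y Z) p - D Y (D X Z) p - D (bracket X Y) Z p.

Lemma adapted_curvature_phi l X Y Z p : in_triple l -> smooth X -> smooth Y ->
  smooth Z -> N p -> adapted_curvature X Y (fun q => phi l q (Z q)) p
    = phi l p (adapted_curvature X Y Z p).
Proof.
move=> lE sX sY sZ Np; have sb := bracket_smooth_on LC oN sX sY.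
have sf := smooth_phi l sZ.
have key U V : smooth U -> smooth V ->
    D U (D V (fun q => phi l q (Z q))) p = phi l p (D U (D V Z) p).
  move=> sU sV; have sVZ := smooth_adapted i j k sV sZ.
  have sVf := smooth_adapted i j k sV sf.
  rewrite -(adapted_phi lE sU sVZ Np).
  by apply: adapted_eqr sU sVf Np => q Nq; exact: adapted_phi.
have sub3 (a b c a' b' c' : 'rV[R]_m) : a = a' -> b = b' -> c = c' ->
    a - b - c = a' - b' - c' by move=> -> -> ->.
rewrite [RHS]linearB [X in X - _]linearB; apply: sub3.
- exact: key X Y sX sY.
- exact: key Y X sY sX.
- exact: adapted_phi.
Qed.

Lemma adapted_curvature_xi l X Y p : in_triple l -> smooth X -> smooth Y ->
  N p -> adapted_curvature X Y (xi l) p = 0.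
Proof.
move=> lE sX sY Np; have sb := bracket_smooth_on LC oN sX sY.
have key U V : smooth U -> smooth V -> D U (D V (xi l)) p = 0.
  move=> sU sV; have sVx := smooth_adapted i j k sV (smooth_xi l).
  have D0 q : N q -> D V (xi l) q = 0 by move=> Nq; exact: adapted_xi.
  have -> : D U (D V (xi l)) p = D U (fun=> 0) p by apply: adapted_eqr sU sVx Np.
  have := adaptedNr e sU smooth0 Np.
  rewrite (_ : (fun _ : M => - (0 : 'rV[R]_m)) = (fun=> 0)); last first.
    by apply/funext => q; rewrite oppr0.
  move=> /eqP; rewrite -subr_eq0 opprK -mulr2n -scaler_nat scaler_eq0 pnatr_eq0.
  by move=> /eqP.
have sub3 (a b c : 'rV[R]_m) : a = 0 -> b = 0 -> c = 0 -> a - b - c = 0.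
  by move=> -> -> ->; rewrite !subr0.
apply: sub3; [exact: key X Y sX sY|exact: key Y X sY sX|exact: adapted_xi].
Qed.

(** As [frameB] is parallel, the only derivatives that survive in the expansion of
    [nabla = adapted + frameB] are those of the arguments.  They are absorbed by the
    torsion of the adapted connection, which appears in [bracket X Y]. *)
Lemma curvature_adapted X Y Z p : smooth X -> smooth Y -> smooth Z -> N p ->
  curvature nabla X Y Z p = adapted_curvature X Y Z p
    + frameQ alpha delta (frame_at g phi xi i j k p) (X p) (Y p) (Z p).
Proof.
move=> sX sY sZ Np; have HF := frame_at_frame h3c p e.
set B := frameB alpha delta (frame_at g phi xi i j k p).
have nE := adaptedE i j k.
have key U V : smooth U -> smooth V -> nabla U (nabla V Z) p =
    D U (D V Z) p + (B (D U V p) (Z p) + B (V p) (D U Z p))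
    + (B (U p) (D V Z p) + B (U p) (B (V p) (Z p))).
  move=> sU sV; have [sB DB] := parallel2_frameB sU sV sZ Np.
  have sVZ := smooth_adapted i j k sV sZ.
  rewrite nE nE (frameBDr HF); congr (_ + _).
  rewrite (_ : nabla V Z = fun q => D V Z q +
      frameB alpha delta (frame_at g phi xi i j k q) (V q) (Z q)).
    by rewrite (adaptedDr e sU sVZ sB Np) DB.
  by apply/funext => q; exact: nE.
have tors : bracket X Y p = D X Y p - D Y X p + (B (X p) (Y p) - B (Y p) (X p)).
  rewrite -(nabla_torsion LC); [|exact: sX|exact: sY].
  by rewrite !nE opprD addrACA.
rewrite /curvature (key X Y sX sY) (key Y X sY sX) nE tors.
rewrite /adapted_curvature /frameQ -/B.
have BDl x y z : B (x + y) z = B x z + B y z by exact: (frameBDl HF).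
have BNl x z : B (- x) z = - B x z by rewrite -scaleN1r /B (frameBZl HF) scaleN1r.
clear nE key tors; clearbody B.
move: (D X (D Y Z) p) (D Y (D X Z) p) (D (bracket X Y) Z p) => d1 d2 d3.
move: (D X Y p) (D Y X p) (D X Z p) (D Y Z p) (X p) (Y p) (Z p).
move=> dxy dyx dxz dyz x y z; rewrite !BDl !BNl.
move: (B dxy z) (B dyx z) (B y dxz) (B x dyz) => b1 b2 b3 b4.
move: (B x (B y z)) (B y (B x z)) (B (B x y) z) (B (B y x) z) => b5 b6 b7 b8.
by apply/rowP => a; rewrite !mxE; ring.
Qed.

End ParallelMaps.

End AdaptedConnection.


(** * Traces against the structure *)

Section Trace.
Variables (R : realType) (m : nat).
Local Notation V := 'rV[R]_m.
Implicit Types (f h : V -> V) (u x y : V) (a : V -> R).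

Definition trace f : R := \sum_i f (delta_mx 0 i) 0 i.

Lemma trace_ext f h : f =1 h -> trace f = trace h.
Proof. by move=> E; apply: eq_bigr => i _; rewrite E. Qed.

Lemma traceD f h : trace (fun x => f x + h x) = trace f + trace h.
Proof. by rewrite -big_split; apply: eq_bigr => i _; rewrite mxE. Qed.

Lemma traceZ (c : R) f : trace (fun x => c *: f x) = c * trace f.
Proof. by rewrite mulr_sumr; apply: eq_bigr => i _; rewrite mxE. Qed.

Lemma trace_id : trace id = m%:R.
Proof.
rewrite /trace (eq_bigr (fun=> 1)); last by move=> i _; rewrite mxE !eqxx.
by rewrite sumr_const card_ord.
Qed.

Lemma trace_rank1 a u : scalar a -> trace (fun x => a x *: u) = a u.
Proof.
move=> al; pose a' : {scalar V} := HB.pack a (GRing.isLinear.Build _ _ _ _ _ al).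
rewrite -[RHS]/(a' u) {2}(row_sum_delta u) linear_sum.
by apply: eq_bigr => i _; rewrite linearZ mxE mulrC.
Qed.

Lemma row_expand f x : linear f -> f x = \sum_i x 0 i *: f (delta_mx 0 i).
Proof.
move=> fl; pose f' : {linear V -> V} := HB.pack f (GRing.isLinear.Build _ _ _ _ _ fl).
rewrite -[LHS]/(f' x) {1}(row_sum_delta x) linear_sum.
by apply: eq_bigr => i _; rewrite linearZ.
Qed.

Lemma traceC f h : linear f -> linear h ->
  trace (fun x => f (h x)) = trace (fun x => h (f x)).
Proof.
move=> fl hl.
have E f1 h1 : linear f1 -> trace (fun x => f1 (h1 x)) =
    \sum_i \sum_j h1 (delta_mx 0 i) 0 j * f1 (delta_mx 0 j) 0 i.
  move=> l1; apply: eq_bigr => i _; rewrite (row_expand (h1 _) l1) summxE.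
  by apply: eq_bigr => j _; rewrite mxE.
rewrite !E// exchange_big; apply: eq_bigr => i _; apply: eq_bigr => j _.
exact: mulrC.
Qed.

End Trace.

(** Traces against an inner product that need not be the standard one. *)
Section Gram.
Variables (R : realType) (m : nat).
Local Notation V := 'rV[R]_m.
Variables (g : V -> V -> R).
Hypotheses (gl : forall y, scalar (g ^~ y)) (gC : forall x y, g x y = g y x)
  (g0 : forall x, g x x = 0 -> x = 0).

Definition gram : 'M[R]_m := \matrix_(i, j) g (delta_mx 0 i) (delta_mx 0 j).

Lemma gramE x y : g x y = (x *m gram *m y^T) 0 0.
Proof.
have gE (z w : V) : g z w = \sum_a z 0 a * g (delta_mx 0 a) w.
  pose f : {scalar V} := HB.pack (g ^~ w) (GRing.isLinear.Build _ _ _ _ _ (gl w)).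
  rewrite -[LHS]/(f z) [in LHS](row_sum_delta z) linear_sum.
  by apply: eq_bigr => a _; rewrite linearZ.
rewrite mxE (eq_bigr (fun b => \sum_a x 0 a * gram a b * y 0 b)); last first.
  by move=> b _; rewrite !mxE mulr_suml.
rewrite exchange_big gE; apply: eq_bigr => a _ /=.
rewrite gC gE mulr_sumr; apply: eq_bigr => b _.
by rewrite mxE gC; ring.
Qed.

Lemma gram_sym : gram^T = gram.
Proof. by apply/matrixP => i j; rewrite !mxE gC. Qed.

Lemma gram_unit : gram \in unitmx.
Proof.
rewrite -row_free_unit -kermx_eq0; apply/eqP/row_matrixP => i.
rewrite row0; apply: g0; rewrite gramE.
have /sub_kermxP -> : (row i (kermx gram) <= kermx gram)%MS by exact: row_sub.
by rewrite mul0mx mxE.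
Qed.

Definition mx_of (f : V -> V) : 'M[R]_m := \matrix_i f (delta_mx 0 i).

Lemma mx_ofE f x : linear f -> f x = x *m mx_of f.
Proof.
move=> fl; rewrite (row_expand x fl) mulmx_sum_row.
by apply: eq_bigr => i _; rewrite rowK.
Qed.

Lemma trace_mx f : trace f = \tr (mx_of f).
Proof. by apply: eq_bigr => i _; rewrite mxE. Qed.

(** In matrices, [f] and the transpose of [h] are conjugate under the Gram matrix. *)
Lemma trace_adjoint f h : linear f -> linear h ->
  (forall x y, g (f x) y = g x (h y)) -> trace f = trace h.
Proof.
move=> fl hl fh.
have E : mx_of f *m gram = gram *m (mx_of h)^T.
  apply/matrixP => i j.
  have := fh (delta_mx 0 i) (delta_mx 0 j).
  rewrite !gramE (mx_ofE _ fl) (mx_ofE _ hl) trmx_mul !mulmxA.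
  rewrite -[_ *m mx_of f *m gram]mulmxA -[_ *m gram *m (mx_of h)^T]mulmxA.
  by rewrite !trmx_delta -!rowE -!colE !mxE.
rewrite !trace_mx -[mx_of f](mulmxK gram_unit) E -mulmxA mxtrace_mulC.
by rewrite mulmxKV ?gram_unit// mxtrace_tr.
Qed.

End Gram.

(** Brings an expression in the inner products of vectors of a frame to a
    polynomial in those of its variables. *)
Ltac frame_norm HF :=
  rewrite ?(frame_fE, frame_linE HF);
  do 3 (rewrite ?(frame_tableE HF); rewrite ?frame_fE; rewrite ?(frame_linE HF);
        rewrite ?(frame_gE HF)).

(** What the computations below use of the trace of endomorphisms of a Euclidean
    space of dimension [d]. *)
Record is_trace (R : realType) (V : lmodType R) (g : V -> V -> R)
    (tr : (V -> V) -> R) (d : R) : Prop := IsTrace {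
  trE : forall f h, f =1 h -> tr f = tr h;
  trD : forall f h, tr (fun x => f x + h x) = tr f + tr h;
  trZ : forall (c : R) f, tr (fun x => c *: f x) = c * tr f;
  tr_id : tr id = d;
  tr_rank1 : forall (a : V -> R) u, scalar a -> tr (fun x => a x *: u) = a u;
  trC : forall f h, linear f -> linear h ->
    tr (fun x => f (h x)) = tr (fun x => h (f x));
  tr_adj : forall f h, linear f -> linear h ->
    (forall x y, g (f x) y = g x (h y)) -> tr f = tr h }.

Lemma trace_is_trace (R : realType) (m : nat) (g : 'rV[R]_m -> 'rV[R]_m -> R) :
  (forall y, scalar (g ^~ y)) -> (forall x y, g x y = g y x) ->
  (forall x, g x x = 0 -> x = 0) -> is_trace g (@trace R m) m%:R.
Proof.
move=> gl gC g0; split.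
- exact: trace_ext.
- exact: traceD.
- exact: traceZ.
- exact: trace_id.
- exact: trace_rank1.
- exact: traceC.
- exact: trace_adjoint.
Qed.

Section FrameTraces.
Variables (R : realType) (V : lmodType R) (F : frame V) (HF : is_frame F).
Variables (tr : (V -> V) -> R) (d : R) (HT : is_trace (fg F) tr d) (al de : R).
Implicit Types (u v w x y z : V) (M : V -> V).
Local Notation g := (fg F). Local Notation B := (frameB al de F).
Local Notation f1 := (f1 F). Local Notation f2 := (f2 F).
Local Notation f3 := (f3 F). Local Notation x1 := (x1 F).
Local Notation x2 := (x2 F). Local Notation x3 := (x3 F).

Lemma trN f : tr (fun x => - f x) = - tr f.
Proof.
rewrite -[RHS]mulN1r -(trZ HT); apply: (trE HT) => x.
by rewrite scaleN1r.
Qed.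

Lemma trB f h : tr (fun x => f x - h x) = tr f - tr h.
Proof. by rewrite (trD HT) trN. Qed.

Lemma fg_scalarl u : scalar (g ^~ u).
Proof. by move=> a x y; rewrite (fgDl HF) (fgZl HF). Qed.

Lemma fg_scalarr u : scalar (g u).
Proof. by move=> a x y; rewrite (fgDr HF) (fgZr HF). Qed.

Lemma tr_rank1l u w : tr (fun x => g x u *: w) = g w u.
Proof. exact: (tr_rank1 HT w (fg_scalarl u)). Qed.

Lemma tr_rank1r u w : tr (fun x => g u x *: w) = g u w.
Proof. exact: (tr_rank1 HT w (fg_scalarr u)). Qed.

Definition frame_trE := (trD HT, trB, trN, trZ HT, tr_rank1l, tr_rank1r).

(** [f1] is the product of [f2] and [f3] in both orders, with opposite signs. *)
Lemma tr_f1 : tr f1 = 0.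
Proof.
have E1 : tr (fun x => f2 (f3 x)) = tr f1.
  rewrite (trE HT (h := fun x => f1 x + g x3 x *: x2)); last exact: f23.
  by rewrite !frame_trE (fgC HF) (g23 HF) addr0.
have E2 : tr (fun x => f3 (f2 x)) = - tr f1.
  rewrite (trE HT (h := fun x => - f1 x + g x2 x *: x3)); last exact: f32.
  by rewrite !frame_trE (g23 HF) addr0.
have := trC HT (linearP f2) (linearP f3); rewrite E1 E2.
by move=> h; lra.
Qed.

Lemma tr_f11 : tr (fun x => f1 (f1 x)) = 1 - d.
Proof.
rewrite (trE HT (h := fun x => - x + g x1 x *: x1)); last exact: f11.
by rewrite !frame_trE (tr_id HT) (g11 HF) addrC.
Qed.

(** The three cyclic summands of [B] have the same shape, so that traces against
    [x |-> B x v] reduce to the following one. *)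
Lemma tr_MTl M v : linear M -> tr (fun x => M (frameT al de F x v)) =
  g x1 (M ((de - al) *: f1 v - al *: (g x2 v *: x3 - g x3 v *: x2)))
  - al * (g (f1 v) (M x1) + g x1 v * tr (fun x => M (f1 x))).
Proof.
move=> Ml.
have MD x y : M (x + y) = M x + M y by rewrite -[x]scale1r Ml !scale1r.
have M0 : M 0 = 0 by apply: (addrI (M 0)); rewrite -MD !addr0.
have MZ a x : M (a *: x) = a *: M x by rewrite -[a *: x]addr0 Ml M0 addr0.
have MN x : M (- x) = - M x by rewrite -scaleN1r MZ scaleN1r.
rewrite (trE HT (h := fun x => g x1 x *: M ((de - al) *: f1 v
     - al *: (g x2 v *: x3 - g x3 v *: x2))
   + (- al) *: (g (f1 v) x *: M x1 + g x1 v *: M (f1 x)))); last first.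
  move=> x; rewrite /frameT MD MZ; congr (_ + _).
  by rewrite MZ MD MN !MZ (f1_skew HF) scaleNr -opprD scalerN scaleNr.
by rewrite !frame_trE; ring.
Qed.

End FrameTraces.

Section MoreTraces.
Variables (R : realType) (V : lmodType R) (F : frame V) (HF : is_frame F).
Variables (tr : (V -> V) -> R) (d : R) (HT : is_trace (fg F) tr d) (al de : R).
Implicit Types (u v w x y z : V) (M : V -> V).
Local Notation g := (fg F). Local Notation B := (frameB al de F).
Local Notation f1 := (f1 F). Local Notation f2 := (f2 F).
Local Notation f3 := (f3 F). Local Notation x1 := (x1 F).
Local Notation x2 := (x2 F). Local Notation x3 := (x3 F).
Let HF' := frame_rot_frame HF.
Let HF'' := frame_rot_frame HF'.

Lemma tr_f2 : tr f2 = 0. Proof. exact: (tr_f1 HF' HT). Qed.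
Lemma tr_f3 : tr f3 = 0. Proof. exact: (tr_f1 HF'' HT). Qed.
Lemma tr_f12 : tr (fun x => f1 (f2 x)) = 0.
Proof.
rewrite (trE HT (h := fun x => f3 x + g x2 x *: x1)); last exact: f12.
by rewrite !(frame_trE HF HT) tr_f3 (fgC HF) (g12 HF) addr0.
Qed.

Lemma tr_f13 : tr (fun x => f1 (f3 x)) = 0.
Proof.
rewrite (trE HT (h := fun x => - f2 x + g x3 x *: x1)); last exact: f13.
by rewrite !(frame_trE HF HT) tr_f2 (g31 HF) oppr0 addr0.
Qed.

Lemma frameB_linear v : linear (B v).
Proof. by move=> a x y; rewrite (frameBDr HF) (frameBZr HF). Qed.

Lemma frameB_linearl v : linear (fun x => B x v).
Proof. by move=> a x y; rewrite (frameBDl HF) (frameBZl HF). Qed.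

(** The factor in [tr (f_a o B_v) = ctrace * g x_a v]. *)
Definition ctrace : R := - (d - 1) * (de - al) - 2 * al.

Lemma tr_f1B v : tr (fun x => f1 (B v x)) = ctrace * g x1 v.
Proof.
rewrite (trE HT (h := fun x =>
  g x1 v *: ((de - al) *: f1 (f1 x)
     + (- al) *: (g x2 x *: f1 x3 - g x3 x *: f1 x2))
  + al *: (g x (f1 v) *: f1 x1 - g x1 x *: f1 (f1 v))
  + (g x2 v *: ((de - al) *: f1 (f2 x)
     + (- al) *: (g x3 x *: f1 x1 - g x1 x *: f1 x3))
  + al *: (g x (f2 v) *: f1 x2 - g x2 x *: f1 (f2 v)))
  + (g x3 v *: ((de - al) *: f1 (f3 x)
     + (- al) *: (g x1 x *: f1 x2 - g x2 x *: f1 x1))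
  + al *: (g x (f3 v) *: f1 x3 - g x3 x *: f1 (f3 v))))); last first.
  move=> x; rewrite /frameB /frameT /=.
  by rewrite !(frame_fE F) !scaleNr.
rewrite !(frame_trE HF HT) (tr_f11 HF HT) tr_f12 tr_f13.
by frame_norm HF; rewrite /ctrace; ring.
Qed.

Lemma tr_MBl M v : linear M -> tr (fun x => M (B x v)) =
  (g x1 (M ((de - al) *: f1 v - al *: (g x2 v *: x3 - g x3 v *: x2)))
   - al * (g (f1 v) (M x1) + g x1 v * tr (fun x => M (f1 x))))
  + (g x2 (M ((de - al) *: f2 v - al *: (g x3 v *: x1 - g x1 v *: x3)))
   - al * (g (f2 v) (M x2) + g x2 v * tr (fun x => M (f2 x))))
  + (g x3 (M ((de - al) *: f3 v - al *: (g x1 v *: x2 - g x2 v *: x1)))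
   - al * (g (f3 v) (M x3) + g x3 v * tr (fun x => M (f3 x)))).
Proof.
move=> Ml.
have MD x y : M (x + y) = M x + M y by rewrite -[x]scale1r Ml !scale1r.
rewrite (trE HT (h := fun x => M (frameT al de F x v)
  + M (frameT al de (frame_rot F) x v)
  + M (frameT al de (frame_rot (frame_rot F)) x v))); last first.
  by move=> x; rewrite /frameB !MD.
by rewrite !(trD HT) (tr_MTl HF HT) // (tr_MTl HF' HT) // (tr_MTl HF'' HT).
Qed.

Lemma tr_f1_Bl w : tr (fun x => f1 (B x w)) =
  (al * (d - 1) + 2 * (de - al)) * g x1 w.
Proof.
rewrite (tr_MBl w (linearP f1)) (tr_f11 HF HT) tr_f12 tr_f13.
by frame_norm HF; ring.
Qed.

Lemma tr_Bl w : tr (fun x => B x w) = 0.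
Proof.
have idl : linear (@id V) by [].
rewrite (tr_MBl w idl) (tr_f1 HF HT) tr_f2 tr_f3.
by frame_norm HF; ring.
Qed.

End MoreTraces.

Section CurvatureTraces.
Variables (R : realType) (V : lmodType R) (F : frame V) (HF : is_frame F).
Variables (tr : (V -> V) -> R) (d : R) (HT : is_trace (fg F) tr d) (al de : R).
Implicit Types (u v w x y z : V) (M : V -> V).
Local Notation g := (fg F). Local Notation B := (frameB al de F).
Local Notation D := (frameD al de F). Local Notation Q := (frameQ al de F).
Local Notation f1 := (f1 F). Local Notation f2 := (f2 F).
Local Notation f3 := (f3 F). Local Notation x1 := (x1 F).
Local Notation x2 := (x2 F). Local Notation x3 := (x3 F).
Let HF' := frame_rot_frame HF.
Let HF'' := frame_rot_frame HF'.

Lemma fgB3 u v w z : g (u - v - w) z = g u z - g v z - g w z.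
Proof. by rewrite !(fgDl HF) !(fgNl HF). Qed.

Lemma tr_f2B v : tr (fun x => f2 (B v x)) = ctrace d al de * g x2 v.
Proof.
rewrite -(tr_f1B HF' HT al de v); apply: (trE HT) => x.
by rewrite frameB_rot.
Qed.

Lemma tr_f3B v : tr (fun x => f3 (B v x)) = ctrace d al de * g x3 v.
Proof.
rewrite -(tr_f1B HF'' HT al de v); apply: (trE HT) => x.
by rewrite !frameB_rot.
Qed.

Lemma tr_DM z M : linear M -> tr (fun x => D z (M x)) =
  al * (g z (M x1) - g x1 (M z))
  + 2 * (de - al) * (g x3 z * tr (fun x => f2 (M x))
                     - g x2 z * tr (fun x => f3 (M x)))
  - (de - al) * (g x2 z * (g x2 (M x1) - g x1 (M x2))
                 + g x3 z * (g x3 (M x1) - g x1 (M x3))).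
Proof.
move=> Ml; have gM u w : tr (fun x => g u (M x) *: w) = g u (M w).
  apply: (tr_rank1 HT w (a := fun x => g u (M x))) => a x y.
  by rewrite Ml (fgDr HF) (fgZr HF).
rewrite (trE HT (h := fun x =>
  al *: (g z (M x) *: x1 - g x1 (M x) *: z)
  + (2 * (de - al)) *: (g x3 z *: f2 (M x) - g x2 z *: f3 (M x))
  - (de - al) *: (g x2 z *: (g x2 (M x) *: x1 - g x1 (M x) *: x2)
                  + g x3 z *: (g x3 (M x) *: x1 - g x1 (M x) *: x3)))).
  by rewrite !(frame_trE HF HT) !gM; ring.
move=> x; rewrite /frameD; congr (_ - _ *: _).
rewrite scalerBr scalerBr !scalerA scalerDl scalerDr !scalerA opprD addrACA.
by rewrite !(mulrC (g x1 _)).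
Qed.

(** In the commutator [[B_z, B_v]] the trace against [f1] only sees the commutator
    [D] of [B] with [f1], by cyclicity. *)
Lemma tr_f1Q z v : tr (fun x => f1 (Q z v x)) =
  - 2 * ((al ^+ 2 + (d - 1) * al * (de - al)) * g z (f1 v)
         - (al - de) ^+ 2 * (g x2 z * g x3 v - g x2 v * g x3 z)).
Proof.
have E : tr (fun x => f1 (Q z v x)) =
    - tr (fun x => D z (B v x)) - tr (fun x => f1 (B (B z v - B v z) x)).
  rewrite -(trN HT) -(trB HT).
  have c1 : tr (fun x => f1 (B v (B z x))) = tr (fun x => B z (f1 (B v x))).
    apply: (trC HT (f := fun y => f1 (B v y)) _ (frameB_linear HF al de z)).
    by move=> a x y; rewrite (frameBDr HF) (frameBZr HF) linearP.
  rewrite (trE HT (h := fun x => f1 (B z (B v x)) - f1 (B v (B z x))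
     - f1 (B (B z v - B v z) x))); last first.
    by move=> x; rewrite /frameQ !linearB.
  rewrite !(trB HT) c1 -(trB HT); congr (_ - _).
  by apply: (trE HT) => x; rewrite -(frameB_comm HF) opprB.
rewrite E (tr_DM _ (frameB_linear HF al de v)) tr_f2B tr_f3B.
rewrite (tr_f1B HF HT) (fgDr HF) (fgNr HF).
have := frameB_torsion1 HF al de z v => ->.
rewrite (frameB_x1 HF) (frameB_x2 HF) (frameB_x3 HF) /ctrace.
rewrite -(fgC HF (B v z)) (frameB_skew HF) (frameB_x1 HF).
by frame_norm HF; ring.
Qed.

(** By the pair symmetry, this gives the curvature operator on [x2 /\ x3]. *)
Lemma frameQ_x23 z v : g (Q z v x2) x3 =
  - (2 * al * (al - de) * g z (f1 v)
     + (2 * al * (al - de) + de ^+ 2) * (g x2 z * g x3 v - g x2 v * g x3 z)).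
Proof.
have tors := frameB_torsion1 HF al de z v.
have -> : g (Q z v x2) x3 =
    - g (B v x2) (B z x3) + g (B z x2) (B v x3) - g (B (B z v - B v z) x2) x3.
  rewrite /frameQ fgB3 (frameB_skew HF al de z (B v x2)).
  by rewrite (frameB_skew HF al de v (B z x2)) opprK.
have {tors} : g x1 (B z v - B v z) = - (2 * al * g z (f1 v)
    + 2 * (al - de) * (g x2 z * g x3 v - g x2 v * g x3 z)).
  by rewrite (fgDr HF) (fgNr HF).
move: (B z v - B v z) => t.
rewrite !(frameB_x2 HF) !(frameB_x3 HF).
frame_norm HF => ->.
rewrite (f1_swap HF v z); ring.
Qed.

End CurvatureTraces.

(** Besides the symmetries of a Riemann tensor: the part [Rm - frameQ], which is
    the curvature of the canonical connection, commutes with the three structures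
    and kills the three characteristic vectors. *)
Record is_curvature (R : realType) (V : lmodType R) (F : frame V) (al de : R)
    (Rm : V -> V -> V -> V) : Prop := IsCurvature {
  Rm_linear1 : forall y z, linear (fun x => Rm x y z);
  Rm_linear2 : forall x z, linear (fun y => Rm x y z);
  Rm_linear3 : forall x y, linear (Rm x y);
  Rm_skew : forall x y z, Rm y x z = - Rm x y z;
  Rm_metric : forall x y z v, fg F (Rm x y z) v = - fg F z (Rm x y v);
  Rm_bianchi : forall x y z, Rm x y z + Rm y z x + Rm z x y = 0;
  Rm_pair : forall x y z v, fg F (Rm x y z) v = fg F (Rm z v x) y;
  Rm_f1 : forall x y z, Rm x y (f1 F z) - f1 F (Rm x y z) =
    frameQ al de F x y (f1 F z) - f1 F (frameQ al de F x y z);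
  Rm_f2 : forall x y z, Rm x y (f2 F z) - f2 F (Rm x y z) =
    frameQ al de F x y (f2 F z) - f2 F (frameQ al de F x y z);
  Rm_f3 : forall x y z, Rm x y (f3 F z) - f3 F (Rm x y z) =
    frameQ al de F x y (f3 F z) - f3 F (frameQ al de F x y z);
  Rm_x1 : forall x y, Rm x y (x1 F) = frameQ al de F x y (x1 F);
  Rm_x2 : forall x y, Rm x y (x2 F) = frameQ al de F x y (x2 F);
  Rm_x3 : forall x y, Rm x y (x3 F) = frameQ al de F x y (x3 F) }.

Lemma frameQ_rot (R : realType) (V : lmodType R) (F : frame V) (al de : R) x y z :
  frameQ al de (frame_rot F) x y z = frameQ al de F x y z.
Proof. by rewrite /frameQ !frameB_rot. Qed.

Lemma is_curvature_rot (R : realType) (V : lmodType R) (F : frame V) (al de : R) Rm :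
  is_curvature F al de Rm -> is_curvature (frame_rot F) al de Rm.
Proof. by case=> *; split=> //= *; rewrite !frameQ_rot. Qed.

Lemma linear_sub3 (R : pzRingType) (V : lmodType R) (a : R) (b1 b2 b3 b4 b5 b6 : V) :
  a *: b1 + b2 - (a *: b3 + b4) - (a *: b5 + b6)
  = a *: (b1 - b3 - b5) + (b2 - b4 - b6).
Proof.
rewrite !scalerDr !scalerN !opprD !addrA.
rewrite -!addrA; congr (_ + _).
rewrite addrCA; congr (_ + _).
by rewrite [RHS]addrCA; congr (_ + _); rewrite addrCA.
Qed.

Lemma sub_swap (V : zmodType) (a b c e : V) : a - c = b - e -> a - b = c - e.
Proof. by move=> h; rewrite -[a](subrK c) h addrAC [b - e]addrC addrK addrC. Qed.

Section Curvature.
Variables (R : realType) (V : lmodType R) (F : frame V) (HF : is_frame F).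
Variables (tr : (V -> V) -> R) (d : R) (HT : is_trace (fg F) tr d) (al de : R).
Variables (Rm : V -> V -> V -> V) (HR : is_curvature F al de Rm).
Implicit Types (u v w x y z : V).
Local Notation g := (fg F). Local Notation B := (frameB al de F).
Local Notation D := (frameD al de F). Local Notation Q := (frameQ al de F).
Local Notation f1 := (f1 F). Local Notation f2 := (f2 F).
Local Notation f3 := (f3 F). Local Notation x1 := (x1 F).
Local Notation x2 := (x2 F). Local Notation x3 := (x3 F).

Lemma frameQ_linear z v : linear (Q z v).
Proof.
move=> a x y; have Bl w := frameB_linear HF al de w.
rewrite /frameQ (Bl v) (Bl z) (Bl z) (Bl v) (Bl (_ - _)).
exact: linear_sub3.
Qed.

(** On the image of [K], which is horizontal, [f1] is both [f2 f3] and [- f3 f2];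
    cyclicity of the trace then makes the trace equal to its opposite. *)
Lemma tr_f1_commuting K : linear K -> (forall x, K (f2 x) = f2 (K x)) ->
  K x2 = 0 -> K x3 = 0 -> (forall x y, g (K x) y = - g x (K y)) ->
  tr (fun x => f1 (K x)) = 0.
Proof.
move=> Kl K2 kx2 kx3 Ks.
have z3 x : g x3 (K x) = 0 by rewrite (fgC HF) Ks kx3 (fg0r HF) oppr0.
have z2 x : g x2 (K x) = 0 by rewrite (fgC HF) Ks kx2 (fg0r HF) oppr0.
have E1 : tr (fun x => f1 (K x)) = tr (fun x => f2 (f3 (K x))).
  by apply: (trE HT) => x; rewrite (f23 HF) z3 scale0r addr0.
have E2 : tr (fun x => f1 (K x)) = - tr (fun x => f3 (f2 (K x))).
  rewrite -(trN HT); apply: (trE HT) => x.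
  by rewrite (f32 HF) z2 scale0r addr0 opprK.
have : tr (fun x => f2 (f3 (K x))) = tr (fun x => f3 (f2 (K x))).
  rewrite (trC HT (linearP f2) (h := fun x => f3 (K x))).
    by apply: (trE HT) => x; rewrite K2.
  by move=> a x y; rewrite Kl linearP.
by move=> h; lra.
Qed.

Lemma tr_f1_eq K L : linear K -> linear L ->
  (forall x, K (f2 x) - f2 (K x) = L (f2 x) - f2 (L x)) ->
  K x2 = L x2 -> K x3 = L x3 -> (forall x y, g (K x) y = - g x (K y)) ->
  (forall x y, g (L x) y = - g x (L y)) ->
  tr (fun x => f1 (K x)) = tr (fun x => f1 (L x)).
Proof.
move=> Kl Ll KL2 kx2 kx3 Ks Ls.
apply/eqP; rewrite -subr_eq0 -(trB HT); apply/eqP.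
rewrite -[RHS](tr_f1_commuting (K := fun x => K x - L x)).
- by apply: (trE HT) => x; exact/esym/linearB.
- move=> a x y; rewrite Kl Ll; apply: (fg_inj HF) => w.
  by rewrite ?(frame_linE HF); ring.
- by move=> x; rewrite linearB; exact/sub_swap/KL2.
- by rewrite kx2 subrr.
- by rewrite kx3 subrr.
- by move=> x y; rewrite (fgDl HF) (fgDr HF) (fgNl HF) (fgNr HF) Ks Ls; ring.
Qed.

Lemma frameQ_skew z v x y : g (Q z v x) y = - g x (Q z v y).
Proof.
rewrite /frameQ (fgB3 HF) (fgC HF x (_ - _)) (fgB3 HF).
rewrite (frameB_skew HF al de z (B v x)) (frameB_skew HF al de v x).
rewrite (frameB_skew HF al de v (B z x)) (frameB_skew HF al de z x).
rewrite (frameB_skew HF al de (B z v - B v z) x).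
rewrite (fgC HF (B z (B v y))) (fgC HF (B v (B z y))).
by rewrite (fgC HF (B (B z v - B v z) y)); ring.
Qed.

(** The curvature of the canonical connection does not contribute. *)
Lemma tr_f1Rm z v : tr (fun x => f1 (Rm z v x)) = tr (fun x => f1 (Q z v x)).
Proof.
apply: tr_f1_eq.
- exact: (Rm_linear3 HR).
- exact: frameQ_linear.
- exact: (Rm_f2 HR).
- exact: (Rm_x2 HR).
- exact: (Rm_x3 HR).
- exact: (Rm_metric HR).
- exact: frameQ_skew.
Qed.

Definition ric v w : R := tr (fun x => Rm x v w).

Lemma ricC v w : ric v w = ric w v.
Proof.
apply: (tr_adj HT) => [||x y]; [exact: (Rm_linear1 HR)|exact: (Rm_linear1 HR)|].
rewrite (Rm_pair HR) (Rm_skew HR) (fgNl HF) (Rm_metric HR) opprK (fgC HF).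
by rewrite (fgC HF (Rm _ _ _)).
Qed.

Lemma ricDl u v w : ric (u + v) w = ric u w + ric v w.
Proof.
rewrite -(trD HT); apply: (trE HT) => x.
by have := Rm_linear2 HR x w 1 u v; rewrite !scale1r.
Qed.

Lemma ricZl (a : R) v w : ric (a *: v) w = a * ric v w.
Proof.
rewrite -(trZ HT); apply: (trE HT) => x; have L := Rm_linear2 HR x w.
have L0 : Rm x 0 w = 0.
  by have := L 1 0 0; rewrite !scale1r addr0 => /(canLR (addrK _)); rewrite subrr.
by have := L a v 0; rewrite L0 !addr0.
Qed.

(** The first Bianchi identity relates the contraction of the curvature with a
    structure in its endomorphism part to the one across its two parts, which
    the pair symmetry makes skew. *)
Lemma tr_f1Rm_bianchi z v :
  tr (fun x => f1 (Rm z v x)) = 2 * tr (fun x => f1 (Rm x v z)).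
Proof.
have skew a b : tr (fun x => f1 (Rm x a b)) = - tr (fun x => f1 (Rm x b a)).
  have L1 := Rm_linear1 HR; have L2 := Rm_linear2 HR.
  rewrite -(trN HT).
  have -> : tr (fun x => - f1 (Rm x b a)) = tr (fun x => f1 (Rm b x a)).
    by apply: (trE HT) => x; rewrite (Rm_skew HR b x) linearN opprK.
  rewrite (trC HT (linearP f1) (h := fun x => Rm b x a)) //.
  apply: (tr_adj HT) => [c x y|c x y|x y]; rewrite ?L1 ?linearP ?L2//.
  rewrite -[LHS]opprK -(f1_skew HF) (Rm_pair HR) (Rm_metric HR) opprK.
  by [].
rewrite (trE HT (h := fun x => f1 (Rm x v z) - f1 (Rm x z v))); last first.
  move=> x; have := Rm_bianchi HR z v x; rewrite (Rm_skew HR x v).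
  rewrite -linearB => /eqP; rewrite -addrA addr_eq0 opprD opprK => /eqP ->.
  by [].
by rewrite (trB HT) (skew z v); ring.
Qed.

Let Bl := frameB_linear HF al de.
Let Al := frameB_linearl HF al de.

Lemma tr_Bf1 w : tr (fun x => B (f1 x) w) = (al * (d - 1) + 2 * (de - al)) * g x1 w.
Proof. by rewrite (trC HT (Al w) (linearP f1)) (tr_f1_Bl HF HT). Qed.

End Curvature.

Section Ricci.
Variables (R : realType) (V : lmodType R) (F : frame V) (HF : is_frame F).
Variables (tr : (V -> V) -> R) (d : R) (HT : is_trace (fg F) tr d) (al de : R).
Variables (Rm : V -> V -> V -> V) (HR : is_curvature F al de Rm).
Implicit Types (u v w x y z : V).
Local Notation g := (fg F). Local Notation B := (frameB al de F).
Local Notation D := (frameD al de F). Local Notation Q := (frameQ al de F).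
Local Notation f1 := (f1 F). Local Notation f2 := (f2 F).
Local Notation f3 := (f3 F). Local Notation x1 := (x1 F).
Local Notation x2 := (x2 F). Local Notation x3 := (x3 F).
Local Notation ric := (ric tr Rm).
Let HF' := frame_rot_frame HF.
Let HF'' := frame_rot_frame HF'.
Let Bl := frameB_linear HF al de.
Let Al := frameB_linearl HF al de.

Lemma tr_Bf2 w : tr (fun x => B (f2 x) w) = (al * (d - 1) + 2 * (de - al)) * g x2 w.
Proof.
rewrite -(tr_Bf1 HF' HT al de w); apply: (trE HT) => x.
by rewrite frameB_rot.
Qed.

Lemma tr_Bf3 w : tr (fun x => B (f3 x) w) = (al * (d - 1) + 2 * (de - al)) * g x3 w.
Proof.
rewrite -(tr_Bf1 HF'' HT al de w); apply: (trE HT) => x.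
by rewrite !frameB_rot.
Qed.

Lemma tr_Q v w : tr (fun x => Q x v w) = - tr (fun x => B (B x v) w).
Proof.
rewrite (trE HT (h := fun x => B x (B v w) - B v (B x w)
   - (B (B x v) w - B (B v x) w))); last first.
  move=> x; rewrite /frameQ; congr (_ - _).
  by rewrite (frameBDl HF) -[- B v x]scaleN1r (frameBZl HF) scaleN1r.
rewrite !(trB HT) (tr_Bl HF HT) (trC HT (Bl v) (Al w)).
by ring.
Qed.

(** Together with [tr_Q], the contribution of the connection form to the Ricci
    tensor. *)
Lemma tr_BB v w : tr (fun x => B (B x v) w) =
  - (6 * al * (de - al) * g v w + (al ^+ 2 * (d - 3) + 2 * de ^+ 2
     - 6 * al * (de - al)) * (g x1 v * g x1 w + g x2 v * g x2 w + g x3 v * g x3 w)).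
Proof.
rewrite (tr_MBl HF HT al de v (Al w)) (tr_Bf1 HF HT) tr_Bf2 tr_Bf3.
have sk u z : g u (B z w) = - g w (B z u).
  by rewrite (fgC HF) (frameB_skew HF).
rewrite (sk x1) (sk x2) (sk x3) (frameB_x1 HF) (frameB_x2 HF) (frameB_x3 HF).
rewrite (frameB_at_x1 HF) (frameB_at_x2 HF) (frameB_at_x3 HF).
frame_norm HF; rewrite (fgC HF w v).
by ring.
Qed.

End Ricci.


(** * The Ricci tensor *)

Section HorizontalRicci.
Variables (R : realType) (V : lmodType R) (F : frame V) (HF : is_frame F).
Variables (tr : (V -> V) -> R) (d : R) (HT : is_trace (fg F) tr d) (al de : R).
Variables (Rm : V -> V -> V -> V) (HR : is_curvature F al de Rm).
Implicit Types (u v w x y z : V) (M : V -> V).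
Local Notation g := (fg F). Local Notation B := (frameB al de F).
Local Notation D := (frameD al de F). Local Notation Q := (frameQ al de F).
Local Notation f1 := (f1 F). Local Notation f2 := (f2 F).
Local Notation f3 := (f3 F). Local Notation x1 := (x1 F).
Local Notation x2 := (x2 F). Local Notation x3 := (x3 F).
Local Notation ric := (ric tr Rm).
Let Bl := frameB_linear HF al de.
Let Al := frameB_linearl HF al de.

(** The eigenvalues of the Ricci tensor on the span of the three characteristic
    vectors and on its orthogonal complement. *)
Definition vertical_ricci : R := al ^+ 2 * (d - 3) + 2 * de ^+ 2.
Definition horizontal_ricci : R := al * (de * (d + 5) - 6 * al).
Local Notation kap := vertical_ricci.
Local Notation rho := horizontal_ricci.

Lemma ric_x1 v : ric v x1 = kap * g x1 v.
Proof.
rewrite /ric (trE HT (h := fun x => Q x v x1)); last first.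
  by move=> x; rewrite (Rm_x1 HR).
rewrite (tr_Q HF HT) (tr_BB HF HT) (g11 HF) (fgC HF x2 x1) (g12 HF) (g31 HF).
by rewrite (fgC HF v x1) /vertical_ricci; ring.
Qed.

Definition horizontal v := [/\ g x1 v = 0, g x2 v = 0 & g x3 v = 0].

Lemma tr_f1BB v z : horizontal v -> horizontal z ->
  tr (fun x => f1 (B (B x v) z)) = al * (de - al) * g (f1 v) z.
Proof.
move=> [v1 v2 v3] [z1 z2 z3].
have Ml : linear (fun x => f1 (B x z)) by move=> a x y; rewrite Al linearP.
have sk u y : g u (B y z) = - g z (B y u).
  by rewrite (fgC HF) (frameB_skew HF).
rewrite (tr_MBl HF HT al de v Ml) v1 v2 v3 !mul0r !addr0 !scale0r !subrr.
rewrite !scaler0 !subr0 !(f1_skew HF) (f1x1 HF) (f1x2 HF) (f1x3 HF).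
rewrite (fg0l HF) !(fgNl HF) !sk !(frameB_x2 HF) !(frameB_x3 HF).
rewrite (frameB_at_x1 HF) (frameB_at_x2 HF) (frameB_at_x3 HF).
have gz1 : g z x1 = 0 by rewrite (fgC HF).
have gz2 : g z x2 = 0 by rewrite (fgC HF).
have gz3 : g z x3 = 0 by rewrite (fgC HF).
frame_norm HF; rewrite ?v1 ?v2 ?v3 ?z1 ?z2 ?z3 ?gz1 ?gz2 ?gz3.
by rewrite (f1_swap HF z v); ring.
Qed.

Lemma tr_f1Ql v z : horizontal v -> horizontal z ->
  tr (fun x => f1 (Q x v z)) =
  - al ^+ 2 * (d - 2) * g v (f1 z).
Proof.
move=> hv hz; rewrite (trE HT (h := fun x => f1 (B x (B v z))
   - (B v (f1 (B x z)) - D v (B x z))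
   - (f1 (B (B x v) z) - f1 (B (B v x) z)))); last first.
  move=> x; rewrite -(frameB_comm HF) /frameQ subKr -!linearB.
  by congr (f1 (_ - _)); rewrite (frameBDl HF) -scaleN1r (frameBZl HF) scaleN1r.
have Ml : linear (fun x => f1 (B x z)) by move=> a x y; rewrite Al linearP.
have := tr_DM HF HT al de v (Al z); move: (D v) => Dv trDv.
rewrite !(trB HT) (tr_f1_Bl HF HT) (trC HT (Bl v) Ml) trDv (tr_f1BB hv hz).
case: hv hz => [v1 v2 v3] [z1 z2 z3]; rewrite v2 v3.
have -> : g x1 (B v z) = - g z (B v x1) by rewrite (fgC HF) (frameB_skew HF).
rewrite (frameB_x1 HF) (frameB_at_x1 HF).
rewrite v2 v3 z2 z3 !mul0r !scale0r !subrr !scaler0 !addr0 !mulr0 !subr0.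
rewrite !(fgZr HF) (fgC HF (f1 v)).
have -> : g z (f1 v) = - g v (f1 z) by rewrite (f1_skew HF) (fgC HF).
by ring.
Qed.

(** Commuting [f1] with [Rm] turns the Ricci contraction into that of [f1 o Rm], which
    by the Bianchi identity is half of the trace of [f1 o Rm z v] computed by
    [tr_f1Rm]; the error terms only involve [frameQ]. *)
Lemma ric_horizontal_f1 v z : horizontal v -> horizontal z ->
  ric v (f1 z) = rho * g v (f1 z).
Proof.
move=> hv hz; have gfvz : g z (f1 v) = - g v (f1 z).
  by rewrite (f1_skew HF) (fgC HF).
have E : tr (fun x => f1 (Rm x v z)) =
    - (al ^+ 2 + (d - 1) * al * (de - al)) * g z (f1 v).
  have := tr_f1Rm_bianchi HF HT HR z v.
  rewrite (tr_f1Rm HF HT HR) (tr_f1Q HF HT).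
  by case: hv hz => [v1 v2 v3] [z1 z2 z3]; rewrite v2 v3 !mulr0 ?mul0r => h; lra.
rewrite /ric (trE HT (h := fun x => f1 (Rm x v z)
   + (Q x v (f1 z) - f1 (Q x v z)))); last first.
  by move=> x; rewrite -(Rm_f1 HR) addrC subrK.
have := tr_f1Ql hv hz; have := tr_Q HF HT al de v (f1 z); rewrite (tr_BB HF HT).
case: hv => [v1 v2 v3]; rewrite v1 v2 v3 !mul0r !addr0 mulr0 addr0 opprK.
move: E; set t1 := tr _; set t2 := tr _; set t3 := tr _ => E1 E2 E3.
rewrite (trD HT) (trB HT) -/t1 -/t2 -/t3 E1 E2 E3 gfvz /horizontal_ricci.
by ring.
Qed.

Lemma ric_horizontal v w : horizontal v -> horizontal w ->
  ric v w = rho * g v w.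
Proof.
move=> hv hw; have [w1 w2 w3] := hw.
have hz : horizontal (- f1 w).
  by split; rewrite (fgNr HF) (f1_skew HF) opprK ?(f1x1 HF) ?(f1x2 HF) ?(f1x3 HF)
       ?(fg0l HF) ?(fgNl HF) ?w2 ?w3 ?oppr0.
have -> : w = f1 (- f1 w) by rewrite linearN (f11 HF) w1 scale0r addr0 opprK.
exact: ric_horizontal_f1.
Qed.

End HorizontalRicci.

Section RicciFormula.
Variables (R : realType) (V : lmodType R) (F : frame V) (HF : is_frame F).
Variables (tr : (V -> V) -> R) (d : R) (HT : is_trace (fg F) tr d) (al de : R).
Variables (Rm : V -> V -> V -> V) (HR : is_curvature F al de Rm).
Implicit Types (u v w : V).
Local Notation g := (fg F).
Local Notation x1 := (x1 F). Local Notation x2 := (x2 F).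
Local Notation x3 := (x3 F). Local Notation ric := (ric tr Rm).
Local Notation horizontal := (horizontal F).
Local Notation kap := (vertical_ricci d al de).
Local Notation rho := (horizontal_ricci d al de).

(** Vertical vectors are eigenvectors of the Ricci tensor, so that the mixed terms
    vanish. *)
Lemma ricci_formula v w : ric v w = rho * g v w
  + (kap - rho) * (g x1 v * g x1 w + g x2 v * g x2 w + g x3 v * g x3 w).
Proof.
have r2 u : ric u x2 = kap * g x2 u := ric_x1 (frame_rot_frame HF) HT
  (is_curvature_rot HR) u.
have r3 u : ric u x3 = kap * g x3 u := ric_x1 (frame_rot_frame (frame_rot_frame HF))
  HT (is_curvature_rot (is_curvature_rot HR)) u.
have rD u y z : ric (u + y) z = ric u z + ric y z := ricDl HT HR u y z.
have rZ a u z : ric (a *: u) z = a * ric u z := ricZl HT HR a u z.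
have rC u z : ric u z = ric z u := ricC HF HT HR u z.
have split1 u z : ric u z = ric (u - (g x1 u *: x1 + g x2 u *: x2 + g x3 u *: x3)) z
    + kap * (g x1 u * g x1 z + g x2 u * g x2 z + g x3 u * g x3 z).
  rewrite -[in LHS](subrK (g x1 u *: x1 + g x2 u *: x2 + g x3 u *: x3) u).
  rewrite [LHS]rD; apply: congr2 => //; rewrite !rD !rZ !(rC _ z) (ric_x1 HF HT HR) r2 r3.
  by ring.
have hp u : horizontal (u - (g x1 u *: x1 + g x2 u *: x2 + g x3 u *: x3)).
  by split; frame_norm HF; ring.
rewrite split1 rC split1 (ric_horizontal HF HT HR (hp _) (hp _)).
by frame_norm HF; rewrite (fgC HF w v); ring.
Qed.

(** Otherwise the identity would have trace three. *)
Lemma horizontal_neq0 : d != 3 -> exists2 v, horizontal v & v != 0.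
Proof.
move=> d3; apply: contrapT => H.
have E u : u = g x1 u *: x1 + g x2 u *: x2 + g x3 u *: x3.
  apply/eqP; rewrite -subr_eq0; apply/negPn/negP => un0; apply: H.
  by exists (u - (g x1 u *: x1 + g x2 u *: x2 + g x3 u *: x3)) => //;
    split; frame_norm HF; ring.
move/eqP: d3; apply; rewrite -(tr_id HT) (trE HT E).
by rewrite !(frame_trE HF HT) (g11 HF) (g22 HF) (g33 HF); ring.
Qed.

End RicciFormula.


(** * Bivectors and the curvature operator *)

Section Bivectors.
Variables (R : realType) (m : nat) (M : manifold R m) (g : metric M) (p : M).
Local Notation V := 'rV[R]_m.
Implicit Types (A C : 'M[R]_m) (x y z v : V) (f h : V -> V).
Local Notation G := (gram (g p)).
Local Notation dot := (bdot g p).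

Let gl y : scalar ((g p)^~ y).
Proof. exact: metric_linear. Qed.
Let gC x y : g p x y = g p y x.
Proof. exact: metricC. Qed.
Let g0 x : g p x x = 0 -> x = 0.
Proof. exact: metric_eq0. Qed.
Let GT : G^T = G := gram_sym gC.
Let Gu : G \in unitmx := gram_unit gl gC g0.
Let gE x y : g p x y = (x *m G *m y^T) 0 0 := gramE gl gC x y.

Lemma bdotE A C : dot A C = 2^-1 * \tr (A^T *m (G *m C *m G)).
Proof.
rewrite /bdot; congr (_ * _); rewrite [in LHS]exchange_big; apply: eq_bigr => b _.
rewrite mxE; apply: eq_bigr => a _; rewrite !mxE exchange_big mulr_sumr.
apply: eq_bigr => d _; rewrite !mxE [g p (delta_mx 0 d) _]gC mulr_suml mulr_sumr.
by apply: eq_bigr => c _; rewrite !mxE; ring.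
Qed.

Lemma bdotC A C : dot A C = dot C A.
Proof.
rewrite !bdotE -[in LHS]mxtrace_tr !trmx_mul trmxK GT !mulmxA.
by rewrite -!mulmxA mxtrace_mulC !mulmxA.
Qed.

Lemma bdot_linearr A : scalar (dot A).
Proof.
move=> a C C'; rewrite !bdotE mulmxDr mulmxDl mulmxDr linearD mulrDr.
by rewrite -scalemxAr -scalemxAl -scalemxAr linearZ/=; congr (_ + _); ring.
Qed.

Lemma bdot_wedgeE A x y : bivector A ->
  dot A (wedge x y) = (x *m G *m A *m G *m y^T) 0 0.
Proof.
move=> bA; rewrite bdotE /wedge.
have key2 z v : (z *m G *m A *m G *m v^T) 0 0 = - (v *m G *m A *m G *m z^T) 0 0.
  rewrite -[z *m _ *m _ *m _ *m _]trmxK mxE !trmx_mul !trmxK bA GT.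
  by rewrite !mulNmx !mulmxN !mulmxA mxE.
have key z v : \tr (A^T *m (G *m (z^T *m v) *m G)) = (z *m G *m A *m G *m v^T) 0 0.
  have -> : A^T *m (G *m (z^T *m v) *m G) = (A^T *m G *m z^T) *m (v *m G).
    by rewrite !mulmxA.
  rewrite mxtrace_mulC trace_mx11 bA key2 !mulNmx mulmxN mxE.
  by rewrite !mulmxA.
rewrite mulmxBr mulmxBl mulmxBr linearB /= !key [X in _ - X]key2.
by rewrite opprK; move: (fun_of_matrix _ 0 0) => t; field.
Qed.

(** The products with decomposable bivectors are the entries of the conjugate by
    the invertible Gram matrix. *)
Lemma bivector_inj A C : bivector A -> bivector C ->
  (forall x y, dot A (wedge x y) = dot C (wedge x y)) -> A = C.
Proof.
move=> bA bC E.
have {E} : G *m A *m G = G *m C *m G.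
  apply/matrixP => a b; have := E (delta_mx 0 a) (delta_mx 0 b).
  rewrite !bdot_wedgeE// trmx_delta -!mulmxA !mulmxA -!rowE -!colE.
  have colrow (X : 'M[R]_m) : col b (row a X) 0 0 = X a b by rewrite !mxE.
  by rewrite -!row_mul !colrow.
move/(congr1 (fun X => invmx G *m X *m invmx G)).
by rewrite !mulmxA mulVmx// !mul1mx !mulmxK.
Qed.

(** For skew [f], the bivector dual to the 2-form [g x (f y)]. *)
Definition endo_bivector f : 'M[R]_m := (mx_of f)^T *m invmx G.

Section Skew.
Variables (f : V -> V) (fl : linear f) (fs : forall x y, g p x (f y) = - g p (f x) y).

Lemma mx_of_skew : G *m (mx_of f)^T = - (mx_of f *m G).
Proof.
apply/matrixP => a b; have := fs (delta_mx 0 a) (delta_mx 0 b).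
rewrite !gE (mx_ofE (delta_mx 0 a) fl) (mx_ofE (delta_mx 0 b) fl).
have colrow (X : 'M[R]_m) : col b (row a X) 0 0 = X a b by rewrite !mxE.
rewrite trmx_mul trmx_delta !mulmxA -!rowE.
rewrite -[row a G *m _ *m _]mulmxA mulmxA -!colE -!row_mul !colrow => ->.
by rewrite [RHS]mxE.
Qed.

Lemma endo_bivectorP : bivector (endo_bivector f).
Proof.
rewrite /bivector /endo_bivector trmx_mul trmxK trmx_inv GT.
apply: (can_inj (mulKmx Gu)); apply: (can_inj (mulmxK Gu)).
rewrite mulmxN !mulmxA mulmxV// mul1mx mx_of_skew !mulNmx opprK.
by rewrite -mulmxA mulVmx// mulmx1.
Qed.

Lemma endo_bivectorE x y : dot (endo_bivector f) (wedge x y) = g p x (f y).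
Proof.
rewrite (bdot_wedgeE _ _ endo_bivectorP) /endo_bivector !mulmxA.
by rewrite mulmxKV// gE (mx_ofE _ fl) trmx_mul !mulmxA.
Qed.

End Skew.

Lemma bdot_endo_bivector f h : linear f -> linear h ->
  (forall x y, g p x (f y) = - g p (f x) y) ->
  (forall x y, g p x (h y) = - g p (h x) y) ->
  dot (endo_bivector f) (endo_bivector h) = - 2^-1 * trace (fun x => f (h x)).
Proof.
move=> fl hl fs hs; rewrite bdotE {2}/endo_bivector.
rewrite !mulmxA mulmxKV// -mulmxA mx_of_skew//.
rewrite /endo_bivector trmx_mul trmxK trmx_inv GT mulmxN mulmxA linearN /=.
rewrite mxtrace_mulC !mulmxA mulmxV// mul1mx mulrN mulNr; congr (- (_ * _)).
rewrite (traceC fl hl) trace_mx; congr (\tr _).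
by apply/row_matrixP => i; rewrite row_mul !rowK (mx_ofE _ hl).
Qed.

End Bivectors.


Lemma wedge_linearl (R : realType) (m : nat) (y : 'rV[R]_m) : linear (fun x => wedge x y).
Proof.
by move=> a x x'; apply/matrixP => i j; rewrite !(mxE, big_ord1); ring.
Qed.

Lemma wedgeC (R : realType) (m : nat) (x y : 'rV[R]_m) : wedge y x = - wedge x y.
Proof. by rewrite /wedge opprB. Qed.

Lemma wedge_bivector (R : realType) (m : nat) (x y : 'rV[R]_m) : bivector (wedge x y).
Proof. by rewrite /bivector /wedge linearB /= !trmx_mul !trmxK opprB. Qed.

Lemma bivector_expand (R : realType) (m : nat) (A : 'M[R]_m) : bivector A ->
  A = 2^-1 *: \sum_a \sum_b A a b *: wedge (delta_mx 0 a) (delta_mx 0 b).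
Proof.
move=> bA; have E : \sum_a \sum_b A a b *: wedge (delta_mx 0 a) (delta_mx 0 b) = A - A^T.
  rewrite {2}[A]matrix_sum_delta [in RHS](matrix_sum_delta A^T).
  rewrite [X in _ - X]exchange_big -sumrB; apply: eq_bigr => a _.
  rewrite -sumrB; apply: eq_bigr => b _.
  by rewrite mxE -scalerBr /wedge !trmx_delta !mul_delta_mx.
by rewrite E bA opprK -mulr2n -(scaler_nat 2 A) scalerA mulVf ?scale1r.
Qed.

Section PointCurvature.
Variables (R : realType) (m : nat) (M : manifold R m) (g : metric M).
Variables (phi : 'I_3 -> endo M) (xi : 'I_3 -> vfield M) (eta : 'I_3 -> form1 M).
Variables (alpha delta : R) (alpha0 : alpha != 0).
Variables (h3c : almost_3contact_metric g phi xi eta)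
  (hsasaki : sasaki3_alpha_delta g phi eta alpha delta).
Variables (nabla : vfield M -> vfield M -> vfield M) (LC : levi_civita g nabla).
Variables (Rop : M -> {linear 'M[R]_m -> 'M[R]_m})
  (hRop : curvature_operator g nabla Rop).
Implicit Types (p q : M) (X Y Z W : vfield M) (x y z v : 'rV[R]_m).

(** The curvature on tangent vectors, through their extensions with constant
    coefficients. *)
Definition point_curvature p x y z : 'rV[R]_m :=
  curvature nabla (const_vf p x) (const_vf p y) (const_vf p z) p.
Local Notation Rm := point_curvature.

Lemma point_curvature_Rop p x y z v :
  g p (Rm p x y z) v = - bdot g p (Rop p (wedge x y)) (wedge z v).
Proof.
have s w : smooth_vf p (const_vf p w) by exact/const_vf_smooth/base_dom.
have := hRop.2 p _ _ _ _ (s x) (s y) (s z) (s v).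
by rewrite !const_vf_at => ->; rewrite opprK /riemann const_vf_at.
Qed.

(** The curvature is tensorial: the existence of a curvature operator says that its
    inner products depend on the values of the fields at [p] only. *)
Lemma curvatureE X Y Z p : smooth_vf p X -> smooth_vf p Y -> smooth_vf p Z ->
  curvature nabla X Y Z p = Rm p (X p) (Y p) (Z p).
Proof.
move=> sX sY sZ; apply: (@metric_inj _ _ _ g p) => w; rewrite point_curvature_Rop.
have sw : smooth_vf p (const_vf p w) by exact/const_vf_smooth/base_dom.
have := hRop.2 p _ _ _ _ sX sY sZ sw.
by rewrite !const_vf_at => ->; rewrite opprK /riemann const_vf_at.
Qed.

Lemma point_curvature_linear p y z :
  [/\ linear (fun x => Rm p x y z), linear (fun x => Rm p y x z) &
      linear (fun x => Rm p y z x)].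
Proof.
have [r [rl rr E]] : exists r : 'M[R]_m -> 'M[R]_m -> R,
    [/\ forall C, scalar (r^~ C), forall A, scalar (r A) &
        forall x y z v, g p (Rm p x y z) v = r (wedge x y) (wedge z v)].
  exists (fun A C => - bdot g p (Rop p A) C); split.
  - move=> C a A A'; rewrite (linearP (Rop p)) (bdotC _ _ _ C) bdot_linearr.
    by rewrite !(bdotC _ _ C) opprD mulrN.
  - by move=> A a C C'; rewrite bdot_linearr opprD mulrN.
  - exact: point_curvature_Rop.
have wr w : wedge y w = (-1) *: wedge w y + 0 by rewrite scaleN1r addr0 wedgeC.
have r0 C : r 0 C = 0.
  by have := rl C 1 0 0; rewrite scale1r addr0 mul1r => h; lra.
move: (Rm p) E => T E; split=> a u u'; apply: (@metric_inj _ _ _ g p) => v;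
  rewrite [RHS]metricDl [X in _ = X + _]metricZl.
- by rewrite (E (a *: u + u')) (E u) (E u') (wedge_linearl y a u u') rl.
- rewrite (E y (a *: u + u')) (E y u) (E y u') !wr (wedge_linearl y a u u') !rl r0.
  by ring.
- by rewrite (E y z (a *: u + u')) (E y z u) (E y z u') (wedge_linearl v a u u') rr.
Qed.

Lemma point_curvature_is_curvature i j k p : even_ijk i j k ->
  is_curvature (frame_at g phi xi i j k p) alpha delta (Rm p).
Proof.
move=> e; have s w : smooth_vf_on (dom p) (const_vf p w).
  by move=> q pq; exact: const_vf_smooth.
have Np : dom p p := base_dom p; have oN := open_dom p.
have sxi l : smooth_vf_on (dom p) (xi l) := @smooth_xi _ _ _ _ _ _ _ h3c _ l.
have at_ w : const_vf p w p = w := const_vf_at p w.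
have lin := point_curvature_linear p.
have alg (f : {linear 'rV[R]_m -> 'rV[R]_m}) (a b c t : 'rV[R]_m) :
    t = a + b -> f a + c - f t = c - f b.
  by move=> ->; rewrite linearD opprD addrACA subrr add0r.
have phiE l x y z : in_triple i j k l -> Rm p x y (phi l p z) - phi l p (Rm p x y z)
   = frameQ alpha delta (frame_at g phi xi i j k p) x y (phi l p z)
     - phi l p (frameQ alpha delta (frame_at g phi xi i j k p) x y z).
  move=> li; pose Z' q := phi l q (const_vf p z q).
  have sZ' : smooth_vf_on (dom p) Z' by exact: (smooth_phi h3c).
  have := curvature_adapted alpha0 h3c hsasaki LC oN e (s x) (s y) (s z) Np.
  have := curvature_adapted alpha0 h3c hsasaki LC oN e (s x) (s y) sZ' Np.
  rewrite (adapted_curvature_phi alpha0 h3c hsasaki LC oN e)//.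
  rewrite (curvatureE (s x p Np) (s y p Np) (sZ' p Np)) /Z' !at_ => -> E.
  exact: alg E.
have xiE l x y : in_triple i j k l -> Rm p x y (xi l p)
   = frameQ alpha delta (frame_at g phi xi i j k p) x y (xi l p).
  move=> li.
  have := curvature_adapted alpha0 h3c hsasaki LC oN e (s x) (s y) (sxi l) Np.
  rewrite (adapted_curvature_xi alpha0 h3c hsasaki LC oN e)// add0r.
  by rewrite (curvatureE (s x p Np) (s y p Np) (sxi l p Np)) !at_.
split=> /=.
- by move=> y z; have [] := lin y z.
- by move=> y z; have [] := lin y z.
- by move=> y z; have [] := lin y z.
- by move=> x y z; exact: (curvature_skew LC oN).
- move=> x y z v; have := curvature_metric LC oN Np (s x) (s y) (s z) (s v).
  by rewrite !at_.
- by move=> x y z; exact: (bianchi LC oN).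
- move=> x y z v; have := curvature_pair LC oN Np (s x) (s y) (s z) (s v).
  by rewrite !at_.
- by move=> x y z; apply: phiE; apply: Or31.
- by move=> x y z; apply: phiE; apply: Or32.
- by move=> x y z; apply: phiE; apply: Or33.
- by move=> x y; apply: xiE; apply: Or31.
- by move=> x y; apply: xiE; apply: Or32.
- by move=> x y; apply: xiE; apply: Or33.
Qed.

Lemma Rop_bivector p A z v : bivector A ->
  bdot g p (Rop p A) (wedge z v) = - 2^-1 *
    \sum_a \sum_b A a b * g p (Rm p z v (delta_mx 0 a)) (delta_mx 0 b).
Proof.
move=> bA; rewrite [in LHS](bivector_expand bA).
pose L C := bdot g p (wedge z v) C.
have LE C : bdot g p C (wedge z v) = L C by exact: bdotC.
pose L' : {scalar 'M[R]_m} :=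
  HB.pack L (GRing.isLinear.Build _ _ _ _ _ (bdot_linearr g p (wedge z v))).
rewrite LE -[L]/(L' : _ -> _) !linearZ /= mulNr -mulrN; congr (_ * _).
rewrite -sumrN linear_sum -[L]/(L' : _ -> _) linear_sum; apply: eq_bigr => a _ /=.
rewrite -sumrN linear_sum -[L]/(L' : _ -> _) linear_sum; apply: eq_bigr => b _ /=.
rewrite linearZ -[L]/(L' : _ -> _) linearZ /= -LE -mulrN; congr (_ * _).
have [i [j [k e]]] := even_ijk_exists.
rewrite -[LHS]opprK -point_curvature_Rop.
congr (- _); exact: (Rm_pair (point_curvature_is_curvature p e)).
Qed.

(** By the pair symmetry, the curvature operator contracts the dual bivector of [f]
    with the first pair of arguments of [Rm z v], a contraction which is a trace. *)
Lemma Rop_endo_bivector p f z v : linear f ->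
  (forall x y, g p x (f y) = - g p (f x) y) ->
  bdot g p (Rop p (endo_bivector g p f)) (wedge z v) =
  - 2^-1 * trace (fun x => f (Rm p z v x)).
Proof.
move=> fl fs; rewrite Rop_bivector; last exact: endo_bivectorP.
congr (_ * _); have [_ _ Kl] := point_curvature_linear p z v.
set K := Rm p z v in Kl *.
have -> : trace (fun x => f (K x)) =
    \tr ((endo_bivector g p f)^T *m (mx_of K *m gram (g p))).
  rewrite /endo_bivector trmx_mul trmxK trmx_inv (gram_sym (metricC g p)).
  rewrite -mulmxA mxtrace_mulC -!mulmxA mulmxV ?mulmx1; last first.
    exact: (gram_unit (metric_linear g p) (metricC g p) (@metric_eq0 _ _ _ g p)).
  rewrite (traceC fl Kl) trace_mx; congr (\tr _).
  by apply/row_matrixP => i; rewrite row_mul !rowK (mx_ofE _ Kl).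
rewrite exchange_big; apply: eq_bigr => b _; rewrite mxE.
apply: eq_bigr => a _; rewrite [X in _ = X * _]mxE; congr (_ * _).
rewrite (gramE (metric_linear g p) (metricC g p)) (mx_ofE _ Kl).
have colrow (X : 'M[R]_m) : col b (row a X) 0 0 = X a b by rewrite !mxE.
by rewrite trmx_delta -!mulmxA mulmxA -rowE mulmxA -colE -row_mul colrow.
Qed.

End PointCurvature.


(** * The invariant planes of the curvature operator *)

Section Eigenforms.
Variables (R : realType) (m : nat) (M : manifold R m) (g : metric M).
Variables (phi : 'I_3 -> endo M) (xi : 'I_3 -> vfield M) (eta : 'I_3 -> form1 M).
Variables (alpha delta : R) (alpha0 : alpha != 0).
Variables (h3c : almost_3contact_metric g phi xi eta)
  (hsasaki : sasaki3_alpha_delta g phi eta alpha delta).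
Variables (nabla : vfield M -> vfield M -> vfield M) (LC : levi_civita g nabla).
Variables (Rop : M -> {linear 'M[R]_m -> 'M[R]_m})
  (hRop : curvature_operator g nabla Rop).
Implicit Types (p q : M) (x y z v : 'rV[R]_m) (c l : R).

Local Notation dot p := (bdot g p).
Local Notation Rm := (point_curvature nabla).

Definition Phi_biv i p : 'M[R]_m := endo_bivector g p (phi i p).
Definition xi_biv j k p : 'M[R]_m := wedge (xi j p) (xi k p).

Let HT p : is_trace (g p) (@trace R m) m%:R :=
  trace_is_trace (metric_linear g p) (metricC g p) (@metric_eq0 _ _ _ g p).

Lemma Phi_biv_bivector i p : bivector (Phi_biv i p).
Proof. exact: (endo_bivectorP (linearP (phi i p)) (phi_skew h3c i p)). Qed.

Lemma Phi_bivE i p x y : dot p (Phi_biv i p) (wedge x y) = g p x (phi i p y).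
Proof. exact: (endo_bivectorE (linearP (phi i p)) (phi_skew h3c i p)). Qed.

(** The matrix of the curvature operator on the plane of [Phi_i] and [xi_jk]. *)
Definition coefPP : R := alpha ^+ 2 + (m%:R - 1) * alpha * (delta - alpha).
Definition coefPX : R := - (alpha - delta) ^+ 2.
Definition coefXP : R := 2 * alpha * (alpha - delta).
Definition coefXX : R := 2 * alpha * (alpha - delta) + delta ^+ 2.

Lemma bivector_lin c c' A C : bivector A -> bivector C ->
  bivector (c *: A + c' *: C : 'M[R]_m).
Proof.
by rewrite /bivector => a b; rewrite linearP linearZ /= a b !scalerN opprD.
Qed.

Lemma dot_lin p c c' A A' C :
  dot p (c *: A + c' *: A') C = c * dot p A C + c' * dot p A' C.
Proof.
have d0 : dot p C 0 = 0.
  by have := bdot_linearr g p C 1 0 0; rewrite scale1r addr0 mul1r => h; lra.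
rewrite !(bdotC _ _ _ C) bdot_linearr; congr (_ + _).
by rewrite -[c' *: A']addr0 bdot_linearr d0 addr0.
Qed.

Lemma dot_expand p c c' A X A' X' : dot p (A + c *: X) (A' + c' *: X') =
  dot p A A' + c * dot p X A' + c' * dot p A X' + c * c' * dot p X X'.
Proof.
have E C : dot p (A + c *: X) C = dot p A C + c * dot p X C.
  by have := dot_lin p 1 c A X C; rewrite scale1r mul1r.
have E' C : dot p C (A' + c' *: X') = dot p C A' + c' * dot p C X'.
  have := dot_lin p 1 c' A' X' C; rewrite scale1r mul1r (bdotC _ _ _ C) => ->.
  by rewrite (bdotC _ _ A') (bdotC _ _ X').
by rewrite E !E'; ring.
Qed.

Section Triple.
Variables (i j k : 'I_3) (e : even_ijk i j k).
Let HF p : is_frame (frame_at g phi xi i j k p) := frame_at_frame h3c p e.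
Let HR p := point_curvature_is_curvature alpha0 h3c hsasaki LC hRop p e.

Lemma Rop_Phi p : Rop p (Phi_biv i p) =
  coefPP *: Phi_biv i p + coefPX *: xi_biv j k p.
Proof.
have bP := Phi_biv_bivector i p; have bX : bivector (xi_biv j k p) := wedge_bivector _ _.
apply: (@bivector_inj _ _ _ g p); [exact: hRop.1|exact: bivector_lin|].
move=> z v; rewrite dot_lin Phi_bivE bdot_wedge.
have S := phi_skew h3c i p.
rewrite (Rop_endo_bivector alpha0 h3c hsasaki LC hRop _ _ (linearP (phi i p)) S).
have := tr_f1Rm (HF p) (HT p) (HR p) z v; rewrite (tr_f1Q (HF p) (HT p)) /= => ->.
by rewrite /coefPP /coefPX; field.
Qed.

Lemma Rop_xi p : Rop p (xi_biv j k p) =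
  coefXP *: Phi_biv i p + coefXX *: xi_biv j k p.
Proof.
have bP := Phi_biv_bivector i p; have bX : bivector (xi_biv j k p) := wedge_bivector _ _.
apply: (@bivector_inj _ _ _ g p); [exact: hRop.1|exact: bivector_lin|].
move=> z v; rewrite dot_lin Phi_bivE bdot_wedge.
have := point_curvature_Rop hRop p (xi j p) (xi k p) z v; rewrite -/(xi_biv j k p).
have := Rm_pair (HR p) (xi j p) (xi k p) z v.
rewrite (Rm_x2 (HR p) z v : Rm p z v (xi j p) = _) /=.
rewrite (frameQ_x23 (HF p) alpha delta z v : g p _ (xi k p) = _) /= => -> h.
rewrite -[LHS]opprK -h /coefXP /coefXX; ring.
Qed.

(** The 2-form [Phi_i + c xi_jk]: the forms of the theorem are those for [c = -1]
    and [c = n + 1]. *)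
Definition comb_form c : form2 M := fun p x y =>
  fundamental_form g (phi i) p x y + c * wedge11 (eta j) (eta k) p x y.
Definition comb_biv c p := Phi_biv i p + c *: xi_biv j k p.

Lemma comb_bivE c p x y : dot p (comb_biv c p) (wedge x y) = comb_form c p x y.
Proof.
rewrite /comb_biv -[Phi_biv i p]scale1r dot_lin Phi_bivE bdot_wedge mul1r.
by rewrite /comb_form /wedge11 !(eta_metric h3c) /=; congr (_ + _ * _); ring.
Qed.

Lemma comb_biv_dual c : dual_form2 g (comb_form c) (comb_biv c).
Proof.
move=> p; split; last exact: comb_bivE.
rewrite /comb_biv -[Phi_biv i p]scale1r; apply: bivector_lin.
  exact: Phi_biv_bivector.
exact: wedge_bivector.
Qed.

Lemma comb_biv_uniq c B : dual_form2 g (comb_form c) B -> B = comb_biv c.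
Proof.
move=> dB; apply/funext => p; have [bB BE] := dB p.
have [bC CE] := comb_biv_dual c p.
by apply: (@bivector_inj _ _ _ g p) => // x y; rewrite BE CE.
Qed.

Lemma Rop_comb c p : Rop p (comb_biv c p) =
  (coefPP + c * coefXP) *: Phi_biv i p + (coefPX + c * coefXX) *: xi_biv j k p.
Proof.
rewrite /comb_biv linearD linearZ Rop_Phi Rop_xi.
move: (Phi_biv i p) (xi_biv j k p) => P X.
by apply/matrixP => a b; rewrite !mxE; ring.
Qed.

Lemma comb_form_xi c p : comb_form c p (xi j p) (xi k p) = c - 1.
Proof.
rewrite /comb_form /fundamental_form /wedge11 !(eta_metric h3c).
have H := HF p.
have -> : phi i p (xi k p) = - xi j p := f1x3 H.
rewrite metricNr (g22 H : g p (xi j p) (xi j p) = 1).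
rewrite (g33 H : g p (xi k p) (xi k p) = 1) (g23 H : g p (xi j p) (xi k p) = 0).
by ring.
Qed.

Lemma comb_form_eigen c l : c != 1 -> coefPP + c * coefXP = l ->
  coefPX + c * coefXX = l * c -> eigenform_at g Rop l (comb_form c).
Proof.
move=> c1 E1 E2; exists (comb_biv c); split; first exact: comb_biv_dual.
  have [p _] := manifold_nonempty M; exists p; apply/eqP => B0.
  have := comb_bivE c p (xi j p) (xi k p); rewrite B0 comb_form_xi.
  have := dot_lin p 0 0 0 0 (wedge (xi j p) (xi k p)).
  rewrite !scale0r addr0 !mul0r addr0 => -> /eqP; rewrite eq_sym subr_eq0.
  exact/negP.
by move=> p; rewrite Rop_comb E1 E2 -scalerA -scalerDr.
Qed.

(** A horizontal vector [v] and its image [phi_i v] only see the form [Phi_i], and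
    exist as the dimension is not three.  The pair [xi_j], [xi_k] sees both forms. *)
Lemma comb_form_eigen_inv c l : m%:R != 3 :> R ->
  eigenform_at g Rop l (comb_form c) ->
  coefPP + c * coefXP = l /\ coefPX + c * coefXX = l * c.
Proof.
move=> m3 [B [/comb_biv_uniq -> _ H]].
have [p _] := manifold_nonempty M.
have E x y : (coefPP + c * coefXP) * g p x (phi i p y)
   + (coefPX + c * coefXX) * wedge11 (eta j) (eta k) p x y = l * comb_form c p x y.
  rewrite -comb_bivE -[l * _]addr0 -(mul0r (dot p 0 (wedge x y))) -dot_lin.
  rewrite scaler0 addr0 -H Rop_comb dot_lin Phi_bivE bdot_wedge.
  by rewrite /wedge11 !(eta_metric h3c); congr (_ + _ * _); ring.
have [v [v1 v2 v3] v0] := horizontal_neq0 (HF p) (HT p) m3.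
have El : coefPP + c * coefXP = l.
  have := E (phi i p v) v; rewrite /comb_form /fundamental_form /wedge11.
  have -> : eta j p v = 0 by rewrite (eta_metric h3c).
  have -> : eta k p v = 0 by rewrite (eta_metric h3c).
  rewrite !(mulr0, mul0r, subr0, addr0); apply: mulIf.
  apply/eqP => /(@metric_eq0 _ _ _ g p) fv0; move/eqP: v0; apply.
  apply: oppr_inj; rewrite oppr0; have := f11 (HF p) v.
  by rewrite v1 /= scale0r addr0 fv0 linear0.
split=> //; have := E (xi j p) (xi k p); have := comb_form_xi 0 p.
have := comb_form_xi 1 p; have := comb_form_xi c p; rewrite /comb_form.
rewrite /fundamental_form El.
by move: (g p _ _) (wedge11 _ _ _ _ _) => a b E1 E2 E3 E4; nra.
Qed.

Lemma dot_Phi_Phi p : dot p (Phi_biv i p) (Phi_biv i p) = 2^-1 * (m%:R - 1).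
Proof.
have L := linearP (phi i p); have S := phi_skew h3c i p.
rewrite (bdot_endo_bivector L L S S) (tr_f11 (HF p) (HT p)).
by ring.
Qed.

Lemma dot_Phi_Phi_neq p : dot p (Phi_biv i p) (Phi_biv j p) = 0.
Proof.
have L (o : 'I_3) := linearP (phi o p); have S (o : 'I_3) := phi_skew h3c o p.
rewrite (bdot_endo_bivector (L i) (L j) (S i) (S j)) (tr_f12 (HF p) (HT p)).
by rewrite mulr0.
Qed.

Lemma dot_comb c c' p : dot p (comb_biv c p) (comb_biv c' p) =
  2^-1 * (m%:R - 1) - c - c' + c * c'.
Proof.
have H := HF p; rewrite /comb_biv dot_expand.
rewrite dot_Phi_Phi (bdotC _ _ (xi_biv j k p) (Phi_biv i p)) Phi_bivE bdot_wedge.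
have -> : phi i p (xi k p) = - xi j p := f1x3 H.
rewrite metricNr (g22 H : g p (xi j p) (xi j p) = 1).
rewrite (g33 H : g p (xi k p) (xi k p) = 1) (g23 H : g p (xi j p) (xi k p) = 0).
by ring.
Qed.

End Triple.

Lemma dot_comb_rot i j k c c' p : even_ijk i j k ->
  dot p (comb_biv i j k c p) (comb_biv j k i c' p) = 0.
Proof.
move=> e; have H := frame_at_frame h3c p e.
rewrite /comb_biv dot_expand (dot_Phi_Phi_neq e) (bdotC _ _ (xi_biv j k p) (Phi_biv j p)).
rewrite !Phi_bivE !bdot_wedge.
have -> : phi i p (xi i p) = 0 := f1x1 H.
have -> : phi j p (xi k p) = xi i p := f2x3 H.
have h1 : g p (xi j p) (xi i p) = 0 by rewrite metricC; exact: (g12 H).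
have h2 : g p (xi j p) (xi k p) = 0 := g23 H.
have h3 : g p (xi k p) (xi i p) = 0 := g31 H.
rewrite metric0r h1 h2 h3.
by ring.
Qed.

Lemma comb_orthogonal i j k i' j' k' c c' : even_ijk i j k -> even_ijk i' j' k' ->
  (i = i' -> 2^-1 * (m%:R - 1) - c - c' + c * c' = 0) ->
  orthogonal_form2 g (comb_form i j k c) (comb_form i' j' k' c').
Proof.
move=> e e' E; exists (comb_biv i j k c), (comb_biv i' j' k' c').
split; [exact: comb_biv_dual|exact: comb_biv_dual|move=> p].
have [[hi hj hk]|[-> -> ->]|[-> -> ->]] := even_ijk_cases e e'.
- by rewrite hi hj hk dot_comb// E.
- exact: dot_comb_rot.
- by rewrite bdotC; apply: dot_comb_rot; exact/even_ijk_rot/even_ijk_rot.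
Qed.

Lemma ricci_trace Y Z p : smooth_vf p Y -> smooth_vf p Z ->
  ricci nabla Y Z p = ric (@trace R m) (Rm p) (Y p) (Z p).
Proof.
move=> sY sZ; apply: eq_bigr => i _.
have sc : smooth_vf p (const_vf p (delta_mx 0 i)).
  exact/const_vf_smooth/base_dom.
rewrite -[coord_vf p i]/(const_vf p (delta_mx 0 i)).
by rewrite (curvatureE hRop sc sY sZ) const_vf_at.
Qed.

(** By [ricci_formula] the Ricci tensor has one value on horizontal vectors and one
    on vertical vectors. *)
Lemma einstein_iff : m%:R != 3 :> R ->
  einstein g nabla <->
  vertical_ricci m%:R alpha delta = horizontal_ricci m%:R alpha delta.
Proof.
move=> m3; have [i [j [k e]]] := even_ijk_exists.
have HF p := frame_at_frame h3c p e.
have HR p := point_curvature_is_curvature alpha0 h3c hsasaki LC hRop p e.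
have RE p v w : ric (@trace R m) (Rm p) v w = horizontal_ricci m%:R alpha delta * g p v w
   + (vertical_ricci m%:R alpha delta - horizontal_ricci m%:R alpha delta)
     * (g p (xi i p) v * g p (xi i p) w + g p (xi j p) v * g p (xi j p) w
        + g p (xi k p) v * g p (xi k p) w) := ricci_formula (HF p) (HT p) (HR p) v w.
split=> [[c H]|E].
  have [p _] := manifold_nonempty M.
  have {}H v w : ric (@trace R m) (Rm p) v w = c * g p v w.
    have s x : smooth_vf p (const_vf p x) by exact/const_vf_smooth/base_dom.
    by have := H p _ _ (s v) (s w); rewrite ricci_trace// !const_vf_at.
  have [v [v1 v2 v3] v0] := horizontal_neq0 (HF p) (HT p) m3.
  have {v1 v2 v3 v0} -> : horizontal_ricci m%:R alpha delta = c.
    have := H v v; rewrite RE (v1 : g p (xi i p) v = 0) (v2 : g p (xi j p) v = 0).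
    rewrite (v3 : g p (xi k p) v = 0) mulr0 !addr0 mulr0 addr0; apply: mulIf.
    by rewrite gt_eqF// Defs.metric_pos.
  have := H (xi i p) (xi i p); rewrite RE.
  have h1 : g p (xi j p) (xi i p) = 0 by rewrite metricC; exact: (g12 (HF p)).
  rewrite h1 (g31 (HF p) : g p (xi k p) (xi i p) = 0).
  by rewrite (g11 (HF p) : g p (xi i p) (xi i p) = 1) => h; lra.
exists (vertical_ricci m%:R alpha delta) => p Y Z sY sZ.
by rewrite ricci_trace// RE E subrr mul0r addr0.
Qed.

End Eigenforms.


(** * Eigenforms and the Einstein condition *)

Theorem theorem3p1 (R : realType) (n : nat) (hn : (0 < n)%N)
    (M : manifold R (4 * n + 3)) (g : metric M)
    (phi : 'I_3 -> endo M) (xi : 'I_3 -> vfield M) (eta : 'I_3 -> form1 M)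
    (alpha delta : R) (halpha : alpha != 0)
    (h3c : almost_3contact_metric g phi xi eta)
    (hsasaki : sasaki3_alpha_delta g phi eta alpha delta)
    (nabla : vfield M -> vfield M -> vfield M) (hnabla : levi_civita g nabla)
    (Rop : M -> {linear 'M[R]_(4 * n + 3) -> 'M[R]_(4 * n + 3)})
    (hRop : curvature_operator g nabla Rop) :
  let minus_form i j k : form2 M :=
    fundamental_form g (phi i) - wedge11 (eta j) (eta k) in
  let plus_form i j k : form2 M :=
    fundamental_form g (phi i) + wedge11 (eta j) (eta k) *+ n.+1 in
  let a := forall i j k, even_ijk i j k -> eigenform g Rop (minus_form i j k) in
  let b := forall i j k, even_ijk i j k -> eigenform g Rop (plus_form i j k) in
  let c := delta = alpha \/ delta = (2 * n + 3)%:R * alpha in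
  let d := einstein g nabla in
  [/\ a <-> b, b <-> c, c <-> d,
      delta = alpha ->
        (forall i j k, even_ijk i j k ->
           eigenform_at g Rop (alpha ^+ 2) (minus_form i j k) /\
           eigenform_at g Rop (alpha ^+ 2) (plus_form i j k)) /\
        (forall i j k i' j' k', even_ijk i j k -> even_ijk i' j' k' ->
           orthogonal_form2 g (minus_form i j k) (plus_form i' j' k') /\
           (i != i' ->
              orthogonal_form2 g (minus_form i j k) (minus_form i' j' k') /\
              orthogonal_form2 g (plus_form i j k) (plus_form i' j' k'))) &
      delta = alpha * (2 * n + 3)%:R ->
        forall i j k, even_ijk i j k ->
          eigenform_at g Rop (alpha ^+ 2 * (8 * n ^ 2 + 16 * n + 9)%:R)
                       (minus_form i j k) /\
          eigenform_at g Rop (alpha ^+ 2 * ((2 * n + 1) ^ 2)%:R)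
                       (plus_form i j k)].
Proof.
move=> minus_form plus_form a b c d.
have mE : (4 * n + 3)%:R = 4 * n%:R + 3 :> R by rewrite natrD natrM.
have n0 : 0 < n%:R :> R by rewrite ltr0n.
have m3 : (4 * n + 3)%:R != 3 :> R by rewrite mE; apply/eqP => h; lra.
have cE : (2 * n + 3)%:R = 2 * n%:R + 3 :> R by rewrite natrD natrM.
have minusE i j k : minus_form i j k = comb_form g phi eta i j k (- 1).
  by apply/funext => p; apply/funext => x; apply/funext => y;
    rewrite /comb_form mulN1r.
have plusE i j k : plus_form i j k = comb_form g phi eta i j k (n%:R + 1).
  apply/funext => p; apply/funext => x; apply/funext => y.
  have natE (w : form2 M) l : (w *+ l) p x y = l%:R * w p x y.
    elim: l => [|l IH]; first by rewrite mul0r.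
    by rewrite mulrS -[LHS]/(w p x y + (w *+ l) p x y) IH mulrS mulrDl mul1r.
  by rewrite -[LHS]/(fundamental_form g (phi i) p x y + _ p x y) natE -natr1.
have np1 : n%:R + 1 != 1 :> R by apply/eqP => h; lra.
have nm1 : - 1 != 1 :> R by apply/eqP => h; lra.
have eig i j k x l : even_ijk i j k -> x != 1 ->
    coefPP (4 * n + 3) alpha delta + x * coefXP alpha delta = l ->
    coefPX alpha delta + x * coefXX alpha delta = l * x ->
    eigenform_at g Rop l (comb_form g phi eta i j k x).
  by move=> e; exact: (comb_form_eigen halpha h3c hsasaki hnabla hRop e).
have inv i j k x l : even_ijk i j k ->
    eigenform_at g Rop l (comb_form g phi eta i j k x) ->
    coefPP (4 * n + 3) alpha delta + x * coefXP alpha delta = l /\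
    coefPX alpha delta + x * coefXX alpha delta = l * x.
  by move=> e; exact: (comb_form_eigen_inv halpha h3c hsasaki hnabla hRop e).
rewrite /coefPP /coefXP /coefPX /coefXX mE in eig inv.
have [i0 [j0 [k0 e0]]] := even_ijk_exists.
have cP : (delta - alpha) * (delta - (2 * n%:R + 3) * alpha) = 0 <-> c.
  rewrite /c cE; split=> [/eqP|[->|->]]; [|ring|ring].
  by rewrite mulf_eq0 !subr_eq0 => /orP[]/eqP ->; [left|right].
have ac : a <-> c.
  split=> [/(_ _ _ _ e0) [l]|hc i j k e].
    rewrite minusE => /(inv _ _ _ _ _ e0) [E1 E2]; apply/cP.
    by rewrite -E1 in E2; nra.
  (* The coefficient of [Phi_i] in the image of [Phi_i - xi_jk]. *)
  exists (alpha ^+ 2 + (4 * n%:R + 4) * alpha * (delta - alpha)).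
  rewrite minusE; move/cP: hc => hc.
  by apply: eig => //; [ring|nra].
have bc : b <-> c.
  split=> [/(_ _ _ _ e0) [l]|hc i j k e].
    rewrite plusE => /(inv _ _ _ _ _ e0) [E1 E2]; apply/cP.
    rewrite -E1 in E2; apply: (mulfI (lt0r_neq0 n0)); rewrite mulr0.
    by nra.
  (* The coefficient of [Phi_i] in the image of [Phi_i + (n + 1) xi_jk]. *)
  exists (alpha ^+ 2 + 2 * n%:R * alpha * (delta - alpha)).
  rewrite plusE; move/cP: hc => hc.
  have hc' : n%:R * ((delta - alpha) * (delta - (2 * n%:R + 3) * alpha)) = 0.
    by rewrite hc mulr0.
  by apply: eig => //; [ring|nra].
have cd : c <-> d.
  rewrite -cP /d; rewrite (einstein_iff halpha h3c hsasaki hnabla hRop m3).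
  rewrite /vertical_ricci /horizontal_ricci mE; split=> h; nra.
split=> //; [tauto| |].
- move=> dE; subst delta; split=> [i j k e|i j k i' j' k' e e'].
    by rewrite minusE plusE; split; apply: eig => //; ring.
  have orth := comb_orthogonal h3c e e'; rewrite mE in orth.
  rewrite !minusE !plusE; split; first by apply: orth => _; field.
  by move=> /eqP ne; split; apply: orth.
- move=> dE i j k e; rewrite minusE plusE.
  have q1 : (8 * n ^ 2 + 16 * n + 9)%:R = 8 * n%:R ^+ 2 + 16 * n%:R + 9 :> R.
    by rewrite natrD natrD natrM natrX natrM.
  have q2 : ((2 * n + 1) ^ 2)%:R = (2 * n%:R + 1) ^+ 2 :> R.
    by rewrite natrX natrD natrM.
  rewrite dE cE in eig.
  by rewrite q1 q2; split; apply: eig => //; ring.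
Qed.
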